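(* Let $K$ be a countable field of characteristic $p$, let $U$ be a coherent good set of valuations on $K$, and let $F$ be the field of constants of $U$. Let $\phi:A\to K\{\tau\}$ be a Drinfeld module of positive relative modular transcendence degree over $F$. Then $\phi(K)$ is the direct sum of a finite torsion $A$-submodule and a free $A$-submodule of rank $\aleph_0$.
   Context: Setting: $p$ prime, $q$ a power of $p$, $A$ the ring of functions on a nonsingular projective curve over $\mathbb{F}_q$ regular away from a fixed closed point. $K\{\tau\}$ twisted polynomials with $\tau(x)=x^q$. A Drinfeld module $\phi:A\to K\{\tau\}$ is a ring morphism with $\tau^0$-coefficient of $\phi_a$ equal to $i(a)$ (fixed morphism $i:A\to K$), not all $\phi_a$ of degree $0$ in $\tau$. $\phi(K)$ is $K$ with $A$-action $a\cdot x=\phi_a(x)$. Field of definition of a Drinfeld module: smallest subfield containing all coefficients of all $\phi_a$. For $\gamma\in K^{\mathrm{alg}}\setminus\{0\}$, $\phi^{(\gamma)}$ is the Drinfeld module $a\mapsto\gamma^{-1}\phi_a\gamma$. The relative modular transcendence degree of $\phi$ over a subfield $K_0\subseteq K$ is the minimum over $\gamma\in K^{\mathrm{alg}}\setminus\{0\}$ of the transcendence degree over $K_0$ of the compositum of $K_0$ and the field of definition of $\phi^{(\gamma)}$. Valuations are discrete, normalized with value group $\mathbb{Z}$. A good set of valuations on $K$ is a set $U$ of such valuations with degrees $d:U\to\mathbb{R}_{>0}$ such that each nonzero $x$ has $v(x)\ne0$ for finitely many $v\in U$ and $\sum_{v\in U}d(v)v(x)=0$. Field of constants: $\{0\}\cup\{x:v(x)=0\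 \forall v\in U\}$. A valuation $v$ of $K$ is coherent if for every finite extension $L/K$, $\sum_{w|v}e(w|v)f(w|v)=[L:K]$; then $w|v$ gets degree $d(w)=f(w|v)d(v)/[L:K]$. $U$ is coherent if every $v\in U$ is coherent and for every finite $L/K$ the set of extensions of the valuations of $U$, with these degrees, is a good set of valuations on $L$. *)

(* Defs.v *)
From HB Require Import structures.
From mathcomp Require Import all_boot all_order all_algebra all_field.
From mathcomp Require Import mpoly.
From mathcomp Require Import boolp classical_sets functions cardinality fsbigop.
From mathcomp Require Import reals.

Set Implicit Arguments.
Unset Strict Implicit.
Unset Printing Implicit Defensive.

Import Order.TTheory GRing.Theory Num.Theory.

Local Open Scope classical_set_scope.
Local Open Scope card_scope.
Local Open Scope ring_scope.

(* The convention 0^-1 = 0 makes the last clause unproblematic at y = 0. *)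
Definition subfield (L : fieldType) (S : set L) : Prop :=
  [/\ S 1, forall x y, S x -> S y -> S (x - y)
    & forall x y, S x -> S y -> S (x / y)].

Definition gen_subfield (L : fieldType) (S : set L) : set L :=
  smallest (@subfield L) S.

Definition algebraic_over (L : fieldType) (S : set L) (x : L) : Prop :=
  exists P : {poly L}, [/\ P != 0, forall j, S P`_j & root P x].

Definition alg_indep (L : fieldType) (S B : set L) : Prop :=
  forall (n : nat) (b : 'I_n -> L), injective b -> (forall j, B (b j)) ->
  forall P : {mpoly L[n]}, (forall m, S P@_m) -> P.@[b] = 0 -> P = 0.

Definition transcendence_basis (L : fieldType) (S M B : set L) : Prop :=
  [/\ B `<=` M, alg_indep S B
    & forall x, M x -> algebraic_over (gen_subfield (S `|` B)) x].

(* The value at 0 (mathematically +oo) is the junk value 0; fixing it makes two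
   valuations equal as functions iff they are equal as valuations. *)
Record dvaluation (k : fieldType) (v : k -> int) : Prop := DValuation {
  dval0 : v 0 = 0;
  dvalM : forall x y, x != 0 -> y != 0 -> v (x * y) = v x + v y;
  dvalD : forall x y, x != 0 -> y != 0 -> x + y != 0 ->
    Num.min (v x) (v y) <= v (x + y);
  dval_surj : forall n : int, exists2 x, x != 0 & v x = n }.

Definition vring (k : fieldType) (v : k -> int) : set k :=
  [set x | x = 0 \/ 0 <= v x].

Definition vmaxideal (k : fieldType) (v : k -> int) : set k :=
  [set x | x = 0 \/ 0 < v x].

Section Extensions.
Variables (k : fieldType) (L : fieldExtType k).
Implicit Types (v : k -> int) (w : L -> int).

Definition ramified_by w v (e : nat) : Prop :=
  (0 < e)%N /\ forall x : k, w x%:A = v x *+ e.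

Definition lies_over w v : Prop := exists e, ramified_by w v e.

Definition ram_index w v : nat := xget 0%N [set e | ramified_by w v e].

(* The classes of the b_j form a basis of the residue field of w over the
   residue field of v. *)
Definition residue_basis w v (n : nat) (b : 'I_n -> L) : Prop :=
  [/\ forall j, vring w (b j),
      forall c : 'I_n -> k, (forall j, vring v (c j)) ->
        vmaxideal w (\sum_j c j *: b j) -> forall j, vmaxideal v (c j)
    & forall y, vring w y -> exists2 c : 'I_n -> k,
        forall j, vring v (c j) & vmaxideal w (y - \sum_j c j *: b j)].

Definition res_degree w v : nat :=
  xget 0%N [set n | exists b : 'I_n -> L, residue_basis w v b].

Definition extensions v : set (L -> int) :=
  [set w | dvaluation w /\ lies_over w v].

Definition extensions_of_set (U : set (k -> int)) : set (L -> int) :=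
  [set w | exists2 v, U v & extensions v w].

(* The normalized valuation of k below w is unique, so xget does not make an
   actual choice. *)
Definition ext_degree (R : realType) (U : set (k -> int)) (d : (k -> int) -> R)
    (w : L -> int) : R :=
  let v := xget (fun=> 0) [set v | U v /\ lies_over w v] in
  (res_degree w v)%:R * d v / (\dim {:L})%:R.

End Extensions.

(* The sum over a set is a finite-support sum, 0 by convention when the support
   is infinite; as the right-hand side is nonzero, the equation includes the
   finiteness of the number of extensions. *)
Definition coherent_val (k : fieldType) (v : k -> int) : Prop :=
  forall L : fieldExtType k,
    (\sum_(w \in @extensions k L v) (ram_index w v * res_degree w v)%N)
      = \dim {:L}.

Record good_set (R : realType) (k : fieldType) (U : set (k -> int))
    (d : (k -> int) -> R) : Prop := GoodSet {
  good_val : forall v, U v -> dvaluation v;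
  good_deg_gt0 : forall v, U v -> 0 < d v;
  good_finite : forall x, x != 0 -> finite_set [set v | U v /\ v x != 0];
  good_sum : forall x, x != 0 -> \sum_(v \in U) d v * (v x)%:~R = 0 }.

Definition coherent_good_set (R : realType) (k : fieldType)
    (U : set (k -> int)) (d : (k -> int) -> R) : Prop :=
  [/\ good_set U d, forall v, U v -> coherent_val v
    & forall L : fieldExtType k,
        good_set (@extensions_of_set k L U) (@ext_degree k L R U d)].

Definition field_of_constants (k : fieldType) (U : set (k -> int)) : set k :=
  [set x | x = 0 \/ forall v, U v -> v x = 0].

(* A nonsingular projective (irreducible) curve over k is given by its function
   field E: a finitely generated extension of k of transcendence degree 1. Its
   closed points are the discrete valuations of E/k; when k is finite, every
   discrete valuation is trivial on k. *)
Definition curve_function_field (k E : fieldType) (iE : {rmorphism k -> E}) :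
    Prop :=
  exists t : E, ~ algebraicOver iE t /\
  exists (n : nat) (b : 'I_n -> E), forall y, exists2 c : 'I_n -> E,
    forall j, gen_subfield (range iE `|` [set t]) (c j) & y = \sum_j c j * b j.

Section RegularFunctions.
Variables (E : fieldType) (infty : E -> int).

Definition regular_away (f : E) : bool :=
  `[< forall v : E -> int, dvaluation v -> v <> infty -> vring v f >].

Lemma dval1 (k : fieldType) (v : k -> int) : dvaluation v -> v 1 = 0.
Proof.
move=> hv; have := dvalM hv (oner_neq0 k) (oner_neq0 k).
by rewrite mulr1 -[X in X = _]addr0 => /addrI /esym.
Qed.

Lemma dvalN (k : fieldType) (v : k -> int) x : dvaluation v -> v (- x) = v x.
Proof.
move=> hv; have [->|x0] := eqVneq x 0; first by rewrite oppr0.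
have N1 : (-1 : k) != 0 by rewrite oppr_eq0 oner_neq0.
suff h : v (-1) = 0 by rewrite -mulN1r (dvalM hv) // h add0r.
have := dvalM hv N1 N1; rewrite mulrNN mulr1 (dval1 hv) -mulr2n => /esym/eqP.
by rewrite mulrn_eq0 => /eqP.
Qed.

Lemma regular_away_subring : subring_closed regular_away.
Proof.
split=> [|x y|x y].
- by apply/asboolP => v hv _; right; rewrite (dval1 hv).
- move=> /asboolP hx /asboolP hy; apply/asboolP => v hv vi.
  have [->|x0] := eqVneq x 0.
    rewrite sub0r; case: (hy v hv vi) => [->|h]; first by left; rewrite oppr0.
    by right; rewrite (dvalN _ hv).
  have [->|y0] := eqVneq y 0; first by rewrite subr0; exact: hx.
  have [->|xy0] := eqVneq (x - y) 0; first by left.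
  case: (hx v hv vi) => [/eqP|hvx]; first by rewrite (negPf x0).
  case: (hy v hv vi) => [/eqP|hvy]; first by rewrite (negPf y0).
  right; have Ny0 : - y != 0 by rewrite oppr_eq0.
  by apply: le_trans (dvalD hv x0 Ny0 xy0); rewrite (dvalN _ hv) le_min hvx.
- move=> /asboolP hx /asboolP hy; apply/asboolP => v hv vi.
  case: (hx v hv vi) => [->|hvx]; first by left; rewrite mul0r.
  case: (hy v hv vi) => [->|hvy]; first by left; rewrite mulr0.
  have [->|x0] := eqVneq x 0; first by left; rewrite mul0r.
  have [->|y0] := eqVneq y 0; first by left; rewrite mulr0.
  by right; rewrite (dvalM hv) // addr_ge0.
Qed.

HB.instance Definition _ :=
  GRing.isSubringClosed.Build E regular_away regular_away_subring.

Record function_ring := FunctionRing {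
  fun_val : E;
  fun_valP : regular_away fun_val }.

HB.instance Definition _ := [isSub for fun_val].
HB.instance Definition _ := [Choice of function_ring by <:].
HB.instance Definition _ := [SubChoice_isSubComNzRing of function_ring by <:].

End RegularFunctions.

Section QFrobenius.
Variables (k : fieldType) (p m : nat) (chk : p \in [pchar k]).

Definition qfrob of p \in [pchar k] := fun x : k => x ^+ (p ^ m).

Let pnat_pm : ([pchar k]).-nat (p ^ m)%N.
Proof.
rewrite pnatX; apply/orP; left.
by rewrite pnatE //; exact: pcharf_prime chk.
Qed.

Lemma qfrob_zmod_morphism : zmod_morphism (qfrob chk).
Proof. by move=> x y; rewrite /qfrob exprDn_pchar // exprNn_pchar. Qed.

Lemma qfrob_monoid_morphism : monoid_morphism (qfrob chk).
Proof. by split=> [|x y]; rewrite /qfrob ?expr1n ?exprMn. Qed.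

HB.instance Definition _ :=
  GRing.isZmodMorphism.Build k k (qfrob chk) qfrob_zmod_morphism.
HB.instance Definition _ :=
  GRing.isMonoidMorphism.Build k k (qfrob chk) qfrob_monoid_morphism.

End QFrobenius.

Section SemilinearEval.
Variables (k : fieldType) (sigma : {rmorphism k -> k}) (V : lmodType k).
Variable t : V -> V.
Hypothesis tD : forall u v, t (u + v) = t u + t v.
Hypothesis tZ : forall c u, t (c *: u) = sigma c *: t u.

Definition semilin_eval (P : {poly k}) (v : V) : V :=
  \sum_(j < size P) P`_j *: iter j t v.

Lemma semilin_evalE n (P : {poly k}) v : (size P <= n)%N ->
  semilin_eval P v = \sum_(j < n) P`_j *: iter j t v.
Proof.
move=> le; rewrite /semilin_eval.
rewrite (big_ord_widen n (fun j => P`_j *: iter j t v) le) big_mkcond /=.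
apply: eq_bigr => j _; case: ltnP => // h.
by rewrite nth_default // scale0r.
Qed.

Lemma semilin_evalDl P Q v :
  semilin_eval (P + Q) v = semilin_eval P v + semilin_eval Q v.
Proof.
have le := size_polyD P Q.
rewrite (semilin_evalE v le) (semilin_evalE v (leq_maxl (size P) (size Q))).
rewrite (semilin_evalE v (leq_maxr (size P) (size Q))) -big_split /=.
by apply: eq_bigr => j _; rewrite coefD scalerDl.
Qed.

Lemma semilin_evalZ c P v : semilin_eval (c *: P) v = c *: semilin_eval P v.
Proof.
rewrite (semilin_evalE v (size_scale_leq c P)) scaler_sumr.
by apply: eq_bigr => j _; rewrite coefZ scalerA.
Qed.

Lemma semilin_eval0 v : semilin_eval 0 v = 0.
Proof. by rewrite /semilin_eval size_poly0 big_ord0. Qed.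

Lemma iter_semilinD j u v : iter j t (u + v) = iter j t u + iter j t v.
Proof. by elim: j => //= j ->. Qed.

Lemma semilin_evalDr P u v :
  semilin_eval P (u + v) = semilin_eval P u + semilin_eval P v.
Proof.
rewrite -big_split /=; apply: eq_bigr => j _.
by rewrite iter_semilinD scalerDr.
Qed.

Lemma semilin_eval1 v : semilin_eval 1 v = v.
Proof. by rewrite /semilin_eval size_poly1 big_ord1 coefC /= scale1r. Qed.

Lemma semilin_sum n (F : 'I_n -> V) : t (\sum_j F j) = \sum_j t (F j).
Proof.
have t0 : t 0 = 0 by have := tZ 0 0; rewrite rmorph0 !scale0r.
exact: (big_morph t tD t0).
Qed.

End SemilinearEval.

Section TwistedPolynomials.
Variables (k : fieldType) (sigma : {rmorphism k -> k}).

(* Left multiplication by tau: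
   tau (sum_j c_j tau^j) = sum_j sigma (c_j) tau^(j+1). *)
Definition tau_mul (P : {poly k}) : {poly k} := map_poly sigma P * 'X.

Lemma tau_mulD P Q : tau_mul (P + Q) = tau_mul P + tau_mul Q.
Proof. by rewrite /tau_mul rmorphD mulrDl. Qed.

Lemma tau_mulZ c P : tau_mul (c *: P) = sigma c *: tau_mul P.
Proof. by rewrite /tau_mul map_polyZ scalerAl. Qed.

Definition tmul (P Q : {poly k}) : {poly k} :=
  \sum_(j < size P) P`_j *: iter j tau_mul Q.

Definition tpoly_eval (P : {poly k}) (x : k) : k :=
  \sum_(j < size P) P`_j * iter j sigma x.

Lemma semilin_eval_tau (V : lmodType k) (t : V -> V) (P : {poly k}) v :
  (forall u v, t (u + v) = t u + t v) ->
  (forall c u, t (c *: u) = sigma c *: t u) ->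
  semilin_eval t (tau_mul P) v = t (semilin_eval t P v).
Proof.
move=> tD tZ; rewrite (semilin_sum tD tZ).
have le : (size (tau_mul P) <= (size P).+1)%N.
  rewrite /tau_mul; apply: leq_trans (size_polyMleq _ _) _.
  by rewrite size_polyX addn2 /= ltnS size_poly.
rewrite (semilin_evalE t v le) big_ord_recl coefMX /= scale0r add0r.
by apply: eq_bigr => j _; rewrite coefMX /= coef_map tZ.
Qed.

Lemma semilin_eval_tmul (V : lmodType k) (t : V -> V) P Q v :
  (forall u v, t (u + v) = t u + t v) ->
  (forall c u, t (c *: u) = sigma c *: t u) ->
  semilin_eval t (tmul P Q) v = semilin_eval t P (semilin_eval t Q v).
Proof.
move=> tD tZ; rewrite [RHS]/semilin_eval /tmul.
rewrite (big_morph (fun S => semilin_eval t S v)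
  (fun S S' => semilin_evalDl t S S' v) (semilin_eval0 t v)).
apply: eq_bigr => j _; rewrite semilin_evalZ; congr (_ *: _).
by elim: (j : nat) => //= n <-; rewrite semilin_eval_tau.
Qed.

(* The ring k{tau} with tau c = sigma(c) tau: the polynomial sum_j c_j 'X^j
   stands for sum_j c_j tau^j, so only the multiplication differs from that of
   {poly k}. *)
Definition tpoly of {rmorphism k -> k} : Type := {poly k}.

HB.instance Definition _ := GRing.Zmodule.copy (tpoly sigma) {poly k}.

Let one_tpoly : tpoly sigma := (1 : {poly k}).

Let tmulA : associative (tmul : tpoly sigma -> tpoly sigma -> tpoly sigma).
Proof.
move=> P Q S; symmetry.
exact: (semilin_eval_tmul P Q S tau_mulD tau_mulZ).
Qed.

Let tmul1l : left_id one_tpoly tmul.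
Proof. by move=> P; exact: (semilin_eval1 tau_mul P). Qed.

Let tmul1r : right_id one_tpoly tmul.
Proof.
move=> P; rewrite -[RHS]coefK poly_def; apply: eq_bigr => j _.
congr (_ *: _); elim: (j : nat) => [|n IHn] /=; first by rewrite expr0.
by rewrite IHn /tau_mul map_polyXn exprSr.
Qed.

Let tmulDl :
  left_distributive (tmul : tpoly sigma -> tpoly sigma -> tpoly sigma) +%R.
Proof. by move=> P Q S; exact: (semilin_evalDl tau_mul P Q S). Qed.

Let tmulDr :
  right_distributive (tmul : tpoly sigma -> tpoly sigma -> tpoly sigma) +%R.
Proof. by move=> P Q S; exact: (semilin_evalDr tau_mulD P Q S). Qed.

Let one_tpoly_neq0 : one_tpoly != 0.
Proof. exact: (oner_neq0 {poly k}). Qed.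

HB.instance Definition _ := GRing.Zmodule_isNzRing.Build (tpoly sigma)
  tmulA tmul1l tmul1r tmulDl tmulDr one_tpoly_neq0.

Definition tconst (c : k) : tpoly sigma := c%:P.

Definition tcoef (P : tpoly sigma) (j : nat) : k := (P : {poly k})`_j.

Definition tsize (P : tpoly sigma) : nat := size (P : {poly k}).

End TwistedPolynomials.

(* tsize is one more than the degree in tau. *)
Definition is_drinfeld_module (A : comNzRingType) (k : fieldType)
    (sigma : {rmorphism k -> k}) (i : {rmorphism A -> k})
    (phi : {rmorphism A -> tpoly sigma}) : Prop :=
  (forall a, tcoef (phi a) 0 = i a) /\ (exists a, (1 < tsize (phi a))%N).

Section DrinfeldAction.
Variables (A : comNzRingType) (k : fieldType) (sigma : {rmorphism k -> k}).
Variable phi : {rmorphism A -> tpoly sigma}.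

(* The A-module phi(k): the additive group of k with a . x = phi_a(x), where
   tau acts on k as sigma. *)
Definition drinfeld_points of {rmorphism A -> tpoly sigma} : Type := k.

Local Notation M := (drinfeld_points phi).

HB.instance Definition _ := GRing.Zmodule.copy M k.

Definition drinfeld_act (a : A) (x : M) : M := tpoly_eval sigma (phi a) x.

Let sigmaD (u v : k^o) : (sigma (u + v) : k^o) = sigma u + sigma v.
Proof. exact: rmorphD. Qed.

Let sigmaZ (c : k) (u : k^o) :
  (sigma (c *: u) : k^o) = sigma c *: (sigma u : k^o).
Proof. exact: rmorphM. Qed.

Let act_mul a b x : drinfeld_act a (drinfeld_act b x) = drinfeld_act (a * b) x.
Proof.
rewrite /drinfeld_act rmorphM; symmetry.
exact: (semilin_eval_tmul (V := k^o) (phi a) (phi b) x sigmaD sigmaZ).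
Qed.

Let act_1 : left_id 1 drinfeld_act.
Proof.
move=> x; rewrite /drinfeld_act rmorph1.
exact: (semilin_eval1 (V := k^o) sigma x).
Qed.

Let act_Dr : right_distributive drinfeld_act +%R.
Proof.
move=> a x y; exact: (semilin_evalDr (V := k^o) sigmaD (phi a) x y).
Qed.

Let act_Dl x : {morph drinfeld_act^~ x : a b / a + b}.
Proof.
move=> a b; rewrite /drinfeld_act rmorphD.
exact: (semilin_evalDl (V := k^o) sigma (phi a) (phi b) x).
Qed.

HB.instance Definition _ :=
  GRing.Zmodule_isLmodule.Build A M act_mul act_1 act_Dr act_Dl.

End DrinfeldAction.

Definition field_of_definition (A : Type) (L : fieldType)
    (sigma : {rmorphism L -> L}) (psi : A -> tpoly sigma) : set L :=
  gen_subfield [set c | exists a j, c = tcoef (psi a) j].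

Section ModularTranscendenceDegree.
Variables (A : comNzRingType) (K L : fieldType).
Variables (sigma : {rmorphism K -> K}) (sigmaL : {rmorphism L -> L}).
Variables (j : {rmorphism K -> L}) (phi : A -> tpoly sigma).

Definition isom_twist (gamma : L) (a : A) : tpoly sigmaL :=
  tconst sigmaL gamma^-1 * (map_poly j (phi a) : tpoly sigmaL)
    * tconst sigmaL gamma.

Definition twist_field (K0 : set K) (gamma : L) : set L :=
  gen_subfield (j @` K0 `|` field_of_definition (isom_twist gamma)).

(* The relative modular transcendence degree of phi over K0 is the cardinality
   of B: B is a transcendence basis for some gamma, of least cardinality among
   all transcendence bases for all gamma. *)
Definition has_rel_mod_trdeg (K0 : set K) (B : set L) : Prop :=
  (exists2 gamma, gamma != 0
     & transcendence_basis (j @` K0) (twist_field K0 gamma) B) /\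
  (forall gamma B', gamma != 0 ->
     transcendence_basis (j @` K0) (twist_field K0 gamma) B' -> B #<= B').

Definition pos_rel_mod_trdeg (K0 : set K) : Prop :=
  exists2 B, has_rel_mod_trdeg K0 B & B !=set0.

End ModularTranscendenceDegree.

Section Modules.
Variables (A : comNzRingType) (M : lmodType A).
Implicit Types S T G : set M.

Definition submodule S : Prop :=
  [/\ S 0, forall x y, S x -> S y -> S (x + y)
    & forall a x, S x -> S (a *: x)].

Definition torsion_set S : Prop :=
  forall x, S x -> exists2 a : A, a != 0 & a *: x = 0.

Definition free_of_rank_aleph0 S : Prop :=
  exists e : nat -> M,
  [/\ forall n, S (e n),
      forall n (c : 'I_n -> A), \sum_j c j *: e j = 0 -> forall j, c j = 0
    & forall x, S x -> exists n (c : 'I_n -> A), x = \sum_j c j *: e j].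

Definition internal_direct_sum S T : Prop :=
  S `&` T = [set 0] /\ forall x, exists y z, [/\ S y, T z & x = y + z].

End Modules.

(* Main.v *)
(** Let f = phi_t for some t in A of degree r >= 2 in tau, and Q = q^r.

    Rescaling f to be monic, its normalized coefficients are not all constants,
    since the relative modular transcendence degree is positive; hence one of
    them has a pole at some place of U, and finitely many places are bad in this
    sense.  The canonical height h is subadditive and satisfies h(f x) = Q h(x).
    At a good place a small height means integrality; at a bad place it forces x
    into finitely many classes modulo elements of positive normalized valuation,
    because one iteration of f already detects the points escaping to infinity.
    By the product formula, two points of small height in the same classes
    coincide, so that {h < eps} is finite for some eps > 0.

    An F_q[t]-module with such a height is tame: the elements dependent on a
    finite set form a finitely generated module.  Applied to phi(K), and to A
    itself embedded in phi(K), this gives that torsion is finite, that A is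
    finite over F_q[t], and that submodules of finite rank are finitely
    generated over A.

    The ring A is a Pruefer domain: for a, b in A there is s with s b in A a and
    (1 - s) a in A b.  Together with the finiteness of A / b A, this makes every
    element part of a free saturated submodule of rank 2 modulo any saturated
    submodule of finite rank, so a basis of a complement of the torsion is built
    two elements at a time. *)

Require Import Defs.
From HB Require Import structures.
From mathcomp Require Import all_boot all_order all_algebra all_field.
From mathcomp Require Import mpoly.
From mathcomp Require Import boolp classical_sets functions cardinality fsbigop.
From mathcomp Require Import reals.
From mathcomp Require Import ring lra zify.

Set Implicit Arguments.
Unset Strict Implicit.
Unset Printing Implicit Defensive.

Import Order.TTheory GRing.Theory Num.Theory.

Local Open Scope classical_set_scope.
Local Open Scope ring_scope.

(** The element t is a square in A, so that r >= 2. Then q^r - q^j >= 2 for j < r, whereas q = 2 and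
    r = 1 would leave a gap of 1. At a bad place this margin separates the growth caused by a
    coefficient of f from the bound imposed on f x. It also gives Q >= 3, so that in P(t) x the
    leading term outweighs the others.

    The factor that makes f monic lies only in an algebraic closure; multiplying valuations by q^r -
    1 keeps all estimates in K.

    Infinite rank does not come from the height. A pole of f z of high order has its order in one
    residue class modulo q^r, so K / f K is infinite, whereas a finitely generated F_q[t]-module is
    finite modulo t. The same fact yields a point x0 of nonzero height, and a -> a x0 embeds A.

    The complement must be free, although a saturated extension of rank 1 may look like a
    non-principal ideal. Its class is cancelled by a second summand of rank 1: an idempotent 2 x 2
    matrix describes the first, and the complementary idempotent supplies the second. *)

Section TrivialExtension.
Variables (A : comNzRingType) (M : lmodType A).

Definition triv_ext : Type := (A * M)%type.
HB.instance Definition _ := GRing.Zmodule.copy triv_ext (A * M)%type.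

Implicit Types x y z : triv_ext.

Let te_mul x y : triv_ext := (x.1 * y.1, x.1 *: y.2 + y.1 *: x.2).
Let te_one : triv_ext := (1, 0).

Let te_mulA : associative te_mul.
Proof.
move=> [a x] [b y] [c z]; rewrite /te_mul /=; congr pair; first exact: mulrA.
rewrite !scalerDr !scalerA -!addrA; congr (_ + _).
by rewrite (mulrC a c) (mulrC c b).
Qed.

Let te_mulC : commutative te_mul.
Proof. by move=> [a x] [b y]; rewrite /te_mul /= mulrC addrC. Qed.

Let te_mul1 : left_id te_one te_mul.
Proof.
by move=> [a x]; rewrite /te_mul /= mul1r scale1r scaler0 addr0.
Qed.

Let te_mulDl : left_distributive te_mul +%R.
Proof.
move=> [a x] [b y] [c z]; rewrite /te_mul /=; congr pair; first exact: mulrDl.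
by rewrite scalerDl scalerDr addrACA.
Qed.

Let te_one_neq0 : te_one != 0.
Proof. by apply/eqP => -[/eqP]; rewrite oner_eq0. Qed.

HB.instance Definition _ := GRing.Zmodule_isComNzRing.Build triv_ext
  te_mulA te_mulC te_mul1 te_mulDl te_one_neq0.

Definition te_scalar (a : A) : triv_ext := (a, 0).
Definition te_vector (x : M) : triv_ext := (0, x).

Let te_scalar_zmod : zmod_morphism te_scalar.
Proof. by move=> a b; congr pair; rewrite subr0. Qed.

Let te_scalar_monoid : monoid_morphism te_scalar.
Proof.
split=> // a b; congr pair.
by rewrite /= !scaler0 addr0.
Qed.

HB.instance Definition _ :=
  GRing.isZmodMorphism.Build A triv_ext te_scalar te_scalar_zmod.
HB.instance Definition _ :=
  GRing.isMonoidMorphism.Build A triv_ext te_scalar te_scalar_monoid.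

Lemma te_vectorD (x y : M) : te_vector (x + y) = te_vector x + te_vector y.
Proof. by congr pair; rewrite addr0. Qed.

Lemma te_vectorN (x : M) : te_vector (- x) = - te_vector x.
Proof. by congr pair; rewrite oppr0. Qed.

Lemma te_vector0 : te_vector 0 = 0.
Proof. by []. Qed.

Lemma te_vectorZ a (x : M) : te_vector (a *: x) = te_scalar a * te_vector x.
Proof. by congr pair; rewrite /= ?mulr0 // scale0r addr0. Qed.

Lemma te_vector_inj : injective te_vector.
Proof. by move=> x y []. Qed.

End TrivialExtension.

(* An identity in a module is decided by [ring] in the commutative ring A + M
   in which M is an ideal of square zero. *)
Ltac module :=
  apply: te_vector_inj; rewrite ?(te_vectorD, te_vectorN, te_vector0, te_vectorZ);
  ring.

(** * Finiteness of a set up to a relation *)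

Section FiniteClasses.
Variable V : zmodType.
Implicit Types (W : set V) (r : V -> V -> Prop).

(** A finite colouring in place of a quotient: [r] need not be an equivalence relation, and
    conjunctions of relations are handled by product colourings. *)
Definition finite_classes W r := exists (T : finType) (c : V -> T),
  forall x y, W x -> W y -> c x = c y -> r x y.

Lemma finite_classes_reps W r : finite_classes W r ->
  exists2 s : seq V, {in s, forall x, W x} &
    forall x, W x -> exists2 y, y \in s & r x y.
Proof.
move=> [T [c cP]].
pose rep w := xget 0 [set x | W x /\ c x = w].
exists [seq rep w | w <- enum T & `[< exists x, W x /\ c x = w >]].
  move=> _ /mapP [w + ->]; rewrite mem_filter => /andP [/asboolP [x xP] _].
  by rewrite /rep; case: xgetP => [y _ [] //|/(_ x) []].
move=> x Wx; exists (rep (c x)).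
  apply/mapP; exists (c x) => //; rewrite mem_filter mem_enum andbT.
  by apply/asboolP; exists x.
rewrite /rep; case: xgetP => [y _ [Wy e]|/(_ x) []//].
exact: cP.
Qed.

Lemma finite_classes_seq W r (u : nat -> V) : finite_classes W r ->
  (forall n, W (u n)) -> exists a b, (a < b)%N /\ r (u b) (u a).
Proof.
move=> [T [c cP]] Wu.
have : ~~ injectiveb (fun a : 'I_#|T|.+1 => c (u a)).
  apply/negP => /injectiveP /leq_card; by rewrite card_ord ltnn.
move=> /injectivePn [a [b ab e]].
have [lt|le] := ltnP a b.
  by exists a, b; split => //; apply: cP => //; rewrite e.
exists b, a; split; last by apply: cP.
by rewrite ltn_neqAle le andbT eq_sym.
Qed.

Lemma finite_classesS W W' r r' : W' `<=` W -> (forall x y, r x y -> r' x y) ->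
  finite_classes W r -> finite_classes W' r'.
Proof.
move=> sW rr [T [c cP]]; exists T, c => x y Wx Wy e.
by apply: rr; apply: cP => //; apply: sW.
Qed.

Lemma finite_classesI W W' r r' : finite_classes W r -> finite_classes W' r' ->
  finite_classes (W `&` W') (fun x y => r x y /\ r' x y).
Proof.
move=> [T [c cP]] [T' [c' cP']].
exists (T * T')%type, (fun x => (c x, c' x)) => x y [Wx Wx'] [Wy Wy'] [e e'].
by split; [exact: cP | exact: cP'].
Qed.

(** The inductive step along a filtration: colour x by the translate chosen for it and by the colour
    of its remainder in [W']. *)
Lemma finite_classes_translate W W' (r : V -> V -> Prop) (s : seq V) :
  (forall x, W x -> exists2 y, y \in s & W' (x - y)) ->
  (forall x y z, r (x - z) (y - z) -> r x y) ->
  finite_classes W' r -> finite_classes W r.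
Proof.
move=> cov rT [T [c cP]].
pose y x := xget 0 [set y | y \in s /\ W' (x - y)].
have yP x : W x -> y x \in s /\ W' (x - y x).
  move=> /cov [z zs Wz]; rewrite /y; case: xgetP => [z' _ //|/(_ z) []].
  by split.
exists ('I_(size s).+1 * T)%type, (fun x => (inord (index (y x) s), c (x - y x))).
move=> x x' Wx Wx' [ey ec].
have [ys Wy] := yP _ Wx; have [ys' Wy'] := yP _ Wx'.
have {}ey : y x = y x'.
  have := congr1 val ey; rewrite /= !inordK ?ltnS ?index_size // => e.
  by rewrite -[LHS](nth_index 0 ys) e nth_index.
by rewrite ey in Wy ec; apply: (rT _ _ (y x')); exact: cP.
Qed.

(** A separated list of greatest length is a net: an element unrelated to all its members could be
    prepended. *)
Lemma reps_of_bound W r (n : nat) :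
  (forall s : seq V, {in s, forall x, W x} -> pairwise (fun x y => `[< ~ r y x >]) s ->
     (size s <= n)%N) ->
  exists2 s : seq V, {in s, forall x, W x} &
    forall x, W x -> exists2 y, y \in s & r y x.
Proof.
move=> bnd; pose P k := `[< exists2 s : seq V, {in s, forall x, W x} &
  pairwise (fun x y => `[< ~ r y x >]) s /\ size s = k >].
have P0 : exists k, P k by exists 0%N; apply/asboolP; exists [::].
have Pn k : P k -> (k <= n)%N.
  by move=> /asboolP [s sW [sp <-]]; exact: bnd.
case: (ex_maxnP P0 Pn) => k /asboolP [s sW [sp sk]] kmax.
exists s => // x Wx; apply: contrapT => nx.
suff /kmax : P k.+1 by rewrite ltnn.
apply/asboolP; exists (x :: s).
  by move=> y; rewrite inE => /orP [/eqP ->//|]; exact: sW.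
split; last by rewrite /= sk.
rewrite /= sp andbT; apply/allP => y ys; apply/asboolP => h.
by apply: nx; exists y.
Qed.

End FiniteClasses.

(** * Spans and pure closures over a subring *)

Definition subring_set (A : comNzRingType) (C : set A) :=
  [/\ C 1, forall x y, C x -> C y -> C (x - y)
    & forall x y, C x -> C y -> C (x * y)].

Definition nonzero_prod (A : comNzRingType) :=
  forall a b : A, a != 0 -> b != 0 -> a * b != 0.

Lemma submoduleZ (A : comNzRingType) (M : lmodType A) (S : set M) a x :
  submodule S -> S x -> S (a *: x).
Proof. by case=> _ _; apply. Qed.

Lemma submoduleD (A : comNzRingType) (M : lmodType A) (S : set M) x y :
  submodule S -> S x -> S y -> S (x + y).
Proof. by case=> _ h _; apply: h. Qed.

Lemma submodule0 (A : comNzRingType) (M : lmodType A) (S : set M) :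
  submodule S -> S 0.
Proof. by case. Qed.

Lemma submoduleB (A : comNzRingType) (M : lmodType A) (S : set M) x y :
  submodule S -> S x -> S y -> S (x - y).
Proof.
by move=> hS Sx Sy; rewrite -scaleN1r; apply: submoduleD => //; exact: submoduleZ.
Qed.

Section Span.
Variables (A : comNzRingType) (M : lmodType A).
Implicit Types (C : set A) (l : seq M).

(** Recursion on the list lets membership be proved by peeling off generators; [span_over_sum]
    recovers the usual linear combinations. *)
Fixpoint span_over C l : set M :=
  if l is x :: l' then [set y | exists2 c, C c & span_over C l' (y - c *: x)]
  else [set 0].

(** The saturation of the span. For the empty list it is the set of elements killed by a nonzero
    scalar of [C], hence the torsion when [C] is the whole ring. *)
Definition pure_closure C l : set M :=
  [set y | exists2 c, C c & c != 0 /\ span_over C l (c *: y)].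

Section Subring.
Variables (C : set A) (hC : subring_set C).

Lemma subring_set0 : C 0.
Proof. by case: hC => C1 CB _; rewrite -(subrr 1); exact: CB. Qed.

Lemma subring_setB a b : C a -> C b -> C (a - b).
Proof. by case: hC => _ h _; exact: h. Qed.

Lemma subring_setM a b : C a -> C b -> C (a * b).
Proof. by case: hC => _ _ h; exact: h. Qed.

Lemma subring_set1 : C 1.
Proof. by case: hC. Qed.

Lemma span_over0 l : span_over C l 0.
Proof.
elim: l => //= x l IH; exists 0; first exact: subring_set0.
by rewrite scale0r subr0.
Qed.

Lemma span_overB l x y :
  span_over C l x -> span_over C l y -> span_over C l (x - y).
Proof.
elim: l x y => [|z l IH] x y /=; first by move=> -> ->; rewrite subr0.
move=> [a Ca xa] [b Cb yb]; exists (a - b); first exact: subring_setB.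
have -> : x - y - (a - b) *: z = (x - a *: z) - (y - b *: z) by module.
exact: IH.
Qed.

Lemma span_overD l x y :
  span_over C l x -> span_over C l y -> span_over C l (x + y).
Proof.
move=> hx hy; rewrite -[y]opprK -[- y]sub0r.
by apply/span_overB => //; apply/span_overB => //; exact: span_over0.
Qed.

Lemma span_overZ l c x : C c -> span_over C l x -> span_over C l (c *: x).
Proof.
move=> Cc; elim: l x => [|z l IH] x /=; first by move=> ->; rewrite scaler0.
move=> [a Ca xa]; exists (c * a); first exact: subring_setM.
have -> : c *: x - (c * a) *: z = c *: (x - a *: z) by module.
exact: IH.
Qed.

Lemma span_over_tail z l : span_over C l `<=` span_over C (z :: l).
Proof.
move=> x hx; exists 0; first exact: subring_set0.
by rewrite scale0r subr0.
Qed.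

Lemma mem_span_over l x : x \in l -> span_over C l x.
Proof.
elim: l => // z l IH; rewrite inE => /orP [/eqP ->|/IH]; last first.
  exact: span_over_tail.
exists 1; first exact: subring_set1.
by rewrite scale1r subrr; exact: span_over0.
Qed.

Lemma span_over_sub l l' : {in l, forall x, span_over C l' x} ->
  span_over C l `<=` span_over C l'.
Proof.
elim: l => [|z l IH] sl x /=; first by move=> ->; exact: span_over0.
move=> [c Cc hx]; rewrite -[x](subrK (c *: z)); apply: span_overD.
  by apply: IH hx => y yl; apply: sl; rewrite inE yl orbT.
by apply: span_overZ => //; apply: sl; rewrite inE eqxx.
Qed.

Lemma span_over_sum l x : span_over C l x <->
  exists2 c : nat -> A, forall k, C (c k) & x = \sum_(k < size l) c k *: l`_k.
Proof.
split.
  elim: l x => [|z l IH] x /=.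
    move=> ->; exists (fun=> 0); first by move=> _; exact: subring_set0.
    by rewrite big_ord0.
  move=> [a Ca /IH [c Cc e]]; exists (fun k => if k is k'.+1 then c k' else a).
    by case.
  by rewrite big_ord_recl /= -e addrC subrK.
move=> [c Cc ->]; elim/big_ind: _ => [||k _]; first exact: span_over0.
  by move=> *; exact: span_overD.
by apply: span_overZ => //; apply: mem_span_over; exact: mem_nth.
Qed.

Hypothesis domA : nonzero_prod A.

Lemma span_pure_closure l : span_over C l `<=` pure_closure C l.
Proof.
move=> x hx; exists 1; first exact: subring_set1.
by rewrite scale1r; split => //; exact: oner_neq0.
Qed.

Lemma pure_closureB l x y :
  pure_closure C l x -> pure_closure C l y -> pure_closure C l (x - y).
Proof.
move=> [a Ca [a0 xa]] [b Cb [b0 yb]]; exists (a * b); first exact: subring_setM.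
split; first exact: domA.
have -> : (a * b) *: (x - y) = b *: (a *: x) - a *: (b *: y) by module.
by apply: span_overB; exact: span_overZ.
Qed.

Lemma pure_closure0 l : pure_closure C l 0.
Proof. by apply: span_pure_closure; exact: span_over0. Qed.

Lemma pure_closureD l x y :
  pure_closure C l x -> pure_closure C l y -> pure_closure C l (x + y).
Proof.
move=> hx hy; rewrite -[y]opprK -[- y]sub0r.
by apply/pure_closureB => //; apply/pure_closureB => //; exact: pure_closure0.
Qed.

Lemma pure_closureZ l c x : C c -> pure_closure C l x -> pure_closure C l (c *: x).
Proof.
move=> Cc [a Ca [a0 xa]]; exists a => //; split => //.
by rewrite scalerA mulrC -scalerA; exact: span_overZ.
Qed.

Lemma pure_closureP l c x : C c -> c != 0 -> pure_closure C l (c *: x) ->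
  pure_closure C l x.
Proof.
move=> Cc c0 [a Ca [a0]]; rewrite scalerA => h.
by exists (a * c); [exact: subring_setM | split => //; exact: domA].
Qed.

End Subring.
End Span.

Lemma subring_setT (A : comNzRingType) : subring_set [set: A].
Proof. by split. Qed.

(** * Complements of the torsion over a Pruefer domain *)

Section FreeComplement.
Variables (A : comNzRingType) (M : lmodType A).
Hypothesis domA : nonzero_prod A.
(** Ideals with two generators are locally principal: b is a multiple of a where s is invertible,
    and a of b where 1 - s is. *)
Hypothesis prufer : forall a b : A, exists s u v : A,
  s * b = u * a /\ (1 - s) * a = v * b.
(** Modulo b some power of s is idempotent; it separates the part of A / b A where s is a unit from
    the part where s is nilpotent. *)
Hypothesis idem_mod : forall s b : A, b != 0 ->
  exists n c, s ^+ n.+1 * (1 - s ^+ n.+1) = b * c.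

Local Notation span := (span_over [set: A]).
Local Notation cl := (pure_closure [set: A]).

Hypothesis closure_fg : forall l : seq M,
  exists2 l' : seq M, {in l', forall x, cl l x} & cl l `<=` span l'.
Hypothesis inf_rank : forall l : seq M, exists x, ~ cl l x.

Implicit Types (l : seq M) (x y z : M) (S : set M).

Lemma dom_eq0 (a b : A) : a != 0 -> a * b = 0 -> b = 0.
Proof.
by move=> a0 e; have [//|b0] := eqVneq b 0; have := domA a0 b0; rewrite e eqxx.
Qed.

Lemma dom_inj (a b c : A) : a != 0 -> a * b = a * c -> b = c.
Proof.
move=> a0 e; apply/eqP; rewrite -subr_eq0; apply/eqP; apply: (dom_eq0 a0).
by rewrite mulrBr e subrr.
Qed.

Lemma cl_submodule l : submodule (cl l).
Proof.
split; first exact: pure_closure0.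
  by move=> x y; exact: pure_closureD.
by move=> a x; exact: pure_closureZ.
Qed.

Definition saturated (S : set M) :=
  submodule S /\ forall a x, a != 0 -> S (a *: x) -> S x.

Lemma cl_saturated l : saturated (cl l).
Proof.
split; first exact: cl_submodule.
by move=> a x a0; apply: pure_closureP.
Qed.

Lemma saturated_eq0 S a x : saturated S -> ~ S x -> S (a *: x) -> a = 0.
Proof.
by move=> [_ satS] nx h; apply/eqP/negP => /negP a0; exact/nx/(satS _ _ a0).
Qed.

Lemma mem_cl l x : x \in l -> cl l x.
Proof. by move=> xl; apply: span_pure_closure => //; exact: mem_span_over. Qed.

Lemma cl_cons x l y : cl (x :: l) y -> exists2 a, a != 0 & exists b, cl l (a *: y - b *: x).
Proof.
move=> [a _ [a0 [b _ h]]]; exists a => //; exists b.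
exact: span_pure_closure.
Qed.

Lemma cl_cons_intro x l a b y :
  a != 0 -> cl l (a *: y - b *: x) -> cl (x :: l) y.
Proof.
move=> a0 h; have [hS sat] := cl_saturated (x :: l); apply: (sat a) => //.
rewrite -(subrK (b *: x) (a *: y)); apply: (submoduleD hS).
  by case: h => c _ [c0 h]; exists c => //; split => //; exact: span_over_tail.
by apply: (submoduleZ _ hS); apply: mem_cl; rewrite inE eqxx.
Qed.

Lemma cl_tail x l : cl l `<=` cl (x :: l).
Proof.
by move=> y hy; apply: (@cl_cons_intro _ _ 1 0); rewrite ?oner_neq0 // scale1r scale0r subr0.
Qed.

(* In a finitely generated module of rank 1, modulo any nonzero b two generators
   can be replaced by one: w equals y1 where e is 1 and y2 where e is 0. *)
Lemma one_generator_mod (S : set M) (y1 y2 : M) (s u v b : A) :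
  submodule S -> b != 0 ->
  S (s *: y2 - u *: y1) -> S ((1 - s) *: y1 - v *: y2) ->
  exists w d k1 k2, [/\ exists k3 k4, w = k3 *: y1 + k4 *: y2,
    S ((1 - b * d) *: y1 - k1 *: w) & S ((1 - b * d) *: y2 - k2 *: w)].
Proof.
move=> hS b0 h1 h2; have [n [c0 hc]] := idem_mod s b0.
set e := s ^+ n.+1 in hc.
pose g := \sum_(i < n.+1) s ^+ i.
have eg : 1 - e = (1 - s) * g.
  by have := subrX1 s n.+1; rewrite -/e -/g => h; rewrite -opprB h -mulNr opprB.
pose u' := s ^+ n * u; pose v' := g * v.
have h1' : S (e *: y2 - u' *: y1).
  suff -> : e *: y2 - u' *: y1 = s ^+ n *: (s *: y2 - u *: y1).
    exact: submoduleZ.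
  by rewrite /e /u' exprS; module.
have h2' : S ((1 - e) *: y1 - v' *: y2).
  suff -> : (1 - e) *: y1 - v' *: y2 = g *: ((1 - s) *: y1 - v *: y2).
    exact: submoduleZ.
  by rewrite eg /v'; module.
(* These make c equal to e^3 + (1 - e)^3 + e (1 - e) (u' + v'). Since e^3 + (1 - e)^3 = 1 - 3 e (1 -
   e) and b divides e (1 - e), c is 1 modulo b; this is also the origin of the 3 below. *)
pose k1 := e ^+ 2 + (1 - e) * u'; pose k2 := (1 - e) ^+ 2 + e * v'.
pose c := e * k1 + (1 - e) * k2.
have cE : 1 - b * (c0 * (3%:R - u' - v')) = c.
  by rewrite mulrA -hc /c /k1 /k2; ring.
pose w := e *: y1 + (1 - e) *: y2.
exists w, (c0 * (3%:R - u' - v')), (e ^+ 2 + v' * (1 - e)),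
  (u' * e + (1 - e) ^+ 2); rewrite cE; split; first by exists e, (1 - e).
- suff -> : c *: y1 - (e ^+ 2 + v' * (1 - e)) *: w =
    (- (e * (1 - e))) *: (e *: y2 - u' *: y1)
    + (k2 - v' * e) *: ((1 - e) *: y1 - v' *: y2).
    by apply: submoduleD => //; exact: submoduleZ.
  by rewrite /c /k1 /k2 /w; module.
- suff -> : c *: y2 - (u' * e + (1 - e) ^+ 2) *: w =
    (k1 - u' * (1 - e)) *: (e *: y2 - u' *: y1)
    + (- (e * (1 - e))) *: ((1 - e) *: y1 - v' *: y2).
    by apply: submoduleD => //; exact: submoduleZ.
  by rewrite /c /k1 /k2 /w; module.
Qed.

(** The Pruefer relation between the coefficients transfers to y1 and y2 because [S] is saturated.
    The last equation says that the matrix with rows (s, v) and (u, 1 - s) is idempotent; this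
    matrix presents the rank-1 module as a direct summand of A^2. *)
Lemma rank_one_pair S (y1 y2 : M) (a b : A) : saturated S ->
  (a != 0) || (b != 0) -> S (a *: y1 - b *: y2) ->
  exists s u v, [/\ S (s *: y2 - u *: y1), S ((1 - s) *: y1 - v *: y2)
    & u * v = s * (1 - s)].
Proof.
move=> satS ab h; have [hS sat] := satS; have S0 := submodule0 hS.
have [y1S|ny1] := pselect (S y1).
  exists 0, 0, 0; split; last by ring.
    by have -> : 0 *: y2 - 0 *: y1 = 0 by module.
  by have -> : (1 - 0) *: y1 - 0 *: y2 = y1 by module.
have [y2S|ny2] := pselect (S y2).
  exists 1, 0, 0; split; last by ring.
    by have -> : 1 *: y2 - 0 *: y1 = y2 by module.
  by have -> : (1 - 1) *: y1 - 0 *: y2 = 0 by module.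
have a0 : a != 0.
  apply/negP => /eqP e; move: ab h; rewrite e eqxx /= => b0 h; apply: ny2.
  apply: (sat b) => //; have -> : b *: y2 = (-1) *: (0 *: y1 - b *: y2) by module.
  exact: submoduleZ.
have b0 : b != 0.
  apply/negP => /eqP e; move: h; rewrite e => h; apply: ny1; apply: (sat a) => //.
  by have -> : a *: y1 = a *: y1 - 0 *: y2 by module.
have [s [u [v [e1 e2]]]] := prufer b a.
exists s, u, v; split.
- apply: (sat b) => //.
  suff -> : b *: (s *: y2 - u *: y1) = (- s) *: (a *: y1 - b *: y2).
    exact: submoduleZ.
  have -> : b *: (s *: y2 - u *: y1) = (s * b) *: y2 - (u * b) *: y1 by module.
  by rewrite -e1; module.
- apply: (sat a) => //.
  suff -> : a *: ((1 - s) *: y1 - v *: y2) = (1 - s) *: (a *: y1 - b *: y2).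
    exact: submoduleZ.
  have -> : a *: ((1 - s) *: y1 - v *: y2) = ((1 - s) * a) *: y1 - (v * a) *: y2.
    by module.
  by rewrite -e2; module.
- apply: (dom_inj (domA a0 b0)).
  have -> : a * b * (u * v) = (u * b) * (v * a) by ring.
  by rewrite -e1 -e2; ring.
Qed.

(** Multiply the denominators of the finitely many generators given by [closure_fg]. *)
Lemma common_multiplier l x : exists2 b, b != 0 &
  forall y, cl (x :: l) y -> exists k, cl l (b *: y - k *: x).
Proof.
have [l' l'P sub] := closure_fg (x :: l).
suff [b b0 hb] : exists2 b, b != 0 &
    {in l', forall y, exists k, cl l (b *: y - k *: x)}.
  exists b => // y /sub {sub}; elim: l' l'P hb y => [|z l' IH] l'P hb y /=.
    move=> ->; exists 0; rewrite scaler0 scale0r subr0.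
    exact: pure_closure0.
  move=> [c _ /IH [|t tl|k hk]]; first by move=> t tl; apply: l'P; rewrite inE tl orbT.
    by apply: hb; rewrite inE tl orbT.
  have [k' hk'] := hb z (mem_head _ _); exists (k + c * k').
  have -> : b *: y - (k + c * k') *: x =
    (b *: (y - c *: z) - k *: x) + c *: (b *: z - k' *: x) by module.
  apply: (submoduleD (cl_submodule l)) => //.
  exact: (submoduleZ _ (cl_submodule l)).
elim: l' {sub} l'P => [|z l' IH] l'P; first by exists 1 => //; exact: oner_neq0.
have [|b b0 hb] := IH; first by move=> t tl; apply: l'P; rewrite inE tl orbT.
have [a a0 [k hk]] := cl_cons (l'P z (mem_head _ _)).
exists (a * b); first exact: domA.
move=> y; rewrite inE => /orP [/eqP ->|/hb [k' hk']].
  exists (b * k); have -> : (a * b) *: z - (b * k) *: x = b *: (a *: z - k *: x).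
    by module.
  exact: (submoduleZ _ (cl_submodule l)).
exists (a * k'); have -> : (a * b) *: y - (a * k') *: x = a *: (b *: y - k' *: x).
  by module.
exact: (submoduleZ _ (cl_submodule l)).
Qed.

Lemma cl_cons_dep l x y z : ~ cl l x -> cl (x :: l) y -> cl (x :: l) z ->
  exists a b, (a != 0) || (b != 0) /\ cl l (a *: y - b *: z).
Proof.
move=> nx /cl_cons [a a0 [a' ha]] /cl_cons [b b0 [b' hb]].
have [e|a'0] := eqVneq a' 0.
  exists a, 0; rewrite a0; split=> //.
  by move: ha; rewrite e !scale0r.
exists (b' * a), (a' * b); split; first by rewrite (domA a'0 b0) orbT.
have -> : (b' * a) *: y - (a' * b) *: z =
  b' *: (a *: y - a' *: x) + (- a') *: (b *: z - b' *: x) by module.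
by apply: (submoduleD (cl_submodule l)); apply: (submoduleZ _ (cl_submodule l)).
Qed.

(** Modulo b a finitely generated module of rank 1 is cyclic: each generator is merged in turn with
    the current one by [one_generator_mod]. *)
Lemma one_generator_cl l x b : ~ cl l x -> b != 0 -> exists2 w, cl (x :: l) w &
  forall y, cl (x :: l) y ->
    exists k z, cl (x :: l) z /\ cl l (y - k *: w - b *: z).
Proof.
move=> nx b0; have [l' l'P sub] := closure_fg (x :: l).
have hS := cl_submodule l; have hP := cl_submodule (x :: l).
suff [w wP hw] : exists2 w, cl (x :: l) w & {in l', forall y,
    exists k z, cl (x :: l) z /\ cl l (y - k *: w - b *: z)}.
  exists w => // y /sub {sub}; elim: l' l'P hw y => [|t l' IH] l'P hw y /=.
    move=> ->; exists 0, 0; split; first exact: submodule0.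
    by rewrite scaler0 scale0r !subr0; exact: submodule0.
  move=> [c _ /IH [|r rl|k [z [zP hk]]]].
  - by move=> r rl; apply: l'P; rewrite inE rl orbT.
  - by apply: hw; rewrite inE rl orbT.
  have [k' [z' [zP' hk']]] := hw t (mem_head _ _).
  exists (k + c * k'), (z + c *: z'); split.
    by apply: submoduleD => //; exact: submoduleZ.
  have -> : y - (k + c * k') *: w - b *: (z + c *: z') =
    (y - c *: t - k *: w - b *: z) + c *: (t - k' *: w - b *: z') by module.
  by apply: (submoduleD hS) => //; exact: submoduleZ.
elim: l' {sub} l'P => [|t l' IH] l'P.
  by exists x => //; apply: mem_cl; exact: mem_head.
have [|w wP hw] := IH; first by move=> r rl; apply: l'P; rewrite inE rl orbT.
have tP := l'P t (mem_head _ _).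
have [a' [b' [ab hab]]] := cl_cons_dep nx tP wP.
have [s [u [v [h1 h2 _]]]] := rank_one_pair (cl_saturated l) ab hab.
have [w' [d [k1 [k2 [[k3 [k4 w'E]] hk1 hk2]]]]] :=
  one_generator_mod hS b0 h1 h2.
exists w'.
  by rewrite w'E; apply: submoduleD => //; exact: submoduleZ.
move=> y; rewrite inE => /orP [/eqP ->|/hw [k [z [zP hk]]]].
  exists k1, (d *: t); split; first exact: submoduleZ.
  suff -> : t - k1 *: w' - b *: (d *: t) = (1 - b * d) *: t - k1 *: w' by [].
  by module.
exists (k * k2), (z + (k * d) *: w); split.
  by apply: submoduleD => //; exact: submoduleZ.
have -> : y - (k * k2) *: w' - b *: (z + (k * d) *: w) =
  (y - k *: w - b *: z) + k *: ((1 - b * d) *: w - k2 *: w') by module.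
by apply: submoduleD => //; exact: submoduleZ.
Qed.

(** As for ideals of a Dedekind domain, one of two generators can be prescribed. With b a common
    multiplier, b z is a multiple of x modulo [cl l], so x and a generator modulo b suffice. *)
Lemma two_generators_cl l x : ~ cl l x -> exists w s u v,
  [/\ ~ cl l w, cl (x :: l) w,
      forall y, cl (x :: l) y -> exists a b, cl l (y - a *: x - b *: w)
    & [/\ cl l (s *: w - u *: x), cl l ((1 - s) *: x - v *: w)
        & u * v = s * (1 - s)]].
Proof.
move=> nx; have hS := cl_submodule l.
have [b b0 hb] := common_multiplier l x.
have [w wP hw] := one_generator_cl nx b0.
have gen y : cl (x :: l) y -> exists a b, cl l (y - a *: x - b *: w).
  move=> /hw [k [z [/hb [k' hz] hk]]]; exists k', k.
  have -> : y - k' *: x - k *: w = (y - k *: w - b *: z) + (b *: z - k' *: x).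
    by module.
  exact: submoduleD.
have xP : cl (x :: l) x by apply: mem_cl; exact: mem_head.
have [wS|nw] := pselect (cl l w).
  exists x, 1, 1, 0; split=> //; last first.
    split; last by ring.
      have -> : 1 *: x - 1 *: x = 0 by module.
      exact: submodule0.
    have -> : (1 - 1) *: x - 0 *: x = 0 by module.
      exact: submodule0.
  move=> y /gen [a [c h]]; exists a, 0.
  have -> : y - a *: x - 0 *: x = (y - a *: x - c *: w) + c *: w by module.
  by apply: submoduleD => //; exact: submoduleZ.
have [a' [b' [ab hab]]] := cl_cons_dep nx xP wP.
have [s [u [v [h1 h2 h3]]]] := rank_one_pair (cl_saturated l) ab hab.
by exists w, s, u, v.
Qed.

Let zero_submodule : submodule [set (0 : M)].
Proof.
split=> // [x y -> ->|a x ->]; first by rewrite /= addr0.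
by rewrite /= scaler0.
Qed.

(* A unimodular element of a module of rank 2: y is a local generator of its
   closure away from a0, and W generates the second summand at the divisors of
   a0. *)
Lemma unimodular_element l : exists2 g, ~ cl l g &
  forall h, cl (g :: l) h -> exists r, cl l (h - r *: g).
Proof.
have [y ny] := inf_rank l.
have satS := cl_saturated l; have [hS sat] := satS.
have satS1 := cl_saturated (y :: l); have [hS1 sat1] := satS1.
have [a0 a00 ha0] := common_multiplier l y.
have [z nz] := inf_rank (y :: l).
have [w [s [u [v [nw wP gen [h1 h2 uv]]]]]] := two_generators_cl nz.
(* Applying the idempotent matrix changes z and w only by elements of [cl (y :: l)], and the
   relations [e1] and [e2] now hold exactly instead of modulo it. So z' and w' span a submodule that
   meets [cl (y :: l)] in 0. *)
pose z' := s *: z + v *: w; pose w' := u *: z + (1 - s) *: w.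
have zz' : cl (y :: l) (z - z').
  by have -> : z - z' = (1 - s) *: z - v *: w by rewrite /z'; module.
have ww' : cl (y :: l) (w - w').
  by have -> : w - w' = s *: w - u *: z by rewrite /w'; module.
have nz' : ~ cl (y :: l) z'.
  by move=> h; apply: nz; rewrite -(subrK z' z); exact: submoduleD.
have nw' : ~ cl (y :: l) w'.
  by move=> h; apply: nw; rewrite -(subrK w' w); exact: submoduleD.
have e1 : s *: w' = u *: z'.
  have -> : s *: w' = (u * s) *: z + (s * (1 - s)) *: w by rewrite /w'; module.
  by rewrite -uv /z'; module.
have e2 : (1 - s) *: z' = v *: w'.
  have -> : (1 - s) *: z' = (s * (1 - s)) *: z + (v * (1 - s)) *: w.
    by rewrite /z'; module.
  by rewrite -uv /w'; module.
have direct a b : cl (y :: l) (a *: z' + b *: w') -> a *: z' + b *: w' = 0.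
  move=> h.
  have E1 : s *: (a *: z' + b *: w') = (s * a + u * b) *: z'.
    have -> : s *: (a *: z' + b *: w') = (s * a) *: z' + b *: (s *: w') by module.
    by rewrite e1; module.
  have E2 : (1 - s) *: (a *: z' + b *: w') = (v * a + (1 - s) * b) *: w'.
    have -> : (1 - s) *: (a *: z' + b *: w') =
      a *: ((1 - s) *: z') + ((1 - s) * b) *: w' by module.
    by rewrite e2; module.
  have c1 : s * a + u * b = 0.
    apply: (saturated_eq0 satS1 nz'); rewrite -E1; exact: submoduleZ.
  have c2 : v * a + (1 - s) * b = 0.
    apply: (saturated_eq0 satS1 nw'); rewrite -E2; exact: submoduleZ.
  have -> : a *: z' + b *: w' =
    s *: (a *: z' + b *: w') + (1 - s) *: (a *: z' + b *: w') by module.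
  by rewrite E1 E2 c1 c2; module.
have r1 : [set (0 : M)] (s *: w' - u *: z') by rewrite /= e1 subrr.
have r2 : [set (0 : M)] ((1 - s) *: z' - v *: w') by rewrite /= e2 subrr.
have [W [d [k1 [k2 [[k3 [k4 WE]] /= hk1 hk2]]]]] :=
  one_generator_mod zero_submodule a00 r1 r2.
move/eqP: hk1; rewrite subr_eq0 => /eqP hk1.
move/eqP: hk2; rewrite subr_eq0 => /eqP hk2.
have WS0 : cl (y :: l) W -> W = 0 by rewrite WE; exact: direct.
have yS1 : cl (y :: l) y by apply: mem_cl; exact: mem_head.
exists (y + W).
  move=> hg; have W0 : W = 0.
    apply: WS0; have -> : W = (y + W) - y by module.
    by apply: (submoduleB hS1) => //; exact: cl_tail.
  by apply: ny; move: hg; rewrite W0 addr0.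
move=> h /cl_cons [a an0 [b hab]].
have hP : cl (z :: y :: l) h.
  have hP2 := cl_submodule (z :: y :: l).
  have [_ satP] := cl_saturated (z :: y :: l).
  have zP : cl (z :: y :: l) z by apply: mem_cl; exact: mem_head.
  apply: (satP a) => //; rewrite -(subrK (b *: (y + W)) (a *: h)).
  apply: (submoduleD hP2); first by do 2!apply: cl_tail.
  apply: (submoduleZ _ hP2); apply: (submoduleD hP2); first exact: cl_tail.
  by rewrite WE /z' /w'; do !apply: (submoduleD hP2) || apply: (submoduleZ _ hP2).
have [al [be hh]] := gen h hP.
pose h2' := al *: z' + be *: w'; pose h1' := h - h2'.
have h1S : cl (y :: l) h1'.
  have -> : h1' = (h - al *: z - be *: w) + (al *: (z - z') + be *: (w - w')).
    by rewrite /h1' /h2'; module.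
  by apply: (submoduleD hS1) => //; apply: (submoduleD hS1); exact: submoduleZ.
have E2 : a *: h2' = b *: W.
  suff : a *: h2' - b *: W = 0 by move/eqP; rewrite subr_eq0 => /eqP.
  have F : a *: h2' - b *: W =
    (a * al - b * k3) *: z' + (a * be - b * k4) *: w' by rewrite /h2' WE; module.
  rewrite F; apply: direct; rewrite -F.
  have -> : a *: h2' - b *: W =
    (a *: h - b *: (y + W)) + (b *: y - a *: h1') by rewrite /h1'; module.
  apply: (submoduleD hS1); first exact: cl_tail.
  by apply: (submoduleB hS1); exact: submoduleZ.
have E1 : cl l (a *: h1' - b *: y).
  have -> : a *: h1' - b *: y = (a *: h - b *: (y + W)) - (a *: h2' - b *: W).
    by rewrite /h1'; module.
  by rewrite E2 subrr subr0.
have [c1 hc1] := ha0 _ h1S.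
have ac1 : a * c1 = a0 * b.
  apply/eqP; rewrite -subr_eq0; apply/eqP; apply: (saturated_eq0 satS ny).
  have -> : (a * c1 - a0 * b) *: y =
    a0 *: (a *: h1' - b *: y) - a *: (a0 *: h1' - c1 *: y) by module.
  by apply: (submoduleB hS); exact: submoduleZ.
(* c and a0 are comaximal. By [ac1], a divides a0 b, and by [hr'] it divides c b; hence a divides b,
   with quotient r' + d c1. *)
pose c := 1 - a0 * d.
have [r' hr'] : exists r', a * r' = c * b.
  have [W0|Wn0] := eqVneq W 0.
    exists 0; suff -> : c = 0 by ring.
    apply: (saturated_eq0 satS1 nz').
    by rewrite /c hk1 W0 scaler0; exact: submodule0.
  exists (al * k1 + be * k2); apply/eqP; rewrite -subr_eq0; apply/eqP.
  apply: (@saturated_eq0 (cl (y :: l)) _ W) => //.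
    by move=> /WS0 W0; rewrite W0 eqxx in Wn0.
  have chE : c *: h2' = (al * k1 + be * k2) *: W.
    have -> : c *: h2' = al *: (c *: z') + be *: (c *: w').
      by rewrite /h2'; module.
    by rewrite /c hk1 hk2; module.
  have -> : (a * (al * k1 + be * k2) - c * b) *: W =
    a *: ((al * k1 + be * k2) *: W) - c *: (b *: W) by module.
  rewrite -chE -E2.
  have -> : a *: (c *: h2') - c *: (a *: h2') = 0 by module.
  exact: submodule0.
exists (r' + d * c1); apply: (sat a) => //.
have -> : a *: (h - (r' + d * c1) *: (y + W)) =
  a *: h - (a * r' + d * (a * c1)) *: (y + W) by module.
rewrite hr' ac1; have -> : c * b + d * (a0 * b) = b by rewrite /c; ring.
by [].
Qed.

(* If P is invertible with P + P' = A^2 and F is free of rank 2, then P + F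
   contains P + P' as a direct summand. *)
Lemma free_extension l x : exists e1 e2,
  [/\ cl (e2 :: e1 :: l) x,
      forall a b, cl l (a *: e1 + b *: e2) -> a = 0 /\ b = 0
    & forall h, cl (e2 :: e1 :: l) h -> exists a b, cl l (h - a *: e1 - b *: e2)].
Proof.
wlog nx : x / ~ cl l x.
  move=> H; have [hx|] := pselect (cl l x); last exact: H.
  have [x' nx'] := inf_rank l; have [e1 [e2 [_ h2 h3]]] := H x' nx'.
  by exists e1, e2; split => //; do 2!apply: cl_tail.
have satS := cl_saturated l; have [hS sat] := satS.
have [w [s [u [v [nw wP gen [h1 h2 uv]]]]]] := two_generators_cl nx.
have [g1 ng1 hg1] := unimodular_element (x :: l).
have [g2 ng2 hg2] := unimodular_element (g1 :: x :: l).
have satP := cl_saturated (x :: l); have [hP sat'] := satP.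
have xP : cl (x :: l) x by apply: mem_cl; exact: mem_head.
have indep a b : cl (x :: l) (a *: g1 + b *: g2) -> a = 0 /\ b = 0.
  move=> h; have b0 : b = 0.
    apply: (saturated_eq0 (cl_saturated (g1 :: x :: l)) ng2).
    have -> : b *: g2 = (a *: g1 + b *: g2) - a *: g1 by module.
    have hP1 := cl_submodule (g1 :: x :: l).
    apply: (submoduleB hP1); first exact: cl_tail.
    by apply: (submoduleZ _ hP1); apply: mem_cl; exact: mem_head.
  split=> //; apply: (saturated_eq0 satP ng1).
  by move: h; rewrite b0 scale0r addr0.
(* Let P be the idempotent matrix with rows (s, v) and (u, 1 - s). It fixes (x, w) modulo [cl l],
   and (e1, e2) is (x, w) plus (1 - P) applied to (g1, g2). For a coefficient row (a, b), [key]
   determines (a, b) (1 - P) and [coefs] determines (a, b) P; their sum is (a, b). *)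
pose e1 := x + (1 - s) *: g1 - v *: g2; pose e2 := w - u *: g1 + s *: g2.
have key a b p c1 c2 : cl (x :: l) p ->
    cl l (a *: e1 + b *: e2 - (p + c1 *: g1 + c2 *: g2)) ->
  [/\ a * (1 - s) - b * u = c1, - (a * v) + b * s = c2
    & cl l (a *: x + b *: w - p)].
  move=> hp h.
  have [] := indep (a * (1 - s) - b * u - c1) (- (a * v) + b * s - c2).
    have -> : (a * (1 - s) - b * u - c1) *: g1 + (- (a * v) + b * s - c2) *: g2 =
      (a *: e1 + b *: e2 - (p + c1 *: g1 + c2 *: g2))
      + (p - (a *: x + b *: w)) by rewrite /e1 /e2; module.
    apply: (submoduleD hP); first exact: cl_tail.
    by apply: (submoduleB hP) => //; apply: (submoduleD hP); exact: submoduleZ.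
  move=> /eqP; rewrite subr_eq0 => /eqP E1 /eqP; rewrite subr_eq0 => /eqP E2.
  split=> //.
  suff -> : a *: x + b *: w - p =
    a *: e1 + b *: e2 - (p + c1 *: g1 + c2 *: g2) by [].
  by rewrite -E1 -E2 /e1 /e2; module.
have coefs a b a' b' : cl l (a *: x + b *: w - (a' *: x + b' *: w)) ->
    s * a + u * b = s * a' + u * b' /\
    v * a + (1 - s) * b = v * a' + (1 - s) * b'.
  move=> h; split; apply/eqP; rewrite -subr_eq0; apply/eqP.
    apply: (saturated_eq0 satS nx).
    have -> : (s * a + u * b - (s * a' + u * b')) *: x =
      s *: (a *: x + b *: w - (a' *: x + b' *: w))
      + (b' - b) *: (s *: w - u *: x) by module.
    by apply: (submoduleD hS); exact: submoduleZ.
  apply: (saturated_eq0 satS nw).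
  have -> : (v * a + (1 - s) * b - (v * a' + (1 - s) * b')) *: w =
    (1 - s) *: (a *: x + b *: w - (a' *: x + b' *: w))
    + (a' - a) *: ((1 - s) *: x - v *: w) by module.
  by apply: (submoduleD hS); exact: submoduleZ.
exists e1, e2; split.
- have hE := cl_submodule (e2 :: e1 :: l).
  have -> : x = (s *: e1 + v *: e2) + ((1 - s) *: x - v *: w).
    have -> : s *: e1 + v *: e2 = s *: x + v *: w +
      (s * (1 - s)) *: g1 - (u * v) *: g1 by rewrite /e1 /e2; module.
    by rewrite uv; module.
  apply: (submoduleD hE); last by do 2!apply: cl_tail.
  by apply: (submoduleD hE); apply: (submoduleZ _ hE); apply: mem_cl;
    rewrite !inE eqxx ?orbT.
- move=> a b h.
  have [] := key a b 0 0 0 (submodule0 hP).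
    by have -> : a *: e1 + b *: e2 - (0 + 0 *: g1 + 0 *: g2) =
      a *: e1 + b *: e2 by module.
  move=> E1 E2 E3.
  have [] := coefs a b 0 0.
    by have -> : a *: x + b *: w - (0 *: x + 0 *: w) = a *: x + b *: w - 0
      by module.
  move=> F1 F2; split.
    have -> : a = (s * a + u * b) + (a * (1 - s) - b * u) by ring.
    by rewrite F1 E1; ring.
  have -> : b = (v * a + (1 - s) * b) + (- (a * v) + b * s) by ring.
  by rewrite F2 E2; ring.
move=> h /cl_cons [a a0 [be]] /cl_cons [a' a'0 [al]] hh.
have n0 := domA a'0 a0.
have {}hh : cl l ((a' * a) *: h - al *: e1 - (a' * be) *: e2).
  suff -> : (a' * a) *: h - al *: e1 - (a' * be) *: e2 =
    a' *: (a *: h - be *: e2) - al *: e1 by [].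
  by module.
move: (a' * a) (a' * be) n0 hh => {a a0 be a' a'0} a be a0 hh.
have hG : cl (g2 :: g1 :: x :: l) h.
  have [hG satG] := cl_saturated (g2 :: g1 :: x :: l); apply: (satG a) => //.
  have -> : a *: h = (a *: h - al *: e1 - be *: e2) + (al *: e1 + be *: e2).
    by module.
  have t p : cl (x :: l) p -> cl (g2 :: g1 :: x :: l) p by move=> ?; do 2!apply: cl_tail.
  apply: (submoduleD hG); first by apply: t; exact: cl_tail.
  have g1G : cl (g2 :: g1 :: x :: l) g1 by apply: mem_cl; rewrite !inE eqxx orbT.
  have g2G : cl (g2 :: g1 :: x :: l) g2 by apply: mem_cl; rewrite !inE eqxx.
  have xG := t _ xP; have wG := t _ wP.
  have e1G : cl (g2 :: g1 :: x :: l) e1.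
    apply: (submoduleB hG); last exact: (submoduleZ _ hG).
    by apply: (submoduleD hG) => //; exact: (submoduleZ _ hG).
  have e2G : cl (g2 :: g1 :: x :: l) e2.
    apply: (submoduleD hG); last exact: (submoduleZ _ hG).
    by apply: (submoduleB hG) => //; exact: (submoduleZ _ hG).
  by apply: (submoduleD hG); exact: (submoduleZ _ hG).
have [c2 /hg1 [c1 pP]] := hg2 _ hG.
set p := h - c2 *: g2 - c1 *: g1 in pP.
have [la [mu hp]] := gen p pP.
have [] := key al be (a *: p) (a * c1) (a * c2); first exact: submoduleZ.
  have -> : al *: e1 + be *: e2 - (a *: p + (a * c1) *: g1 + (a * c2) *: g2) =
    (-1) *: (a *: h - al *: e1 - be *: e2) by rewrite /p; module.
  exact: submoduleZ.
move=> E1 E2 E3.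
have [] := coefs al be (a * la) (a * mu).
  have -> : al *: x + be *: w - ((a * la) *: x + (a * mu) *: w) =
    (al *: x + be *: w - a *: p) + a *: (p - la *: x - mu *: w) by module.
  by apply: (submoduleD hS) => //; exact: submoduleZ.
move=> F1 F2.
have G1 : al = a * (s * la + u * mu + c1).
  have -> : al = (s * al + u * be) + (al * (1 - s) - be * u) by ring.
  by rewrite F1 E1; ring.
have G2 : be = a * (v * la + (1 - s) * mu + c2).
  have -> : be = (v * al + (1 - s) * be) + (- (al * v) + be * s) by ring.
  by rewrite F2 E2; ring.
exists (s * la + u * mu + c1), (v * la + (1 - s) * mu + c2).
apply: (sat a) => //.
suff -> : a *: (h - (s * la + u * mu + c1) *: e1 - (v * la + (1 - s) * mu + c2) *: e2)
  = a *: h - al *: e1 - be *: e2 by [].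
by rewrite G1 G2; module.
Qed.

(** Stage n absorbs [en n] and adjoins two vectors, a basis of the new closure modulo the old one.
    The closures start at the torsion and exhaust M, so all the vectors together are a basis of a
    complement. *)
Theorem torsion_free_complement (en : nat -> M) : (forall x, exists n, en n = x) ->
  exists G : set M,
    [/\ submodule G, free_of_rank_aleph0 G & internal_direct_sum (cl [::]) G].
Proof.
move=> enP.
have /choice [step stepP] : forall lx : seq M * M, exists e : M * M,
  [/\ cl (e.2 :: e.1 :: lx.1) lx.2,
      forall a b, cl lx.1 (a *: e.1 + b *: e.2) -> a = 0 /\ b = 0
    & forall h, cl (e.2 :: e.1 :: lx.1) h ->
        exists a b, cl lx.1 (h - a *: e.1 - b *: e.2)].
  by move=> [l x]; have [e1 [e2 h]] := free_extension l x; exists (e1, e2).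
pose st := fix st n := if n is n'.+1 then
  let e := step (st n', en n') in e.2 :: e.1 :: st n' else [::].
pose e k := let p := step (st k./2, en k./2) in if odd k then p.2 else p.1.
have e_even n : e n.*2 = (step (st n, en n)).1 by rewrite /e odd_double doubleK.
have e_odd n : e n.*2.+1 = (step (st n, en n)).2.
  by rewrite /e /= odd_double /= uphalf_double.
have stS n : st n.+1 = e n.*2.+1 :: e n.*2 :: st n by rewrite e_even e_odd.
have stepP' n : [/\ cl (st n.+1) (en n),
      forall a b, cl (st n) (a *: e n.*2 + b *: e n.*2.+1) -> a = 0 /\ b = 0
    & forall h, cl (st n.+1) h ->
        exists a b, cl (st n) (h - a *: e n.*2 - b *: e n.*2.+1)].
  by rewrite stS e_even e_odd; exact: (stepP (st n, en n)).
have mem_st n : forall k, (k < n.*2)%N -> cl (st n) (e k).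
  elim: n => // n IH k; rewrite stS doubleS !ltnS leq_eqVlt => /orP [/eqP ->|].
    by apply: mem_cl; rewrite inE eqxx.
  rewrite ltnS leq_eqVlt => /orP [/eqP ->|/IH h].
    by apply: mem_cl; rewrite !inE eqxx orbT.
  by do 2!apply: cl_tail.
have sum_st n (c : nat -> A) : cl (st n) (\sum_(k < n.*2) c k *: e k).
  have h := cl_submodule (st n); elim/big_ind: _ => [||k _].
  - exact: submodule0.
  - by move=> *; exact: submoduleD.
  - by apply: submoduleZ => //; exact: mem_st.
have tors_indep n (c : nat -> A) : cl [::] (\sum_(k < n.*2) c k *: e k) ->
    forall k, (k < n.*2)%N -> c k = 0.
  elim: n => // n IH h.
  move: h; rewrite doubleS !big_ord_recr /= => h.
  have [_ ind _] := stepP' n.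
  have cl0 y : cl [::] y -> cl (st n) y.
    by move=> [a _ [a0 /= e0]]; exists a => //; split => //; rewrite e0; exact: span_over0.
  have [|c1 c2] := ind (c n.*2) (c n.*2.+1).
    have -> : c n.*2 *: e n.*2 + c n.*2.+1 *: e n.*2.+1 =
      (\sum_(k < n.*2) c k *: e k + c n.*2 *: e n.*2 + c n.*2.+1 *: e n.*2.+1)
      - \sum_(k < n.*2) c k *: e k by module.
    by apply: (submoduleB (cl_submodule _)) => //; exact: cl0.
  move=> k; rewrite ltnS leq_eqVlt => /orP [/eqP -> //|].
  rewrite ltnS leq_eqVlt => /orP [/eqP -> //|]; apply: IH.
  by move: h; rewrite c1 c2 !scale0r !addr0.
have widen n m (c : nat -> A) : (n <= m)%N ->
    \sum_(k < n) c k *: e k = \sum_(k < m) (if (k < n)%N then c k else 0) *: e k.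
  move=> nm; rewrite (big_ord_widen m (fun k => c k *: e k) nm) big_mkcond /=.
  by apply: eq_bigr => k _; case: ifP => // _; rewrite scale0r.
have le2 n : (n <= n.*2)%N by rewrite -addnn leq_addr.
have tors_indep' n (c : nat -> A) : cl [::] (\sum_(k < n) c k *: e k) ->
    forall k, (k < n)%N -> c k = 0.
  rewrite (widen _ _ _ (le2 n)) => h k kn.
  have := tors_indep n (fun k => if (k < n)%N then c k else 0) h k.
  by move/(_ (leq_trans kn (le2 n))); rewrite kn.
have decomp n x : cl (st n) x -> exists c : nat -> A,
    cl [::] (x - \sum_(k < n.*2) c k *: e k).
  elim: n x => [|n IH] x h; first by exists (fun=> 0); rewrite big_ord0 subr0.
  have [_ _ /(_ _ h) [a [b /IH [c hc]]]] := stepP' n.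
  exists (fun k => if k == n.*2 then a else if k == n.*2.+1 then b else c k).
  rewrite doubleS !big_ord_recr /= eqxx eqn_leq ltnn /= eqxx.
  set s := \sum_(i < _) _; have -> : s = \sum_(k < n.*2) c k *: e k.
    apply: eq_bigr => k _; rewrite /= !ltn_eqF // ?ltn_ord //.
    by rewrite ltnS ltnW.
  suff -> : x - (\sum_(k < n.*2) c k *: e k + a *: e n.*2 + b *: e n.*2.+1) =
    x - a *: e n.*2 - b *: e n.*2.+1 - \sum_(k < n.*2) c k *: e k by [].
  by module.
pose G := [set x | exists n (c : nat -> A), x = \sum_(k < n) c k *: e k].
have GD x y : G x -> G y -> G (x + y).
  move=> [n [c ->]] [m [c' ->]]; exists (maxn n m).
  rewrite (widen _ _ _ (leq_maxl n m)) (widen _ _ _ (leq_maxr n m)) -big_split /=.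
  exists (fun k => (if (k < n)%N then c k else 0) + (if (k < m)%N then c' k else 0)).
  by apply: eq_bigr => k _; rewrite scalerDl.
have Ge n : G (e n).
  exists n.+1, (fun k => if k == n then 1 else 0).
  rewrite big_ord_recr /= eqxx scale1r big1 ?add0r // => k _.
  by rewrite ltn_eqF ?ltn_ord // scale0r.
exists G; split.
- split=> //; first by exists 0%N, (fun=> 0); rewrite big_ord0.
  move=> a x [n [c ->]]; exists n, (fun k => a * c k).
  by rewrite scaler_sumr; apply: eq_bigr => k _; rewrite scalerA.
- exists e; split=> //.
    move=> n c h j.
    pose c' k := if insub k is Some i then c i else 0.
    have c'E (i : 'I_n) : c' i = c i by rewrite /c' valK.
    rewrite -c'E; apply: (tors_indep' n) => //.
    under eq_bigr => i _ do rewrite c'E.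
    by rewrite h; exact: pure_closure0.
  by move=> x [n [c ->]]; exists n, (fun i => c i).
- split.
    apply/seteqP; split=> x /=.
      move=> [tx [n [c xE]]]; rewrite xE in tx *.
      by apply: big1 => k _; rewrite (tors_indep' _ _ tx) // scale0r.
    move=> ->; split; first exact: pure_closure0.
    by exists 0%N, (fun=> 0); rewrite big_ord0.
  move=> x; have [n <-] := enP x.
  have [/decomp [c hc] _ _] := stepP' n.
  exists (en n - \sum_(k < n.+1.*2) c k *: e k), (\sum_(k < n.+1.*2) c k *: e k).
  by split; [| exists n.+1.*2, c | rewrite subrK].
Qed.

End FreeComplement.

(** * Tameness from a height *)

Lemma range_subring (B A : comNzRingType) (f : {rmorphism B -> A}) :
  subring_set (range f).
Proof.
split; first by exists 1; rewrite ?rmorph1.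
  by move=> _ _ [x _ <-] [y _ <-]; exists (x - y); rewrite ?rmorphB.
by move=> _ _ [x _ <-] [y _ <-]; exists (x * y); rewrite ?rmorphM.
Qed.

Lemma natr_le_exp (R : realType) (Q : R) n : 2 <= Q -> n%:R <= Q ^+ n.
Proof.
move=> Q2; elim: n => [|n IH]; first by rewrite expr0 ler01.
have Qn : 1 <= Q ^+ n by apply: exprn_ege1; lra.
by rewrite exprS mulrSr; nra.
Qed.

Section PolynomialHeight.
Variables (F : finFieldType) (A : comNzRingType) (iota : {rmorphism {poly F} -> A}).
Variables (V : lmodType A) (R : realType) (h : V -> R) (Q : R).
Hypothesis Q3 : 3 <= Q.
Hypothesis h_ge0 : forall x, 0 <= h x.
Hypothesis hD : forall x y, h (x + y) <= h x + h y.
Hypothesis hX : forall x, h (iota 'X *: x) = Q * h x.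
Hypothesis hC : forall c x, c != 0 -> h (iota c%:P *: x) = h x.

Let Q_gt0 : 0 < Q.
Proof. by move: Q3 => q3; lra. Qed.

Lemma height0 : h 0 = 0.
Proof.
have := hX 0; rewrite scaler0 => e; have : (Q - 1) * h 0 = 0 by rewrite mulrBl -e; ring.
by move=> e1; move: Q3 e1 => q3 /eqP; rewrite mulf_eq0 => /orP [/eqP e'|/eqP //]; lra.
Qed.

Lemma heightN x : h (- x) = h x.
Proof.
rewrite -[RHS](hC (c := -1)) ?oppr_eq0 ?oner_neq0 //.
by rewrite polyCN rmorphN rmorph1 scaleN1r.
Qed.

Lemma heightXn n x : h (iota 'X^n *: x) = Q ^+ n * h x.
Proof.
elim: n x => [|n IH] x; first by rewrite expr0 rmorph1 scale1r mul1r.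
by rewrite exprSr rmorphM -scalerA IH hX exprSr mulrA.
Qed.

Lemma height_sum (I : finType) (x : I -> V) : h (\sum_i x i) <= \sum_i h (x i).
Proof.
elim/big_ind2: _ => [|u a v b ha hb|//]; first by rewrite height0.
by apply: le_trans (hD _ _) _; exact: lerD.
Qed.

Let split_lead n (P : {poly F}) : (size P <= n.+1)%N ->
  exists2 P' : {poly F}, (size P' <= n)%N & P = (P`_n)%:P * 'X^n + P'.
Proof.
move=> sP; exists (P - (P`_n)%:P * 'X^n); last by rewrite addrC subrK.
apply/leq_sizeP => i; rewrite coefB coefCM coefXn leq_eqVlt => /orP [/eqP <-|ni].
  by rewrite eqxx mulr1 subrr.
by rewrite gtn_eqF // mulr0 subr0; move/leq_sizeP: sP; apply.
Qed.

(** The top term contributes at most Q^n h(x) and the lower ones at most half of that; 1 + 1/2 <=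
    Q/2 closes the induction and is the reason for Q >= 3. *)
Lemma height_poly_le n (P : {poly F}) x : (size P <= n)%N ->
  2 * h (iota P *: x) <= Q ^+ n * h x.
Proof.
elim: n P => [|n IH] P sP.
  have -> : P = 0 by apply/eqP; rewrite -size_poly_eq0 -leqn0.
  by rewrite rmorph0 scale0r height0 mulr0 expr0 mul1r.
have [P' sP' ->] := split_lead sP; have := IH _ sP'.
rewrite rmorphD rmorphM scalerDl -scalerA => {}IH.
have hc : h (iota (P`_n)%:P *: (iota 'X^n *: x)) <= Q ^+ n * h x.
  have [->|c0] := eqVneq P`_n 0; last by rewrite hC // heightXn.
  by rewrite rmorph0 scale0r height0 mulr_ge0 ?exprn_ge0 // ltW.
have := hD (iota (P`_n)%:P *: (iota 'X^n *: x)) (iota P' *: x).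
have : 0 <= Q ^+ n * h x by rewrite mulr_ge0 ?exprn_ge0 // ltW.
rewrite exprS -mulrA; move: (Q ^+ n * h x) Q3 hc IH => t *; nra.
Qed.

(** The leading term has height exactly Q^n h(x), of which the other terms cancel at most half. *)
Lemma height_poly_ge n (P : {poly F}) x : size P = n.+1 ->
  Q ^+ n * h x <= 2 * h (iota P *: x).
Proof.
move=> sP; have [|P' sP' PE] := @split_lead n P; first by rewrite sP.
have c0 : P`_n != 0.
  have : lead_coef P != 0 by rewrite lead_coef_eq0 -size_poly_eq0 sP.
  by rewrite lead_coefE sP.
have := height_poly_le x sP'.
have := hD (iota P *: x) (- (iota P' *: x)); rewrite heightN.
have -> : iota P *: x - iota P' *: x = iota (P`_n)%:P *: (iota 'X^n *: x).
  by rewrite {1}PE rmorphD rmorphM scalerDl scalerA addrK.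
by rewrite hC // heightXn => *; lra.
Qed.

Lemma height_poly_eq0 (P : {poly F}) x : P != 0 -> iota P *: x = 0 -> h x = 0.
Proof.
move=> P0 e; have sP : size P = (size P).-1.+1 by rewrite prednK // lt0n size_poly_eq0.
have := height_poly_ge x sP; rewrite e height0 mulr0 => le0.
have Qn : 0 < Q ^+ (size P).-1 by rewrite exprn_gt0.
by apply/eqP; rewrite eq_le h_ge0 andbT -(ler_pM2l Qn) mulr0.
Qed.

Local Notation B := (range iota).
Let hB := range_subring iota.

Variable eps : R.
Hypothesis eps_gt0 : 0 < eps.
Hypothesis small_height : exists Z : seq V, forall x, h x < eps -> x \in Z.
Hypothesis domA : nonzero_prod A.

Let divp_digits m (S D : {poly F}) : D != 0 ->
  (size (('X^m * (S %% D)) %/ D)%R <= m)%N.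
Proof.
move=> D0; rewrite size_divp // leq_subLR.
apply: leq_trans (size_polyMleq _ _) _; rewrite size_polyXn addSn /=.
rewrite addnC leq_add2r -ltnS prednK ?ltn_modp // lt0n size_poly_eq0 //.
Qed.

(* An element x of the closure with D x = sum_k S_k l_k is classified by the
   first m digits of the fractional parts of the S_k / D. *)
Lemma closure_fg_height l : exists2 l' : seq V,
  {in l', forall x, pure_closure B l x} & pure_closure B l `<=` span_over B l'.
Proof.
pose W := pure_closure B l; pose n := size l.
pose H := \sum_(k < n) h l`_k.
(* Elements with the same m digits will differ, up to the span of [l], by a z with Q^m h(z) <= H. *)
have [m hm] : exists m, H < Q ^+ m * eps.
  pose m := Num.bound (H / eps).
  have H0 : 0 <= H by apply: sumr_ge0.
  exists m; rewrite -ltr_pdivrMr //.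
  apply: lt_le_trans (natr_le_exp m _); last by move: Q3 => q3; lra.
  by apply: archi_boundP; rewrite divr_ge0 // ltW.
have /choice [DS DSP] : forall x, exists DS : {poly F} * (nat -> {poly F}), W x ->
    DS.1 != 0 /\ iota DS.1 *: x = \sum_(k < n) iota (DS.2 k) *: l`_k.
  move=> x; have [Wx|nWx] := pselect (W x); last by exists (0, fun=> 0).
  have [_ [D _ <-] [D0 /(span_over_sum hB) [c cB e]]] := Wx.
  have /choice [S SE] : forall k, exists P, iota P = c k.
    by move=> k; have [P _ <-] := cB k; exists P.
  exists (D, S) => _; split=> /=.
    by apply: contra D0 => /eqP ->; rewrite rmorph0.
  by rewrite e; apply: eq_bigr => k _; rewrite SE.
pose dig x k := ('X^m * ((DS x).2 k %% (DS x).1)) %/ (DS x).1.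
have fc : finite_classes W (fun x y =>
    exists s, span_over B l s /\ h (x - y - s) < eps).
  exists {ffun 'I_n -> {ffun 'I_m -> F}},
    (fun x => [ffun k : 'I_n => [ffun i : 'I_m => (dig x k)`_i]]).
  move=> x y Wx Wy e.
  have {e} e (k : 'I_n) : dig x k = dig y k.
    apply/polyP => i; have [im|mi] := ltnP i m.
      by move/ffunP/(_ k): e; rewrite !ffunE => /ffunP/(_ (Ordinal im)); rewrite !ffunE.
    by rewrite !nth_default // (leq_trans _ mi) // divp_digits //;
      have [] := DSP _ Wx; have [] := DSP _ Wy.
  move: e; rewrite /dig; have [] := DSP _ Wx; have [] := DSP _ Wy.
  move: (DS x) (DS y) => [D S] [D' S'] /= D'0 E' D0 E e.
  pose s := \sum_(k < n) iota (S k %/ D) *: l`_k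
            - \sum_(k < n) iota (S' k %/ D') *: l`_k.
  have sum_span (c : nat -> {poly F}) : span_over B l (\sum_(k < n) iota (c k) *: l`_k).
    by apply/(span_over_sum hB); exists (fun k => iota (c k)) => // k; exists (c k).
  exists s; split; first by apply: (span_overB hB);
    [exact: (sum_span (fun k => S k %/ D)) | exact: (sum_span (fun k => S' k %/ D'))].
  pose T k := (S k %% D) * D' - (S' k %% D') * D.
  have zE : iota (D * D') *: (x - y - s) = \sum_(k < n) iota (T k) *: l`_k.
    have -> : iota (D * D') *: (x - y - s) =
      iota D' *: (iota D *: x) - iota D *: (iota D' *: y)
      - iota D' *: (iota D *: (\sum_(k < n) iota (S k %/ D) *: l`_k))
      + iota D *: (iota D' *: (\sum_(k < n) iota (S' k %/ D') *: l`_k)).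
      by rewrite /s rmorphM; module.
    rewrite E E' !scaler_sumr -!sumrB -big_split /=; apply: eq_bigr => k _.
    rewrite /T {1}(divp_eq (S k) D) {1}(divp_eq (S' k) D') rmorphB !rmorphD !rmorphM.
    by module.
  pose g := (size D + size D').-2.
  have sDD : size (D * D') = g.+1.
    rewrite size_mul // /g; case: (size D) (size_poly_eq0 D) => [|a].
      by rewrite (negPf D0).
    case: (size D') (size_poly_eq0 D') => [|b]; first by rewrite (negPf D'0).
    by rewrite addSn addnS.
  (* T k / (D D') is the difference of the fractional parts. As their first m digits agree,
     multiplication by 'X^m still leaves a proper fraction. *)
  have sT (k : 'I_n) : (size ('X^m * T k)%R <= g)%N.
    have -> : 'X^m * T k =
        (('X^m * (S k %% D)) %% D) * D' - (('X^m * (S' k %% D')) %% D') * D.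
      have modE (P P' : {poly F}) : P %% P' = P - (P %/ P') * P'.
        by rewrite {2}(divp_eq P P') addrC addKr.
      by rewrite (modE ('X^m * (S k %% D))) (modE ('X^m * (S' k %% D'))) (e k) /T; ring.
    have small (P P' r : {poly F}) : P != 0 -> P' != 0 ->
        (size ((r %% P) * P')%R <= (size P + size P').-2)%N.
      move=> P0 P'0; apply: leq_trans (size_polyMleq _ _) _.
      have : (size (r %% P)%R < size P)%N by rewrite ltn_modp.
      by move: (size _) (size P) (size P') => a1 a2 a3; lia.
    apply: leq_trans (size_polyD _ _) _; rewrite size_polyN geq_max.
    by rewrite {1}/g small //= /g addnC small.
  have low := height_poly_ge (x - y - s) sDD.
  have up : 2 * (Q ^+ m * h (iota (D * D') *: (x - y - s))) <= Q ^+ g * H.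
    rewrite zE -heightXn scaler_sumr /H mulr_sumr.
    apply: le_trans (_ : \sum_(k < n) 2 * h (iota ('X^m * T k) *: l`_k) <= _).
      rewrite -mulr_sumr ler_pM2l //; under eq_bigr => k _ do rewrite scalerA -rmorphM.
      exact: height_sum.
    by apply: ler_sum => k _; exact: height_poly_le.
  have Qm : 0 < Q ^+ m by rewrite exprn_gt0.
  have Qg : 0 < Q ^+ g by rewrite exprn_gt0.
  rewrite -(ltr_pM2l Qm); apply: le_lt_trans hm; rewrite -(ler_pM2l Qg).
  apply: le_trans up; rewrite mulrCA [X in _ <= X]mulrCA.
  by rewrite ler_pM2l.
have [s sW sP] := finite_classes_reps fc.
have [Z ZP] := small_height.
pose Z' := [seq z <- Z | `[< W z >]].
have mem_l x : x \in l -> W x.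
  by move=> xl; apply: (span_pure_closure hB) => //; exact: mem_span_over.
exists (l ++ s ++ Z').
  move=> x; rewrite !mem_cat => /or3P [/mem_l //|/sW //|].
  by rewrite mem_filter => /andP [/asboolP].
move=> x Wx; have [y ys [t [tl ht]]] := sP x Wx.
have in_span z : z \in l ++ s ++ Z' -> span_over B (l ++ s ++ Z') z.
  exact: mem_span_over.
have -> : x = y + t + (x - y - t) by module.
apply: (span_overD hB); first apply: (span_overD hB).
- by apply: in_span; rewrite !mem_cat ys orbT.
- by apply: (span_over_sub hB) tl => z zl; apply: in_span; rewrite mem_cat zl.
apply: in_span; rewrite !mem_cat mem_filter ZP // andbT.
suff -> : `[< W (x - y - t) >] by rewrite !orbT.
apply/asboolP; apply: (pure_closureB hB) => //; last exact: (span_pure_closure hB).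
by apply: (pure_closureB hB) => //; exact: sW.
Qed.

End PolynomialHeight.

Section FiniteQuotient.
Variables (F : finFieldType) (A : comNzRingType) (iota : {rmorphism {poly F} -> A}).
Variable V : lmodType A.

(** Each coefficient is divided by P, and the remainders are the colours. *)
Lemma span_over_classes l (P : {poly F}) : P != 0 ->
  finite_classes (span_over (range iota) l)
    (fun x y : V => exists z, x - y = iota P *: z).
Proof.
move=> P0; elim: l => [|v l [T [c cP]]].
  exists unit, (fun=> tt) => x y /= -> -> _; exists 0.
  by rewrite subr0 scaler0.
have /choice [d dP] : forall x, exists d, span_over (range iota) (v :: l) x ->
    span_over (range iota) l (x - iota d *: v).
  move=> x; have [[_ [d _ <-] h]|h] := pselect (span_over (range iota) (v :: l) x).
    by exists d.
  by exists 0.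
exists ({ffun 'I_(size P) -> F} * T)%type,
  (fun x => ([ffun i : 'I_(size P) => (d x %% P)`_i], c (x - iota (d x) *: v))).
move=> x y /dP hx /dP hy [e /(cP _ _ hx hy) [z hz]].
have {}e : d x %% P = d y %% P.
  apply/polyP => i; have [im|mi] := ltnP i (size P).
    by move/ffunP/(_ (Ordinal im)): e; rewrite !ffunE.
  by rewrite !nth_default // (leq_trans _ mi) // ltnW // ltn_modp.
exists (z + iota (d x %/ P - d y %/ P) *: v).
have E : iota (d x) - iota (d y) = iota (d x %/ P - d y %/ P) * iota P.
  rewrite -rmorphB -rmorphM; congr (iota _).
  have := divp_eq (d x) P; have := divp_eq (d y) P; rewrite e => Ey Ex.
  by rewrite mulrBl {1}Ey {1}Ex; ring.
have -> : x - y = (x - iota (d x) *: v - (y - iota (d y) *: v))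
   + (iota (d x) - iota (d y)) *: v by module.
by rewrite hz E; module.
Qed.

End FiniteQuotient.

(* Among the powers of s, two are congruent modulo b, which makes a power of s
   idempotent modulo b. *)
Lemma idempotent_power (A : comNzRingType) (s b : A) :
  finite_classes [set: A] (fun x y => exists z, x - y = b * z) ->
  exists n c, s ^+ n.+1 * (1 - s ^+ n.+1) = b * c.
Proof.
move=> fc; have [i [j [ij [z hz]]]] := finite_classes_seq (u := fun n => s ^+ n) fc (fun=> I).
pose k := (j - i)%N; have k0 : (0 < k)%N by rewrite subn_gt0.
have jE : j = (k + i)%N by rewrite subnK // ltnW.
exists (k * i.+1).-1; rewrite prednK ?muln_gt0 ?k0 //.
(* A multiple of the period k that is at least the preperiod i, so s^i (1 - s^k) divides s^N (1 -
   s^N). *)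
set N := (k * i.+1)%N.
have iN : (i <= N)%N by rewrite /N; apply: leq_trans (leq_pmull _ k0); exact: leqnSn.
have E1 : s ^+ N = s ^+ (N - i) * s ^+ i by rewrite -exprD subnK.
have E2 : 1 - s ^+ N = (1 - s ^+ k) * \sum_(t < i.+1) (s ^+ k) ^+ t.
  by rewrite /N exprM -opprB subrX1 -mulNr opprB.
exists (- (s ^+ (N - i) * z * \sum_(t < i.+1) (s ^+ k) ^+ t)).
move: hz; rewrite jE exprD => hz.
have {}hz : s ^+ i * (1 - s ^+ k) = - (b * z) by rewrite -hz; ring.
rewrite {1}E1 E2.
have -> : forall a c d g : A, a * c * (d * g) = a * (c * d) * g by move=> *; ring.
by rewrite hz; ring.
Qed.

(** * Local heights *)

Section Ultrametric.
Variables (R : realType) (K : fieldType).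
Implicit Types (w v : K -> int) (x y : K) (M : R).

(** Multiplicativity is left out so that the notion also covers the normalized valuation, which is a
    multiple of a valuation shifted by a constant. *)
Definition ultrametric w := (forall x, w (- x) = w x) /\
  forall x y, x != 0 -> y != 0 -> x + y != 0 -> Num.min (w x) (w y) <= w (x + y).

(* The first case reads the junk value w 0 as +oo. *)
Definition lower_bound w M x := x = 0 \/ M <= (w x)%:~R.

Lemma lower_boundW w M M' x : M' <= M -> lower_bound w M x -> lower_bound w M' x.
Proof. by move=> le [->|h]; [left | right; exact: le_trans h]. Qed.

Lemma lower_boundN w M x : ultrametric w -> lower_bound w M x -> lower_bound w M (- x).
Proof. by move=> [wN _] [->|h]; [left; rewrite oppr0 | right; rewrite wN]. Qed.

Lemma lower_boundD w M x y : ultrametric w ->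
  lower_bound w M x -> lower_bound w M y -> lower_bound w M (x + y).
Proof.
move=> [_ wD] hx hy.
have [->|x0] := eqVneq x 0; first by rewrite add0r.
have [->|y0] := eqVneq y 0; first by rewrite addr0.
have [->|xy0] := eqVneq (x + y) 0; first by left.
case: hx => [/eqP|hx]; first by rewrite (negPf x0).
case: hy => [/eqP|hy]; first by rewrite (negPf y0).
right; apply: le_trans (_ : (Num.min (w x) (w y))%:~R <= _).
  by have [_|_] := leP (w x) (w y).
by rewrite ler_int; exact: wD.
Qed.

Lemma lower_boundB w M x y : ultrametric w ->
  lower_bound w M x -> lower_bound w M y -> lower_bound w M (x - y).
Proof. by move=> hw hx hy; apply: lower_boundD => //; exact: lower_boundN. Qed.

Lemma lower_bound_sum w M (I : finType) (P : pred I) (F : I -> K) : ultrametric w ->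
  (forall i, P i -> lower_bound w M (F i)) -> lower_bound w M (\sum_(i | P i) F i).
Proof.
move=> hw hF; elim/big_ind: _ => //; first by left.
by move=> x y; exact: lower_boundD.
Qed.

Lemma ultrametric_dominated w x y : ultrametric w -> x != 0 ->
  lower_bound w (w x + 1)%:~R y -> x + y != 0 /\ w (x + y) = w x.
Proof.
move=> hw x0 hy; have [wN wD] := hw.
case: hy => [->|]; first by rewrite addr0.
rewrite ler_int => hy.
have [->|y0] := eqVneq y 0; first by rewrite addr0.
have xy0 : x + y != 0.
  by apply: contraTneq hy => /eqP; rewrite addr_eq0 => /eqP ->; rewrite wN; lia.
split=> //; have := wD x y x0 y0 xy0.
have Ny0 : - y != 0 by rewrite oppr_eq0.
have := wD (x + y) (- y) xy0 Ny0; rewrite addrK wN => /(_ x0).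
by move: hy; case: (leP (w x) (w y)); case: (leP (w (x + y)) (w y)); lia.
Qed.

Section Valuation.
Variables (v : K -> int) (hv : dvaluation v).

Lemma val_ultrametric : ultrametric v.
Proof. by split=> [x|x y]; [exact: dvalN | exact: dvalD]. Qed.

Lemma valX x n : x != 0 -> v (x ^+ n) = v x *+ n.
Proof.
move=> x0; elim: n => [|n IH]; first by rewrite expr0 (dval1 hv).
by rewrite exprS (dvalM hv) ?expf_neq0 // IH mulrS.
Qed.

Lemma valV x : x != 0 -> v x^-1 = - v x.
Proof.
move=> x0; apply/eqP; rewrite -addr_eq0 addrC -(dvalM hv) ?invr_neq0 //.
by rewrite divff // (dval1 hv).
Qed.

Lemma lower_boundM M M' x y :
  lower_bound v M x -> lower_bound v M' y -> lower_bound v (M + M') (x * y).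
Proof.
have [->|x0] := eqVneq x 0; first by left; rewrite mul0r.
have [->|y0] := eqVneq y 0; first by left; rewrite mulr0.
move=> [/eqP|hx]; first by rewrite (negPf x0).
move=> [/eqP|hy]; first by rewrite (negPf y0).
by right; rewrite (dvalM hv) // intrD lerD.
Qed.

(* By synthetic division: the quotient of P - P.[y0] by 'X - y0 is small at the
   other points. *)
Lemma lower_bound_coef n (P : {poly K}) (s : seq K) (k : int) M :
  (size P <= n)%N -> size s = n -> {in s, forall y, lower_bound v k%:~R y} ->
  pairwise (fun x y => `[< ~ lower_bound v (k + 1)%:~R (x - y) >]) s ->
  {in s, forall y, lower_bound v M P.[y]} ->
  forall i, lower_bound v (M - k%:~R *+ i) P`_i.
Proof.
elim: n P s M => [|n IH] P s M sP.
  move=> _ _ _ _ i; left; rewrite nth_default //.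
  exact: leq_trans sP (leq0n _).
case: s => // y0 s [sS] sk /= /andP [/allP s0 sp] sM.
pose P1 := P %/ ('X - y0%:P).
have PE : P = P1 * ('X - y0%:P) + P.[y0]%:P.
  by rewrite {1}(divp_eq P ('X - y0%:P)) modp_XsubC.
have sP1 : (size P1 <= n)%N.
  by rewrite /P1 size_divp ?polyXsubC_eq0 // size_XsubC leq_subLR add1n.
have y0k : lower_bound v k%:~R y0 by apply: sk; exact: mem_head.
have y0M : lower_bound v M P.[y0] by apply: sM; exact: mem_head.
have hP1 : {in s, forall y, lower_bound v (M - k%:~R) P1.[y]}.
  move=> y ys; have yM : lower_bound v M P.[y] by apply: sM; rewrite inE ys orbT.
  have /asboolP nlb := s0 y ys.
  have d0 : y0 - y != 0 by apply/eqP => e; apply: nlb; left.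
  have vd : v (y0 - y) <= k.
    rewrite leNgt; apply/negP => lt; apply: nlb; right; rewrite ler_int; lia.
  have -> : P1.[y] = (P.[y0] - P.[y]) * (y0 - y)^-1.
    rewrite [in P.[y]]PE !hornerE; apply: (mulIf d0); rewrite divfK //; ring.
  apply: lower_boundM; first exact: (lower_boundB val_ultrametric).
  by right; rewrite valV // -rmorphN ler_int; lia.
have s_sk : {in s, forall y, lower_bound v k%:~R y}.
  by move=> y ys; apply: sk; rewrite inE ys orbT.
have {}IH := IH P1 s (M - k%:~R) sP1 sS s_sk sp hP1.
move=> [|i]; rewrite PE coefD coefC mulrBr coefB coefMX [in _ * y0%:P]mulrC coefCM /=.
  rewrite mulr0n subr0 sub0r; apply: (lower_boundD val_ultrametric) => //.
  apply: (lower_boundN val_ultrametric).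
  have -> : M = k%:~R + (M - k%:~R - k%:~R *+ 0) by rewrite mulr0n; ring.
  exact: lower_boundM.
rewrite addr0; apply: (lower_boundB val_ultrametric).
  have -> : M - k%:~R *+ i.+1 = M - k%:~R - k%:~R *+ i by rewrite mulrS; ring.
  exact: IH.
have -> : M - k%:~R *+ i.+1 = k%:~R + (M - k%:~R - k%:~R *+ i.+1) by ring.
exact: lower_boundM.
Qed.

End Valuation.
End Ultrametric.

Section ExponentGap.
Variables (R : realType) (q r : nat).
Hypothesis q_gt1 : (1 < q)%N.
Hypothesis r_gt1 : (1 < r)%N.

(** The gap of 2 depends on r >= 2: for q = 2 and r = 1 it would be 1. *)
Lemma q_gap j : (j < r)%N -> (q ^ j + 2 <= q ^ r)%N.
Proof.
move=> jr; have : (q ^ j.+1 <= q ^ r)%N by rewrite leq_exp2l.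
rewrite expnS => h; case: j jr h => [|j] jr h.
  by apply: leq_trans (_ : (q ^ 2 <= _)%N); [nia | rewrite leq_exp2l].
have : (q <= q ^ j.+1)%N by rewrite -{1}(expn1 q) leq_exp2l.
nia.
Qed.

Lemma q_gapR j : (j < r)%N -> 2 <= (q ^ r)%:R - (q ^ j)%:R :> R.
Proof.
move=> /q_gap h; rewrite lerBrDr -natrD ler_nat; lia.
Qed.

Lemma Q_ge4 : (4 <= q ^ r)%N.
Proof.
by apply: leq_trans (_ : (q ^ 2 <= _)%N); [nia | rewrite leq_exp2l].
Qed.

End ExponentGap.

(* Writing y = x / gamma with gamma ^+ (q ^ r - 1) = 1 / c r, [nu] is q ^ r - 1
   times the valuation of y, and the additive polynomial f in the variable y is
   monic, with coefficient of degree q ^ j of valuation [kappa j / (q ^ r - 1)]. *)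
Section LocalHeight.
Variables (R : realType) (K : fieldType) (q r : nat) (c : nat -> K) (f : K -> K).
Hypothesis q_gt1 : (1 < q)%N.
Hypothesis r_gt1 : (1 < r)%N.
Hypothesis cr0 : c r != 0.
Hypothesis fE : forall x, f x = \sum_(j < r.+1) c j * x ^+ (q ^ j).
Hypothesis fB : forall x y, f (x - y) = f x - f y.

Definition normalized_val (v : K -> int) (x : K) : int :=
  v x *+ (q ^ r).-1 + v (c r).

Definition normalized_coef_val (v : K -> int) (j : nat) : int :=
  v (c j) *+ (q ^ r).-1 - v (c r) *+ (q ^ j).-1.

Local Notation nu := normalized_val.
Local Notation kappa := normalized_coef_val.
Local Notation Q := ((q ^ r)%:R : R).

(** A slope of the Newton polygon. At [nu] equal to -n, the term of degree q^j has value kappa_j - n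
    q^j, the leading one -n q^r; for n beyond the radius the leading term is strictly the smallest.
    The radius is nonzero exactly when some normalized coefficient has a pole. *)
Definition pole_radius (v : K -> int) : R :=
  \big[Num.max/0]_(j < r | c j != 0) (- (kappa v j)%:~R / (Q - (q ^ j)%:R)).

Local Notation b := pole_radius.

Lemma pole_radius_ge0 v : 0 <= b v.
Proof.
by rewrite /b; elim/big_rec: _ => // j x _ x0; rewrite le_max x0 orbT.
Qed.

Lemma pole_radius_att v : b v = 0 \/
  exists2 j, (j < r)%N /\ c j != 0 & (kappa v j)%:~R = - (b v * (Q - (q ^ j)%:R)).
Proof.
rewrite /b; elim/big_ind: _ => [|x y hx hy|j cj]; first by left.
  by case: (leP x y).
right; exists j; first by [].
rewrite divfK ?opprK // gt_eqF //.
by apply: lt_le_trans (q_gapR R q_gt1 r_gt1 (ltn_ord j)).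
Qed.

Lemma normalized_coef_val_lead v : kappa v r = 0.
Proof. by rewrite /kappa subrr. Qed.

Lemma pole_radius_le v j : (j <= r)%N -> c j != 0 ->
  - (b v * (Q - (q ^ j)%:R)) <= (kappa v j)%:~R.
Proof.
rewrite leq_eqVlt => /orP [/eqP ->|jr] cj.
  by rewrite normalized_coef_val_lead subrr mulr0 oppr0.
have d0 : 0 < Q - (q ^ j)%:R by apply: lt_le_trans (q_gapR R q_gt1 r_gt1 jr).
rewrite lerNl -ler_pdivrMr // /b.
by rewrite (bigD1 (Ordinal jr)) //= le_max lexx.
Qed.

Section OneValuation.
Variables (v : K -> int) (hv : dvaluation v).

Lemma normalized_ultrametric : ultrametric (nu v).
Proof.
split=> [x|x y x0 y0 xy0]; first by rewrite /nu (dvalN _ hv).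
have := dvalD hv x0 y0 xy0; rewrite /nu.
have N0 : (0 < (q ^ r).-1)%N by have := Q_ge4 q_gt1 r_gt1; lia.
rewrite !ge_min; case/orP => h; apply/orP; [left | right];
  by rewrite lerD2r lerMn2r h orbT.
Qed.

Lemma normalized_term x j : x != 0 -> c j != 0 ->
  nu v (c j * x ^+ (q ^ j)) = kappa v j + nu v x *+ (q ^ j).
Proof.
move=> x0 cj; rewrite /nu (dvalM hv) ?expf_neq0 // (valX hv) //.
rewrite /kappa; have : (0 < q ^ j)%N by rewrite expn_gt0; lia.
by case: (q ^ j)%N => // e _; rewrite /=; ring.
Qed.

Lemma normalized_term_ge x j m : b v <= m -> x = 0 \/ - m <= (nu v x)%:~R ->
  (j <= r)%N -> lower_bound (nu v) (- (Q * m)) (c j * x ^+ (q ^ j)).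
Proof.
move=> bm hx jr; have [->|x0] := eqVneq x 0.
  by left; rewrite expr0n; have -> : (q ^ j == 0)%N = false; rewrite ?mulr0 //;
    apply/negbTE; rewrite -lt0n expn_gt0; lia.
case: hx => [/eqP|hx]; first by rewrite (negPf x0).
have [->|cj] := eqVneq (c j) 0; first by left; rewrite mul0r.
right; rewrite normalized_term // intrD rmorphMn /= -[_ *+ (q ^ j)]mulr_natr.
have h1 := pole_radius_le v jr cj.
have h2 : (q ^ j)%:R <= Q by rewrite ler_nat leq_exp2l.
have h3 : 0 <= (q ^ j)%:R :> R by [].
move: h1 h2 h3 bm hx; move: (kappa v j)%:~R (q ^ j)%:R Q (nu v x)%:~R (b v).
move=> k e q0 n b0 h1 h2 h3 h4 h5.
have p1 : 0 <= (m - b0) * (q0 - e) by rewrite mulr_ge0 // subr_ge0.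
have p2 : 0 <= (n + m) * e by rewrite mulr_ge0 // -lerBlDr sub0r.
by lra.
Qed.

Lemma normalized_image_ge x m : b v <= m -> x = 0 \/ - m <= (nu v x)%:~R ->
  lower_bound (nu v) (- (Q * m)) (f x).
Proof.
move=> bm hx; rewrite fE; apply: (lower_bound_sum normalized_ultrametric) => j _.
by apply: normalized_term_ge => //; rewrite -ltnS.
Qed.

Lemma normalized_image_eq x : x != 0 -> b v < - (nu v x)%:~R ->
  f x != 0 /\ nu v (f x) = nu v x *+ (q ^ r).
Proof.
move=> x0 hx; rewrite fE big_ord_recr /= addrC.
have lead : nu v (c r * x ^+ (q ^ r)) = nu v x *+ (q ^ r).
  by rewrite normalized_term // normalized_coef_val_lead add0r.
rewrite -lead; apply: (@ultrametric_dominated R _ _ _ _ normalized_ultrametric).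
  by rewrite mulf_neq0 ?expf_neq0.
apply: (lower_bound_sum normalized_ultrametric) => j _.
have [->|cj] := eqVneq (c j) 0; first by left; rewrite mul0r.
right; rewrite lead normalized_term // ler_int -ltzD1 ltrD2r -(ltr_int R).
rewrite intrD !rmorphMn /= -[_ *+ (q ^ r)]mulr_natr -[_ *+ (q ^ j)]mulr_natr.
have h1 := pole_radius_le v (ltnW (ltn_ord j)) cj.
have h2 := q_gapR R q_gt1 r_gt1 (ltn_ord j); have h3 := pole_radius_ge0 v.
move: h1 h2 h3 hx; move: (kappa v j)%:~R (q ^ j)%:R Q (nu v x)%:~R (b v).
move=> k e q0 n b0 h1 h2 h3 h4; nra.
Qed.

(* The normalized filled Julia set, as seen by one iteration of f. *)
Definition near_julia (x : K) :=
  lower_bound (nu v) (- b v) x /\ lower_bound (nu v) (- b v) (f x).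

Lemma near_juliaB x y : near_julia x -> near_julia y -> near_julia (x - y).
Proof.
move=> [hx hfx] [hy hfy]; split; last rewrite fB;
  exact: (lower_boundB normalized_ultrametric).
Qed.

(** By interpolation, more than q^r points that are distinct modulo the next level and have bounded
    images would bound every coefficient of f. The coefficient that attains the pole radius violates
    this bound. *)
Lemma near_julia_level k : b v != 0 -> k *+ (q ^ r).-1 + v (c r) <= 0 ->
  exists2 s : seq K,
    {in s, forall x, near_julia x /\ lower_bound v (k%:~R : R) x} &
    forall x, near_julia x /\ lower_bound v (k%:~R : R) x ->
      exists2 y, y \in s & lower_bound v ((k + 1)%:~R : R) (x - y).
Proof.
move=> b0 hk; case: (pole_radius_att v) => [/eqP|[j [jr cj] hj]].
  by rewrite (negPf b0).
pose W := [set x | near_julia x /\ lower_bound v (k%:~R : R) x].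
have [|s sW sP] := @reps_of_bound _ W
    (fun x y => lower_bound v ((k + 1)%:~R : R) (y - x)) (q ^ r).
  move=> s sW sp; rewrite leqNgt; apply/negP => ls.
  pose P := \sum_(i < r.+1) c i *: 'X^(q ^ i).
  have sP : (size P <= size s)%N.
    apply: leq_trans ls; apply: (leq_trans (size_sum _ _ _)).
    apply/bigmax_leqP => i _; apply: leq_trans (size_scale_leq _ _) _.
    by rewrite size_polyXn ltnS leq_exp2l // -ltnS.
  have PE x : P.[x] = f x.
    by rewrite fE horner_sum; apply: eq_bigr => i _; rewrite !hornerE.
  have coefP : P`_(q ^ j) = c j.
    have jr' : (j < r.+1)%N by rewrite ltnW.
    rewrite coef_sum (bigD1 (Ordinal jr')) //= coefZ coefXn eqxx mulr1.
    rewrite big1 ?addr0 // => i ij; rewrite coefZ coefXn eqn_exp2l //.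
    have -> : (j == i) = false by apply/negbTE; rewrite eq_sym -val_eqE in ij.
    by rewrite mulr0.
  (* With this bound on the values, interpolation gives v (c j) >= v (c j) + 1. A value below it
     would have [nu] at most kappa_j = -b (Q - q^j) <= -2 b, against the bound -b of
     [near_julia]. *)
  pose M : int := v (c j) + k *+ (q ^ j) + 1.
  have sM : {in s, forall y, lower_bound v (M%:~R : R) P.[y]}.
    move=> y /sW [[_ hfy] _]; rewrite PE.
    case: hfy => [->|hfy]; first by left.
    have [->|fy0] := eqVneq (f y) 0; first by left.
    right; rewrite ler_int leNgt; apply/negP => lt.
    have le : v (f y) <= v (c j) + k *+ (q ^ j) by move: lt; rewrite /M; lia.
    have : nu v (f y) <= kappa v j + (k *+ (q ^ r).-1 + v (c r)) *+ (q ^ j).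
      have -> : kappa v j + (k *+ (q ^ r).-1 + v (c r)) *+ (q ^ j) =
        (v (c j) + k *+ (q ^ j)) *+ (q ^ r).-1 + v (c r).
        rewrite /kappa; have : (0 < q ^ j)%N by rewrite expn_gt0; lia.
        case: (q ^ j)%N => // e _ /=.
        by ring.
      by rewrite /nu lerD2r lerMn2r le orbT.
    have : (k *+ (q ^ r).-1 + v (c r)) *+ (q ^ j) <= 0 by rewrite mulrn_wle0.
    move=> h1 h2; have : (nu v (f y))%:~R <= (kappa v j)%:~R :> R.
      by rewrite ler_int; lia.
    rewrite hj; have := q_gapR R q_gt1 r_gt1 jr.
    have : 0 < b v by rewrite lt_def b0 pole_radius_ge0.
    move: hfy; move: (nu v (f y))%:~R (b v) (Q - _) => n b1 d g1 g2 g3 g4.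
    have : 0 <= b1 * (d - 2) by rewrite mulr_ge0 ?subr_ge0 // ltW.
    by rewrite mulrBr; lra.
  have sk : {in s, forall y, lower_bound v (k%:~R : R) y} by move=> y /sW [].
  have := lower_bound_coef hv sP erefl sk sp sM (q ^ j); rewrite coefP.
  case=> [/eqP|]; first by rewrite (negPf cj).
  rewrite -rmorphMn -rmorphB ler_int /M; lia.
by exists s => // x hx; exact: sP.
Qed.

(** Levels are added one at a time, downwards from k1, where all differences already have [nu] at
    least 1. Since [nu] is at least -b on the set, some level contains all of it. *)
Lemma near_julia_classes : b v != 0 ->
  finite_classes near_julia (fun x y => lower_bound (nu v) (1 : R) (x - y)).
Proof.
move=> b0; pose W (k : int) := [set x | near_julia x /\ lower_bound v (k%:~R : R) x].
have N0 : (0 < (q ^ r).-1)%N by have := Q_ge4 q_gt1 r_gt1; lia.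
pose k1 : int := `|v (c r)| + 1.
have fin n : finite_classes (W (k1 - n%:Z))
    (fun x y => lower_bound (nu v) (1 : R) (x - y)).
  elim: n => [|n IH].
    exists unit, (fun=> tt) => x y [_ hx] [_ hy] _; rewrite subr0 in hx hy.
    case: (lower_boundB (val_ultrametric hv) hx hy) => [->|]; first by left.
    rewrite ler_int => h; right; rewrite -[1]/(1%:~R) ler_int /nu.
    have : k1 *+ 1 <= v (x - y) *+ (q ^ r).-1.
      apply: le_trans (_ : k1 *+ (q ^ r).-1 <= _); last by rewrite lerMn2r h orbT.
      by apply: ler_wpMn2l => //; rewrite /k1; lia.
    by rewrite mulr1n /k1; lia.
  have [pos|le0] := ltP 0 ((k1 - n.+1%:Z) *+ (q ^ r).-1 + v (c r)).
    exists unit, (fun=> tt) => x y [_ hx] [_ hy] _.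
    case: (lower_boundB (val_ultrametric hv) hx hy) => [->|]; first by left.
    rewrite ler_int => h; right; rewrite -[1]/(1%:~R) ler_int /nu.
    have : (k1 - n.+1%:Z) *+ (q ^ r).-1 <= v (x - y) *+ (q ^ r).-1.
      by rewrite lerMn2r h orbT.
    by lia.
  have [s sW sP] := near_julia_level b0 le0.
  apply: (finite_classes_translate (s := s)) IH => [x Wx|x y z].
    have [y ys hy] := sP x Wx; exists y => //; split.
      by apply: near_juliaB; [case: Wx | case: (sW y ys)].
    by have -> : k1 - n%:Z = k1 - n.+1%:Z + 1 by lia.
  by rewrite opprB addrA subrK.
pose B := Num.bound (b v).
have sub : near_julia `<=` W (k1 - (absz (k1 + `|v (c r)| + B%:Z))%:Z); last first.
  exact: (finite_classesS sub _ (fin _)).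
move=> x hx.
split=> //; case: hx => [[->|hx] _]; first by left.
have [->|x0] := eqVneq x 0; first by left.
right; rewrite ler_int leNgt; apply/negP => lt.
have vx : v x < - `|v (c r)| - B%:Z.
  by move: lt; rewrite /k1; lia.
have : nu v x < - B%:Z.
  rewrite /nu; have : v x *+ (q ^ r).-1 <= v x.
    by rewrite -[X in _ <= X]mulr1n; apply: ler_wnMn2l => //; lia.
  by lia.
rewrite -(ltr_int R) rmorphN /= => h.
have : b v < B%:R by apply: archi_boundP; exact: pole_radius_ge0.
move: hx h; rewrite -pmulrn => h1 h2 h3.
by have := le_lt_trans h1 h2; rewrite ltrN2 => /(lt_trans h3); rewrite ltxx.
Qed.

(* Poles of high order of elements of the image of f have order -v (c r) modulo
   q ^ r. *)
Lemma image_classes_infinite : exists u : nat -> K,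
  forall i j, (i < j)%N -> ~ exists z, u j - u i = f z.
Proof.
pose B := Num.bound (Q * b v).
pose n0 := (`|v (c r)|.*2 + B + 2)%N.
(* The + 1 leaves the residue class of v (c r) modulo q^r, where valuations of high poles of the
   image lie. The valuations decrease strictly, so u j - u i keeps that of u j; n0 makes the pole
   high enough. *)
pose ord n : int := v (c r) + 1 - ((n0 + n) * q ^ r)%N%:Z.
have /choice [u uP] : forall n, exists x, x != 0 /\ v x = ord n.
  by move=> n; have [x x0 vx] := dval_surj hv (ord n); exists x.
have Q4 := Q_ge4 q_gt1 r_gt1.
exists u => i j ij [z].
have [ui0 vi] := uP i; have [uj0 vj] := uP j.
have lt : ord j < ord i.
  have h : ((n0 + i) * q ^ r < (n0 + j) * q ^ r)%N by nia.
  by rewrite /ord; lia.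
have n0j : (n0 <= (n0 + j) * q ^ r)%N by nia.
have [] := @ultrametric_dominated R _ v (u j) (- u i) (val_ultrametric hv) uj0.
  right; rewrite (dvalN _ hv) vi vj ler_int; lia.
set y := u j - u i => y0; rewrite vj => vy yE.
have z0 : z != 0.
  apply: contraNneq y0 => z0; rewrite yE fE big1 // => l _.
  rewrite z0 expr0n; have -> : (q ^ l == 0)%N = false; rewrite ?mulr0 //.
  by apply/negbTE; rewrite -lt0n expn_gt0; lia.
have big : (nu v y) < - B%:Z.
  rewrite /nu vy; have : ord j *+ (q ^ r).-1 <= ord j.
    rewrite -[X in _ <= X]mulr1n; apply: ler_wnMn2l; last by lia.
    by move: n0j; rewrite /ord /n0; lia.
  have : ord j < - `|v (c r)| - B%:Z.
    by move: n0j; rewrite /ord /n0; lia.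
  by lia.
have bB : Q * b v < B%:R by apply: archi_boundP; rewrite mulr_ge0 // pole_radius_ge0.
have nuR : (nu v y)%:~R < - B%:R :> R.
  by have := big; rewrite -(ltr_int R) rmorphN /= -pmulrn.
(* For z within the pole radius, f z would have [nu] at least -Q b, which B excludes. *)
have [hz|hz] := ltP (b v) (- (nu v z)%:~R); last first.
  have [|/eqP|] := @normalized_image_ge z (b v) (lexx _).
  - by right; rewrite lerNl.
  - by rewrite -yE (negPf y0).
  rewrite -yE => h; have := le_lt_trans h nuR.
  by rewrite ltrN2 => /(lt_trans bB); rewrite ltxx.
have [_] := normalized_image_eq z0 hz; rewrite -yE /nu vy /ord.
have -> : (q ^ r = (q ^ r).-1.+1)%N by lia.
have N3 : (2 < (q ^ r).-1)%N by lia.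
move: (q ^ r).-1 N3 => N N3; rewrite /= => e.
have {e} : (v (c r) + 1 - ((n0 + j) * N.+1)%N%:Z) * N%:Z + v (c r) =
  (v z * N%:Z + v (c r)) * (N.+1)%:Z.
  by move: e; lia.
move: (v z) (v (c r)) (n0 + j)%N => a d e.
rewrite PoszM -addn1 PoszD => E.
(* N + 1 would divide N. *)
have {}E : (N%:Z + 1) * (a * N%:Z + e%:Z * N%:Z) = N%:Z.
  by apply: (@addrI _ ((d - e%:Z * (N%:Z + 1)) * N%:Z + d)); rewrite -[RHS]addrC; nia.
move: E; move: (a * _ + _) => t E.
have N1 : 0 <= N%:Z + 1 :> int by lia.
have [t0|t0] := lerP t 0.
  by have := mulr_ge0_le0 N1 t0; rewrite E; lia.
have : N%:Z + 1 <= (N%:Z + 1) * t by rewrite ler_peMr // -gtz0_ge1.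
by rewrite E; lia.
Qed.

End OneValuation.
End LocalHeight.

(** * The canonical height *)

Section FiniteSupportSums.
Variables (R : realDomainType) (I : choiceType) (P : set I).
Implicit Types g : I -> R.

(** A sum of infinite support is 0 by convention, so comparisons and additions of sums must carry
    this condition. *)
Definition finite_support_on g := finite_set [set i | P i /\ g i != 0].

Lemma fsum_common_support (g : I -> R) (s : seq I) : uniq s -> [set` s] `<=` P ->
  (forall i, P i -> g i != 0 -> i \in s) ->
  \sum_(i \in P) g i = \sum_(i <- s) g i.
Proof.
move=> us sP gs; rewrite (fsbigE s _ us sP) => [|i Pi /negP nis].
  rewrite big_mkcond [LHS]big_seq [RHS]big_seq; apply: eq_bigr => i si.
  by rewrite mem_set //; exact: sP.
by apply/eqP/negPn/negP => gi; apply: nis; exact: gs.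
Qed.

Lemma finite_support_seq (D : set I) : finite_set D -> D `<=` P ->
  exists s : seq I, [/\ uniq s, [set` s] `<=` P & forall i, D i -> i \in s].
Proof.
move=> /finite_seqP [s ->] sP; exists (undup s); split; first exact: undup_uniq.
  by move=> i /=; rewrite mem_undup; exact: sP.
by move=> i /=; rewrite mem_undup.
Qed.

Lemma ler_fsum g1 g2 : finite_support_on g1 -> finite_support_on g2 ->
  (forall i, P i -> g1 i <= g2 i) -> \sum_(i \in P) g1 i <= \sum_(i \in P) g2 i.
Proof.
move=> f1 f2 le12; have [||s [us sP hs]] := @finite_support_seq
  ([set i | P i /\ g1 i != 0] `|` [set i | P i /\ g2 i != 0]).
- by rewrite finite_setU.
- by move=> i [[]|[]].
rewrite (fsum_common_support us sP); last by move=> i Pi gi; apply: hs; left.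
rewrite (fsum_common_support us sP); last by move=> i Pi gi; apply: hs; right.
by rewrite big_seq [leRHS]big_seq; apply: ler_sum => i /sP; exact: le12.
Qed.

Lemma fsumD g1 g2 : finite_support_on g1 -> finite_support_on g2 ->
  \sum_(i \in P) (g1 i + g2 i) = \sum_(i \in P) g1 i + \sum_(i \in P) g2 i.
Proof.
move=> f1 f2; have [||s [us sP hs]] := @finite_support_seq
  ([set i | P i /\ g1 i != 0] `|` [set i | P i /\ g2 i != 0]).
- by rewrite finite_setU.
- by move=> i [[]|[]].
rewrite (fsum_common_support us sP); last first.
  move=> i Pi gi; apply: hs.
  have [g10|] := eqVneq (g1 i) 0; last by left.
  by right; split=> //; apply: contraNneq gi => ->; rewrite g10 addr0.
rewrite (fsum_common_support us sP); last by move=> i Pi gi; apply: hs; left.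
rewrite (fsum_common_support us sP); last by move=> i Pi gi; apply: hs; right.
by rewrite big_split.
Qed.

Lemma finite_support_sub g1 g2 : finite_support_on g1 ->
  (forall i, P i -> g1 i = 0 -> g2 i = 0) -> finite_support_on g2.
Proof.
move=> f1 h; apply: sub_finite_set f1 => i [Pi gi]; split=> //.
by apply: contraNneq gi => e; apply/eqP; exact: h.
Qed.

Lemma finite_supportD g1 g2 : finite_support_on g1 -> finite_support_on g2 ->
  finite_support_on (fun i => g1 i + g2 i).
Proof.
move=> f1 f2; apply: (@sub_finite_set _ _
  ([set i | P i /\ g1 i != 0] `|` [set i | P i /\ g2 i != 0])); last first.
  by rewrite finite_setU.
move=> i [Pi gi]; have [g10|] := eqVneq (g1 i) 0; last by left.
by right; split=> //; apply: contraNneq gi => ->; rewrite g10 addr0.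
Qed.

Lemma ler_term_fsum g i : finite_support_on g -> (forall i, P i -> 0 <= g i) -> P i ->
  g i <= \sum_(i \in P) g i.
Proof.
move=> fg g0 Pi; have [||s [us sP hs]] := @finite_support_seq
  (i |` [set i | P i /\ g i != 0]).
- by rewrite finite_setU.
- by move=> k [->|[]].
rewrite (fsum_common_support us sP); last by move=> k Pk gk; apply: hs; right.
rewrite (big_rem i) /=; last by apply: hs; left.
rewrite lerDl big_seq; apply: sumr_ge0 => k /mem_rem /sP; exact: g0.
Qed.

End FiniteSupportSums.

Section GlobalHeight.
Variables (R : realType) (K : fieldType) (U : set (K -> int)) (d : (K -> int) -> R).
Hypothesis hU : good_set U d.
Variables (q r : nat) (c : nat -> K) (f : K -> K).
Hypothesis q_gt1 : (1 < q)%N.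
Hypothesis r_gt1 : (1 < r)%N.
Hypothesis cr0 : c r != 0.
Hypothesis fE : forall x, f x = \sum_(j < r.+1) c j * x ^+ (q ^ j).
Hypothesis fB : forall x y, f (x - y) = f x - f y.

Local Notation nu := (normalized_val q r c).
Local Notation kappa := (normalized_coef_val q r c).
Local Notation Q := ((q ^ r)%:R : R).
Local Notation b := (pole_radius R q r c).

Hypothesis bad_place : exists2 v, U v & b v != 0.

Let d0 v : U v -> 0 < d v. Proof. exact: (good_deg_gt0 hU). Qed.
Let b0 v : 0 <= b v. Proof. exact: pole_radius_ge0. Qed.
Let Q4 : 4 <= Q. Proof. by rewrite ler_nat (Q_ge4 q_gt1 r_gt1). Qed.
Let Q_gt0 : 0 < Q. Proof. by move: Q4 => h; lra. Qed.
Let nu_ultra v : U v -> ultrametric (nu v).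
Proof. by move=> /(good_val hU) hv; exact: normalized_ultrametric. Qed.

(* The contribution of v to the naive height, truncated below at the pole
   radius so that it grows by a factor of at most Q under f. *)
Definition local_height v x : R :=
  if x == 0 then b v else Num.max (b v) (- (nu v x)%:~R).

(* The part of the height that grows by a factor of at least Q under f. *)
Definition escape_height v x : R :=
  if (x == 0) || (- (nu v x)%:~R <= b v) then 0 else - (nu v x)%:~R.

Lemma local_height_ge v x : b v <= local_height v x.
Proof. by rewrite /local_height; case: ifP; rewrite // le_max lexx. Qed.

Lemma local_height_ge0 v x : 0 <= local_height v x.
Proof. exact: le_trans (b0 v) (local_height_ge v x). Qed.

Lemma local_height_bound v x : x = 0 \/ - local_height v x <= (nu v x)%:~R.
Proof.
rewrite /local_height; have [->|x0] := eqVneq x 0; [by left | right].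
by rewrite lerNl le_max lexx orbT.
Qed.

Lemma local_height_le v x m : b v <= m -> lower_bound (nu v) (- m) x ->
  local_height v x <= m.
Proof.
rewrite /local_height; have [//|x0] := eqVneq x 0.
by move=> bm [/eqP|h]; rewrite ?(negPf x0) // ge_max bm lerNl.
Qed.

Lemma local_heightD v x y : U v ->
  local_height v (x + y) <= local_height v x + local_height v y.
Proof.
move=> Uv; have hx := local_height_ge0 v x; have hy := local_height_ge0 v y.
apply: local_height_le.
  by apply: le_trans (local_height_ge v x) _; rewrite lerDl.
have hw := nu_ultra Uv; apply: (lower_boundD hw).
  apply: lower_boundW (local_height_bound v x); lra.
apply: lower_boundW (local_height_bound v y); lra.
Qed.

Lemma local_height_image v x : U v -> local_height v (f x) <= Q * local_height v x.
Proof.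
move=> Uv; have bx := local_height_ge v x.
apply: local_height_le.
  by apply: le_trans bx _; rewrite ler_peMl ?local_height_ge0 //; move: Q4 => h; lra.
apply: (normalized_image_ge q_gt1 r_gt1 cr0 fE (good_val hU Uv)) => //.
exact: local_height_bound.
Qed.

Lemma escape_height_ge0 v x : 0 <= escape_height v x.
Proof.
rewrite /escape_height; case: ifP => // /negbT; rewrite negb_or -ltNge => /andP [_ h].
exact: le_trans (b0 v) (ltW h).
Qed.

Lemma escape_height_le v x : escape_height v x <= local_height v x.
Proof.
rewrite /escape_height; case: ifP => [_|/negbT]; first exact: local_height_ge0.
by rewrite negb_or /local_height => /andP [/negPf -> _]; rewrite le_max lexx orbT.
Qed.

Lemma escape_height_image v x : U v -> Q * escape_height v x <= escape_height v (f x).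
Proof.
move=> Uv; rewrite {1}/escape_height; case: ifP => [_|/negbT].
  by rewrite mulr0 escape_height_ge0.
rewrite negb_or -ltNge => /andP [x0 hx].
have [fx0 nufx] := normalized_image_eq q_gt1 r_gt1 cr0 fE (good_val hU Uv) x0 hx.
rewrite /escape_height (negPf fx0) nufx rmorphMn /=.
set n := (nu v x)%:~R in hx *.
have le : - n <= - (n * Q).
  rewrite lerN2 -subr_ge0; have -> : n - n * Q = (- n) * (Q - 1) by ring.
  by apply: mulr_ge0; [exact: le_trans (b0 v) (ltW hx) | move: Q4 => h; lra].
have -> : n *- (q ^ r) = - (n * Q) by rewrite mulr_natr.
case: ifP => [h|_]; last by rewrite mulrN mulrC.
by have := lt_le_trans hx (le_trans le h); rewrite ltxx.
Qed.

(** A nonzero radius requires some nonzero coefficient of f to have nonzero valuation. *)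
Lemma finite_support_radius : finite_support_on U (fun v => d v * b v).
Proof.
apply: (@sub_finite_set _ _ (\bigcup_(j in [set: 'I_r.+1])
    [set v | [/\ U v, c j != 0 & v (c j) != 0]])); last first.
  apply: bigcup_finite; first exact: finite_finset.
  move=> j _; have [cj|/eqP cj] := pselect (c j = 0).
    have sub0 : [set v | [/\ U v, c j != 0 & v (c j) != 0]] `<=` set0.
      by move=> v /= [_ h _]; move: h; rewrite cj eqxx.
    exact: (sub_finite_set sub0 (finite_set0 _)).
  by apply: sub_finite_set (good_finite hU cj) => v [].
move=> v [Uv]; rewrite mulf_eq0 negb_or => /andP [_ bv].
have [e|[j [jr cj] hj]] := pole_radius_att R c q_gt1 r_gt1 v.
  by rewrite e eqxx in bv.
have kj : kappa v j != 0.
  apply: contraNneq bv => e; move: hj; rewrite e.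
  move/esym/eqP; rewrite oppr_eq0 mulf_eq0 => /orP [//|/eqP e'].
  by have := q_gapR R q_gt1 r_gt1 jr; rewrite e'; lra.
have [vr|vr] := eqVneq (v (c r)) 0; last by exists ord_max.
exists (inord j) => //=; rewrite inordK; last by rewrite ltnS ltnW.
by split=> //; apply: contraNneq kj => vj; rewrite /kappa vj vr !mul0rn subrr.
Qed.

Lemma finite_support_nu x : x != 0 ->
  finite_support_on U (fun v => d v * (nu v x)%:~R).
Proof.
move=> x0; apply: (@sub_finite_set _ _ ([set v | U v /\ v x != 0]
    `|` [set v | U v /\ v (c r) != 0])); last first.
  by rewrite finite_setU; split; exact: (good_finite hU).
move=> v [Uv]; rewrite mulf_eq0 negb_or => /andP [_ h].
have [vx|] := eqVneq (v x) 0; last by left.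
right; split=> //; apply: contraNneq h => vc.
by rewrite /nu vx vc mul0rn.
Qed.

Lemma finite_support_height x : finite_support_on U (fun v => d v * local_height v x).
Proof.
have [->|x0] := eqVneq x 0.
  by rewrite /local_height eqxx; exact: finite_support_radius.
apply: (@sub_finite_set _ _ ([set v | U v /\ d v * b v != 0]
    `|` [set v | U v /\ d v * (nu v x)%:~R != 0])); last first.
  by rewrite finite_setU; split; [exact: finite_support_radius | exact: finite_support_nu].
move=> v [Uv h]; have [e|] := eqVneq (d v * b v) 0; last by left.
right; split=> //; apply: contraNneq h.
move/eqP: e; rewrite mulf_eq0 gt_eqF ?d0 //= => /eqP bv /eqP.
rewrite mulf_eq0 gt_eqF ?d0 //= => /eqP n0.
by rewrite /local_height (negPf x0) bv n0 oppr0 maxxx mulr0.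
Qed.

Lemma finite_support_escape x :
  finite_support_on U (fun v => d v * escape_height v x).
Proof.
apply: finite_support_sub (finite_support_height x) _ => v Uv /eqP.
rewrite mulf_eq0 gt_eqF ?d0 //= => /eqP e.
have := escape_height_le v x; have := escape_height_ge0 v x; rewrite e => h1 h2.
by have -> : escape_height v x = 0; [apply/le_anti; rewrite h1 h2 | rewrite mulr0].
Qed.

Definition naive_height x : R := \sum_(v \in U) d v * local_height v x.

Lemma naive_height_ge0 x : 0 <= naive_height x.
Proof.
apply: fsumr_ge0 => v Uv; apply: mulr_ge0; last exact: local_height_ge0.
exact/ltW/d0.
Qed.

Lemma naive_heightD x y : naive_height (x + y) <= naive_height x + naive_height y.
Proof.
rewrite /naive_height -fsumD; [|exact: finite_support_height..].
apply: ler_fsum; [exact: finite_support_height| |].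
  by apply: finite_supportD; exact: finite_support_height.
move=> v Uv; rewrite -mulrDr ler_pM2l ?d0 //; exact: local_heightD.
Qed.

Lemma naive_height_image x : naive_height (f x) <= Q * naive_height x.
Proof.
rewrite /naive_height mulr_fsumr; apply: ler_fsum.
- exact: finite_support_height.
- apply: finite_support_sub (finite_support_height x) _ => v Uv ->; exact: mulr0.
move=> v Uv; rewrite mulrCA ler_pM2l ?d0 //; exact: local_height_image.
Qed.

Definition escape_sum x : R := \sum_(v \in U) d v * escape_height v x.

Lemma escape_sum_le x : escape_sum x <= naive_height x.
Proof.
apply: ler_fsum; [exact: finite_support_escape | exact: finite_support_height |].
by move=> v Uv; rewrite ler_pM2l ?d0 //; exact: escape_height_le.
Qed.

Lemma escape_sum_image x : Q * escape_sum x <= escape_sum (f x).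
Proof.
rewrite /escape_sum mulr_fsumr; apply: ler_fsum.
- apply: finite_support_sub (finite_support_escape x) _ => v Uv ->; exact: mulr0.
- exact: finite_support_escape.
move=> v Uv; rewrite mulrCA ler_pM2l ?d0 //; exact: escape_height_image.
Qed.

Local Notation approx n x := (naive_height (iter n f x) / Q ^+ n).

(** The naive height grows at most by Q under f, so the approximations decrease and the infimum is
    their limit. *)
Definition canonical_height x : R := inf [set approx n x | n in [set: nat]].

Local Notation h := canonical_height.

Lemma canonical_height_ge x M : (forall n, M <= approx n x) -> M <= h x.
Proof.
move=> hM; apply: lb_le_inf; first by exists (approx 0 x), 0%N.
by move=> _ [n _ <-]; exact: hM.
Qed.

Lemma canonical_height_le x n : h x <= approx n x.
Proof.
apply: ge_inf; last by exists n.
exists 0 => _ [k _ <-]; apply: divr_ge0; first exact: naive_height_ge0.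
by rewrite exprn_ge0 // ltW.
Qed.

Lemma approx_decr x n m : (n <= m)%N -> approx m x <= approx n x.
Proof.
move=> /subnK <-; elim: (m - n)%N => // k IH; apply: le_trans IH.
rewrite addSn iterS ler_pdivrMr ?exprn_gt0 //.
apply: le_trans (naive_height_image _) _.
by rewrite exprS mulrCA divfK // expf_neq0 // gt_eqF.
Qed.

Lemma canonical_height_ge0 x : 0 <= h x.
Proof.
apply: canonical_height_ge => n; apply: divr_ge0; first exact: naive_height_ge0.
by rewrite exprn_ge0 // ltW.
Qed.

Let fD x y : f (x + y) = f x + f y.
Proof.
have f0 : f 0 = 0 by have := fB 0 0; rewrite !subrr.
have fN z : f (- z) = - f z by rewrite -sub0r fB f0 sub0r.
by rewrite -{1}[y]opprK fB fN opprK.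
Qed.

Let iterfD n x y : iter n f (x + y) = iter n f x + iter n f y.
Proof. by elim: n => //= n ->. Qed.

Lemma canonical_heightD x y : h (x + y) <= h x + h y.
Proof.
have key n m : h (x + y) <= approx n x + approx m y.
  apply: le_trans (canonical_height_le _ (maxn n m)) _.
  apply: (@le_trans _ _ (approx (maxn n m) x + approx (maxn n m) y)); last first.
    by apply: lerD; apply: approx_decr; rewrite ?leq_maxl ?leq_maxr.
  rewrite -mulrDl ler_pM2r ?invr_gt0 ?exprn_gt0 // iterfD; exact: naive_heightD.
rewrite -lerBlDr; apply: canonical_height_ge => n.
rewrite lerBlDr -lerBlDl; apply: canonical_height_ge => m.
by rewrite lerBlDl.
Qed.

Lemma canonical_height_image x : h (f x) = Q * h x.
Proof.
have approxS n : approx n (f x) = Q * approx n.+1 x.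
  by rewrite -iterSr exprS invfM mulrCA mulVKf // gt_eqF.
apply/le_anti/andP; split.
  rewrite -ler_pdivrMl //; apply: canonical_height_ge => n.
  rewrite ler_pdivrMl //; apply: le_trans (canonical_height_le _ n) _.
  by rewrite approxS ler_pM2l //; exact: approx_decr.
apply: canonical_height_ge => n; rewrite approxS ler_pM2l //.
exact: canonical_height_le.
Qed.

Lemma canonical_height_unit a x : a != 0 -> (forall v, U v -> v a = 0) ->
  (forall y, f (a * y) = a * f y) -> h (a * x) = h x.
Proof.
move=> a0 va fa; rewrite /h; congr inf.
suff e n : approx n (a * x) = approx n x.
  by apply/seteqP; split=> _ [n _ <-]; exists n; rewrite ?e.
have -> : iter n f (a * x) = a * iter n f x by elim: n => //= n ->; rewrite fa.
congr (_ / _); apply: eq_fsbigr => v; rewrite inE => Uv; congr (_ * _).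
rewrite /local_height mulf_eq0 (negPf a0) /=; case: eqVneq => // y0.
by rewrite /nu (dvalM (good_val hU Uv)) // va // add0r.
Qed.

(** The escape part grows at least by Q at each iteration, so it survives the division by Q^n in the
    limit. *)
Lemma escape_sum_le_canonical x : escape_sum x <= h x.
Proof.
apply: canonical_height_ge => n; rewrite ler_pdivlMr ?exprn_gt0 //.
apply: le_trans (escape_sum_le _).
elim: n => [|n IH]; first by rewrite expr0 mulr1.
rewrite iterS exprSr mulrA; apply: le_trans (escape_sum_image _).
by rewrite mulrC ler_pM2l.
Qed.

Lemma escape_height_le_canonical v x : U v -> d v * escape_height v x <= h x.
Proof.
move=> Uv; apply: le_trans (escape_sum_le_canonical x).
apply: (ler_term_fsum (finite_support_escape x) _ Uv) => w Uw.
by rewrite mulr_ge0 ?escape_height_ge0 // ltW // d0.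
Qed.

Lemma escape_height_lt v x : b v != 0 -> escape_height v x < b v ->
  lower_bound (nu v) (- b v) x.
Proof.
rewrite /escape_height; have [->|x0] := eqVneq x 0; first by left.
rewrite orFb; case: ifP => [le _ _|/negbT]; first by right; rewrite lerNl.
by rewrite -ltNge => lt _ /(lt_trans lt); rewrite ltxx.
Qed.

(** The shift by v (c r) does no harm, since c r is itself a nonzero element of K. *)
Lemma product_formula x : x != 0 -> \sum_(v \in U) d v * (nu v x)%:~R = 0.
Proof.
move=> x0; pose N := ((q ^ r).-1)%:R : R.
have E v : d v * (nu v x)%:~R = N * (d v * (v x)%:~R) + d v * (v (c r))%:~R.
  by rewrite /nu intrD rmorphMn /= /N; ring.
under eq_fsbigr => v _ do rewrite E.
have fs y : y != 0 -> finite_support_on U (fun v => d v * (v y)%:~R).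
  move=> y0; apply: sub_finite_set (good_finite hU y0) => v [Uv hv]; split=> //.
  by apply: contraNneq hv => ->; rewrite mulr0.
rewrite fsumD; [|by apply: finite_support_sub (fs _ x0) _ => v Uv ->; rewrite mulr0|exact: fs].
by rewrite -mulr_fsumr !(good_sum hU) // mulr0 addr0.
Qed.

(* Two points of small height in the same class at every bad place differ by an
   element whose zeros at the bad places outweigh its poles. *)
Lemma small_canonical_height : exists2 eps, 0 < eps &
  exists Z : seq K, forall x, h x < eps -> x \in Z.
Proof.
pose bad := [set v | U v /\ b v != 0].
have [s [us sU sbad]] : exists s : seq (K -> int),
    [/\ uniq s, [set` s] `<=` bad & forall v, bad v -> v \in s].
  apply: finite_support_seq => //; apply: sub_finite_set finite_support_radius => v [Uv bv].
  by split=> //; rewrite mulf_neq0 // gt_eqF // d0.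
pose delta := \sum_(v \in U) (if b v != 0 then d v else 0).
have fdelta : finite_support_on U (fun v => if b v != 0 then d v else 0).
  apply: finite_support_sub finite_support_radius _ => v Uv /eqP.
  by rewrite mulf_eq0 gt_eqF ?d0 //= => /eqP ->; rewrite eqxx.
have delta0 : 0 < delta.
  have [v Uv bv] := bad_place.
  apply: lt_le_trans (ler_term_fsum fdelta _ Uv) => /=; first by rewrite bv d0.
  by move=> w Uw; case: ifP => // _; rewrite ltW // d0.
(* Below d v * b v / Q, both h x and h (f x) = Q h x are too small for x or f x to escape at v. For
   two points in the same classes, [inj] would give delta <= h x + h y, which delta / 2
   contradicts. *)
pose eps := \big[Num.min/delta / 2]_(v <- s) (d v * b v / Q).
have eps0 : 0 < eps.
  rewrite /eps big_seq; elim/big_ind: _ => [|x y x0 y0|v /sU [Uv bv]].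
  - by rewrite divr_gt0.
  - by rewrite lt_min x0.
  - by rewrite divr_gt0 // mulr_gt0 ?d0 // lt_def bv b0.
have eps_delta : eps <= delta / 2.
  rewrite /eps; elim/big_rec: _ => // v x _ hx.
  by rewrite ge_min hx orbT.
have eps_bad v : v \in s -> eps <= d v * b v / Q.
  rewrite /eps; elim: (s) => // w s' IH; rewrite inE big_cons ge_min.
  by case/orP => [/eqP -> | /IH ->]; rewrite ?lexx ?orbT.
exists eps => //.
pose W := [set x | h x < eps].
have julia x v : W x -> v \in s -> near_julia R q r c f v x.
  move=> hx vs; have [Uv bv] := sU v vs.
  have bv0 : 0 < b v by rewrite lt_def bv b0.
  have lt1 : Q * h x < d v * b v.
    by rewrite mulrC -ltr_pdivlMr //; exact: lt_le_trans (eps_bad v vs).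
  split; apply: escape_height_lt => //.
    rewrite -(ltr_pM2l (d0 Uv)); apply: le_lt_trans (escape_height_le_canonical x Uv) _.
    apply: le_lt_trans lt1; rewrite ler_peMl ?canonical_height_ge0 //.
    by move: Q4 => h4; lra.
  rewrite -(ltr_pM2l (d0 Uv)).
  apply: le_lt_trans (escape_height_le_canonical (f x) Uv) _.
  by rewrite canonical_height_image.
have gen (s' : seq (K -> int)) (W' : set K) : [set` s'] `<=` bad ->
    (forall x v, W' x -> v \in s' -> near_julia R q r c f v x) ->
    finite_classes W' (fun x y =>
      forall v, v \in s' -> lower_bound (nu v) (1 : R) (x - y)).
  elim: s' W' => [|v s' IH] W' hs hW.
    by exists unit, (fun=> tt) => x y _ _ _ v; rewrite in_nil.
  have [Uv bv] := hs v (mem_head _ _).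
  have fc := near_julia_classes q_gt1 r_gt1 cr0 fE fB (good_val hU Uv) bv.
  have {}IH : finite_classes W' (fun x y =>
      forall v, v \in s' -> lower_bound (nu v) (1 : R) (x - y)).
    apply: IH => [w /= ws|x w Wx ws]; first by apply: hs; rewrite /= inE ws orbT.
    by apply: hW => //; rewrite inE ws orbT.
  apply: finite_classesS (finite_classesI fc IH) => [x Wx|x y [h1 h2] w].
    by split=> //; apply: hW => //; exact: mem_head.
  by rewrite inE => /orP [/eqP -> //|]; exact: h2.
have classes := gen s W sU julia.
have inj x y : W x -> W y ->
    (forall v, v \in s -> lower_bound (nu v) (1 : R) (x - y)) -> x = y.
  move=> Wx Wy hxy; apply/eqP; rewrite -subr_eq0; apply/negPn/negP => z0.
  have := product_formula z0; set z := x - y in z0 hxy *.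
  suff : \sum_(v \in U) (if b v != 0 then d v else 0) <=
    \sum_(v \in U) d v * (nu v z)%:~R + escape_sum x + escape_sum y.
    have := escape_sum_le_canonical x; have := escape_sum_le_canonical y.
    move: Wx Wy; rewrite /W /= -/delta; move: (escape_sum x) (escape_sum y).
    move: eps_delta; move: (h x) (h y) => hx hy e0 e1 e2 l1 l2 l3 l4 l5 l6.
    by move: l5; rewrite l6; lra.
  rewrite /escape_sum -addrA -!fsumD;
    try exact: finite_support_escape; try exact: finite_support_nu.
    apply: ler_fsum => //.
      apply: finite_supportD; first exact: finite_support_nu.
      by apply: finite_supportD; exact: finite_support_escape.
    move=> v Uv; have dv := d0 Uv; rewrite -!mulrDr.
    have ex := escape_height_ge0 v x; have ey := escape_height_ge0 v y.
    case: ifP => [bv|/negbT/negPn/eqP bv].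
      have vs : v \in s by apply: sbad.
      case: (hxy v vs) => [/eqP|n1]; first by rewrite (negPf z0).
      by rewrite ler_peMr ?(ltW dv) //; lra.
    rewrite pmulr_rge0 //.
    have esc t : lower_bound (nu v) (- escape_height v t) t.
      rewrite /escape_height bv; have [->|t0] := eqVneq t 0; first by left.
      rewrite orFb; case: ifP => ht; right; last by rewrite opprK.
      by rewrite oppr0 -oppr_le0.
    have : lower_bound (nu v) (- (escape_height v x + escape_height v y)) z.
      apply: (lower_boundB (nu_ultra Uv)).
        by apply: lower_boundW (esc x); lra.
      by apply: lower_boundW (esc y); lra.
    by case=> [/eqP|]; [rewrite (negPf z0) | lra].
  by apply: finite_supportD; exact: finite_support_escape.
have [Z ZW ZP] := finite_classes_reps classes.
exists Z => x Wx; have [y yZ hxy] := ZP x Wx.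
by rewrite (inj x y Wx (ZW y yZ) hxy).
Qed.

End GlobalHeight.
(** * The function ring *)

Section FinitenessOverPolynomials.
Variables (Fq : finFieldType) (E : fieldType) (iE : {rmorphism Fq -> E}).

Local Notation ev t P := ((map_poly iE P).[t]).

Lemma fractions_subfield (t : E) : subfield
  [set z | exists P D : {poly Fq}, ev t D != 0 /\ z = ev t P / ev t D].
Proof.
split.
- by exists 1, 1; rewrite rmorph1 hornerE oner_neq0 divr1.
- move=> _ _ [P [D [D0 ->]]] [P' [D' [D'0 ->]]].
  exists (P * D' - P' * D), (D * D'); rewrite !(rmorphB, rmorphM) /= !hornerE.
  by split; [rewrite mulf_neq0 | field; rewrite D0 D'0].
move=> _ _ [P [D [D0 ->]]] [P' [D' [D'0 ->]]].
have [P'0|P'0] := eqVneq (ev t P') 0.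
  exists 0, 1; rewrite rmorph1 rmorph0 !hornerE oner_neq0; split=> //.
  by rewrite P'0 !(mul0r, invr0, mulr0).
exists (P * D'), (D * P'); rewrite !rmorphM /= !hornerE.
by split; [rewrite mulf_neq0 | field; rewrite D0 D'0 P'0].
Qed.

Lemma gen_subfield_fraction (t : E) z : gen_subfield (range iE `|` [set t]) z ->
  exists P D : {poly Fq}, ev t D != 0 /\ z = ev t P / ev t D.
Proof.
move=> h; apply: (h _ (conj (fractions_subfield t) _)).
move=> y [[x _ <-]| ->].
  by exists x%:P, 1; rewrite rmorph1 map_polyC !hornerE oner_neq0 divr1.
by exists 'X, 1; rewrite rmorph1 map_polyX !hornerE oner_neq0 divr1.
Qed.

Lemma common_denominator (I : Type) (t : E) (s : seq I) (z : I -> E) :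
  (forall i, exists P D : {poly Fq}, ev t D != 0 /\ z i = ev t P / ev t D) ->
  exists D : {poly Fq}, ev t D != 0 /\
    forall i, List.In i s -> exists P : {poly Fq}, ev t D * z i = ev t P.
Proof.
move=> hz; elim: s => [|i s [D [D0 hD]]].
  by exists 1; rewrite rmorph1 hornerE oner_neq0.
have [P [D' [D'0 zi]]] := hz i.
exists (D * D'); rewrite rmorphM hornerM mulf_neq0 //; split=> // k /= [<-|/hD [P' e]].
  by exists (D * P); rewrite zi rmorphM hornerM; field.
by exists (D' * P'); rewrite rmorphM hornerM -e; ring.
Qed.

Hypothesis curve_E : curve_function_field iE.

(* Multiplication by t raises the degrees of coordinates by at most a fixed
   amount, so the D N products t^i y_k, with i < D, lie in a space of dimension
   O(D) with a constant independent of N. *)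
Lemma polynomial_dependence (t : E) : exists N, forall y : nat -> E,
  exists P : nat -> {poly Fq},
    (exists2 i, (i < N)%N & P i != 0) /\ \sum_(i < N) ev t (P i) * y i = 0.
Proof.
have [t0 [_ [n [b hb]]]] := curve_E.
pose coord (D : {poly Fq}) e z := exists M : 'I_n -> {poly Fq},
  (forall j, (size (M j) <= e)%N) /\ ev t0 D * z = \sum_j ev t0 (M j) * b j.
have coordW D e e' z : (e <= e')%N -> coord D e z -> coord D e' z.
  by move=> le [M [sM h]]; exists M; split=> // j; exact: leq_trans le.
have coordM D (D' : {poly Fq}) e c z : (size D' <= c)%N ->
    coord D e z -> coord (D' * D) (c + e)%N z.
  move=> sD [M [sM h]]; exists (fun j => D' * M j); split=> [j|].
    apply: leq_trans (size_polyMleq _ _) _; apply: leq_trans (leq_pred _) _.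
    exact: leq_add.
  rewrite rmorphM hornerM -mulrA h mulr_sumr; apply: eq_bigr => j _.
  by rewrite rmorphM hornerM mulrA.
have coord_ex z : exists D e, ev t0 D != 0 /\ coord D e z.
  have [cz hcz ->] := hb z.
  have [D [D0 hD]] := common_denominator (enum 'I_n) (fun j => gen_subfield_fraction (hcz j)).
  have /choice [M hM] : forall j, exists P : {poly Fq}, ev t0 D * cz j = ev t0 P.
    move=> j; apply: hD; elim: (enum 'I_n) (mem_enum 'I_n j) => // a l IH.
    by rewrite inE => /orP [/eqP -> | /IH]; [left | right].
  exists D, (\max_j size (M j)); split=> //; exists M; split=> [j|].
    exact: (leq_bigmax j).
  by rewrite mulr_sumr; apply: eq_bigr => j _; rewrite mulrA hM.
have coord_all (m : nat) (z : nat -> E) : exists D e, ev t0 D != 0 /\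
    forall k, (k < m)%N -> coord D e (z k).
  elim: m => [|m [D [e [D0 hD]]]].
    by exists 1, 0%N; rewrite rmorph1 hornerE oner_neq0.
  have [D' [e' [D'0 hD']]] := coord_ex (z m).
  exists (D * D'), ((size D + e') + (size D' + e))%N.
  rewrite rmorphM hornerM mulf_neq0 //; split=> // k; rewrite ltnS leq_eqVlt.
  case/orP => [/eqP ->|/hD h].
    exact: coordW (leq_addr _ _) (coordM _ D _ _ _ (leqnn _) hD').
  by rewrite mulrC; exact: coordW (leq_addl _ _) (coordM _ D' _ _ _ (leqnn _) h).
pose tb k := if insub k is Some j then t * b j else 0.
have [h [c0 [h0 hc0]]] := coord_all n tb.
pose c := (c0 + size h)%N.
have step D e z : coord D e z -> coord (h * D) (c + e)%N (t * z).
  move=> [M [sM hM]].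
  have /choice [M' hM'] : forall j, exists M' : 'I_n -> {poly Fq},
      (forall k, (size (M' k) <= c0)%N) /\ ev t0 h * (t * b j) = \sum_k ev t0 (M' k) * b k.
    by move=> j; have := hc0 j (ltn_ord j); rewrite /tb valK.
  exists (fun k => \sum_j M j * M' j k); split=> [k|].
    apply: (leq_trans (size_sum _ _ _)); apply/bigmax_leqP => j _.
    apply: leq_trans (size_polyMleq _ _) _; apply: leq_trans (leq_pred _) _.
    rewrite addnC leq_add //; have [h' _] := hM' j.
    by apply: leq_trans (h' k) _; rewrite leq_addr.
  rewrite rmorphM hornerM.
  have -> : ev t0 h * ev t0 D * (t * z) = (ev t0 h * t) * (ev t0 D * z) by ring.
  rewrite hM mulr_sumr.
  transitivity (\sum_j \sum_k ev t0 (M j * M' j k) * b k).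
    apply: eq_bigr => j _; have [_ hj] := hM' j.
    have -> : ev t0 h * t * (ev t0 (M j) * b j) = ev t0 (M j) * (ev t0 h * (t * b j)).
      by ring.
    by rewrite hj mulr_sumr; apply: eq_bigr => k _; rewrite rmorphM hornerM mulrA.
  rewrite exchange_big; apply: eq_bigr => k _.
  by rewrite -mulr_suml rmorph_sum horner_sum.
have sh : (size h <= c)%N by exact: leq_addl.
(* There are (D + 1) N unknown coefficients and n e = n (D c + c') coordinates. With N = n c + 1 and
   D = n c' the unknowns exceed the coordinates by n c + 1. *)
exists (n * c).+1 => y; set N := (n * c).+1.
have [h' [c' [h'0 hc']]] := coord_all N y.
pose D := (n * c')%N; pose e := (D * c + c')%N.
have pow i k : (i <= D)%N -> (k < N)%N -> coord (h ^+ D * h') e (t ^+ i * y k).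
  move=> iD kN; have base m : coord (h ^+ m * h') (m * c + c')%N (t ^+ m * y k).
    elim: m => [|m IH]; first by rewrite !expr0 !mul1r; exact: hc'.
    by rewrite !exprS -!mulrA mulSn -addnA; exact: step.
  have ext m : coord (h ^+ (m + i)%N * h') ((m + i) * c + c')%N (t ^+ i * y k).
    elim: m => [|m IH]; first exact: base.
    by rewrite addSn exprS -mulrA mulSn -addnA; exact: coordM.
  by have := ext (D - i)%N; rewrite subnK.
have /choice [M hM] : forall ik : 'I_D.+1 * 'I_N, exists M : 'I_n -> {poly Fq},
    (forall j, (size (M j) <= e)%N) /\
    ev t0 (h ^+ D * h') * (t ^+ ik.1 * y ik.2) = \sum_j ev t0 (M j) * b j.
  by move=> [i k]; apply: pow; [exact: (ltn_ord i) | exact: (ltn_ord k)].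
pose comb (a : {ffun 'I_D.+1 * 'I_N -> Fq}) j := \sum_ik (a ik)%:P * M ik j.
pose code a := [ffun je : 'I_n * 'I_e => (comb a je.1)`_je.2].
have size_comb a j : (size (comb a j) <= e)%N.
  apply: (leq_trans (size_sum _ _ _)); apply/bigmax_leqP => ik _.
  by rewrite mul_polyC; apply: leq_trans (size_scale_leq _ _) _; have [] := hM ik.
(* Over a finite field the pigeonhole principle does the linear algebra: two families with the same
   code differ by a nontrivial relation. *)
have : ~~ injectiveb code.
  apply/negP => /injectiveP /leq_card; rewrite !card_ffun !card_prod !card_ord.
  rewrite leq_exp2l ?finNzRing_gt1 // leqNgt /e /N /D => /negP; apply; nia.
case/injectivePn => a [a' aa' eaa'].
have eM j : comb a j = comb a' j.
  apply/polyP => i; have [ie|ei] := ltnP i e.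
    by move/ffunP/(_ (j, Ordinal ie)): eaa'; rewrite !ffunE.
  by rewrite !nth_default // (leq_trans _ ei).
pose P k := if insub k is Some k' then
  \poly_(i < D.+1) (if insub i is Some i' then a (i', k') - a' (i', k') else 0) else 0.
have PE (k : 'I_N) : P k = \sum_(i < D.+1) (a (i, k) - a' (i, k))%:P * 'X^i.
  rewrite /P valK poly_def; apply: eq_bigr => i _; by rewrite valK mul_polyC.
exists P; split.
  have : exists ik, a ik != a' ik.
    apply/existsP; rewrite -negb_forall; apply: contra aa' => /forallP h1.
    by apply/eqP/ffunP => ik; apply/eqP.
  move=> [[i k] ne]; exists k => //.
  apply: contraNneq ne => /(congr1 (fun p : {poly Fq} => p`_i)).
  by rewrite /P valK coef_poly ltn_ord valK coef0 => /eqP; rewrite subr_eq0.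
have H0 : ev t0 (h ^+ D * h') != 0.
  by rewrite rmorphM rmorphXn hornerM horner_exp mulf_neq0 // expf_neq0.
apply: (mulfI H0); rewrite mulr0.
have -> : \sum_(k < N) ev t (P k) * y k =
    \sum_(ik : 'I_D.+1 * 'I_N) iE (a ik - a' ik) * (t ^+ ik.1 * y ik.2).
  transitivity (\sum_(i < D.+1) \sum_(k < N) iE (a (i, k) - a' (i, k)) * (t ^+ i * y k));
    last by rewrite pair_bigA; apply: eq_bigr => -[i k] _.
  rewrite exchange_big; apply: eq_bigr => k _.
  rewrite PE rmorph_sum horner_sum mulr_suml; apply: eq_bigr => i _.
  by rewrite rmorphM /= map_polyC map_polyXn !hornerE.
rewrite mulr_sumr.
transitivity (\sum_ik \sum_j iE (a ik - a' ik) * (ev t0 (M ik j) * b j)).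
  by apply: eq_bigr => ik _; have [_ e1] := hM ik; rewrite mulrCA e1 mulr_sumr.
rewrite exchange_big big1 // => j _.
have := congr1 (fun p => ev t0 p * b j) (eM j); rewrite /comb !rmorph_sum !horner_sum.
rewrite !mulr_suml => /eqP; rewrite -subr_eq0 -sumrB => /eqP e1; rewrite -[RHS]e1.
apply: eq_bigr => ik _; rewrite !rmorphM /= !map_polyC !hornerE rmorphB /=.
by ring.
Qed.

End FinitenessOverPolynomials.

(** A nonzero element of least degree in the ideal of the P i divides them all; dividing by it
    leaves a Bezout relation. *)
Lemma primitive_family (F : fieldType) N (P : nat -> {poly F}) :
  (exists2 i, (i < N)%N & P i != 0) ->
  exists (g : {poly F}) (P' u : nat -> {poly F}), [/\ g != 0,
    forall i, (i < N)%N -> P i = g * P' i & \sum_(i < N) u i * P' i = 1].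
Proof.
move=> [i0 i0N Pi0].
pose J (g : {poly F}) := exists u : nat -> {poly F}, g = \sum_(i < N) u i * P i.
have JP i : (i < N)%N -> J (P i).
  move=> iN; exists (fun k => if k == i then 1 else 0).
  rewrite (bigD1 (Ordinal iN)) //= eqxx mul1r big1 ?addr0 // => k ki.
  by rewrite -val_eqE /= in ki; rewrite (negPf ki) mul0r.
have Jlin a g k : J g -> J k -> J (k - a * g).
  move=> [u ->] [w ->]; exists (fun i => w i - a * u i).
  rewrite mulr_sumr -sumrB; apply: eq_bigr => i _; ring.
pose Q s := `[< exists g, [/\ J g, g != 0 & size g = s] >].
have Qex : exists s, Q s.
  by exists (size (P i0)); apply/asboolP; exists (P i0); split=> //; exact: JP.
case: (ex_minnP Qex) => s /asboolP [g [Jg g0 sg]] smin.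
have dvd i : (i < N)%N -> P i = g * (P i %/ g).
  move=> iN; rewrite mulrC {1}(divp_eq (P i) g).
  suff -> : P i %% g = 0 by rewrite addr0.
  apply/eqP/negPn/negP => m0.
  have : Q (size (P i %% g)).
    apply/asboolP; exists (P i %% g); split=> //.
    have -> : P i %% g = P i - (P i %/ g) * g by rewrite {2}(divp_eq (P i) g) addrC addKr.
    by apply: Jlin => //; exact: JP.
  by move=> /smin; rewrite leqNgt -sg ltn_modp g0.
have [u gE] := Jg; exists g, (fun i => P i %/ g), u; split=> //.
apply: (mulfI g0); rewrite mulr1 [RHS]gE mulr_sumr; apply: eq_bigr => i _.
by rewrite mulrCA -dvd.
Qed.

Section ValuationRing.
Variables (E : fieldType) (v : E -> int) (hv : dvaluation v).

Lemma vring0 : vring v 0. Proof. by left. Qed.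

Lemma vringM x y : vring v x -> vring v y -> vring v (x * y).
Proof.
have [->|x0] := eqVneq x 0; first by left; rewrite mul0r.
have [->|y0] := eqVneq y 0; first by left; rewrite mulr0.
move=> [/eqP|hx]; first by rewrite (negPf x0).
move=> [/eqP|hy]; first by rewrite (negPf y0).
by right; rewrite (dvalM hv) // addr_ge0.
Qed.

Lemma vringD x y : vring v x -> vring v y -> vring v (x + y).
Proof.
have [->|x0] := eqVneq x 0; first by rewrite add0r.
have [->|y0] := eqVneq y 0; first by rewrite addr0.
have [->|xy0] := eqVneq (x + y) 0; first by left.
move=> [/eqP|hx]; first by rewrite (negPf x0).
move=> [/eqP|hy]; first by rewrite (negPf y0).
by right; apply: le_trans (dvalD hv x0 y0 xy0); rewrite le_min hx.
Qed.

Lemma vringN x : vring v x -> vring v (- x).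
Proof. by move=> [->|h]; [left; rewrite oppr0 | right; rewrite (dvalN _ hv)]. Qed.

Lemma vring1 : vring v 1. Proof. by right; rewrite (dval1 hv). Qed.

Lemma vringX x n : vring v x -> vring v (x ^+ n).
Proof.
move=> hx; elim: n => [|n IH]; first by rewrite expr0; exact: vring1.
by rewrite exprS; exact: vringM.
Qed.

Lemma vring_sum (I : finType) (P : pred I) (F : I -> E) :
  (forall i, P i -> vring v (F i)) -> vring v (\sum_(i | P i) F i).
Proof. by move=> h; elim/big_ind: _ => //; [exact: vring0 | exact: vringD]. Qed.

Lemma vringV x : vring v x \/ vring v x^-1.
Proof.
have [->|x0] := eqVneq x 0; first by left; left.
have [h|h] := lerP 0 (v x); first by left; right.
right; right; have := dval1 hv; rewrite -(mulVf x0) (dvalM hv) ?invr_neq0 //.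
by lia.
Qed.

Lemma val_torsion x n : (0 < n)%N -> x != 0 -> x ^+ n = 1 -> v x = 0.
Proof.
move=> n0 x0 xn; have : v (x ^+ n) = v x *+ n by exact: valX.
by rewrite xn (dval1 hv) => /esym/eqP; rewrite mulrn_eq0 eqn0Ngt n0 => /eqP.
Qed.

Lemma val_finite_field (F : finFieldType) (iF : {rmorphism F -> E}) a :
  a != 0 -> v (iF a) = 0.
Proof.
move=> a0; apply: (@val_torsion _ #|F|.-1).
- by have := finNzRing_gt1 F; case: #|F| => [|[]].
- by rewrite fmorph_eq0.
rewrite -rmorphXn; apply/eqP; rewrite fmorph_eq1; apply/eqP.
apply: (mulfI a0); rewrite -exprS mulr1 prednK ?expf_card //.
exact: ltnW (finNzRing_gt1 F).
Qed.

End ValuationRing.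

Section FunctionRing.
Variables (Fq : finFieldType) (E : fieldType) (iE : {rmorphism Fq -> E}).
Hypothesis curve_E : curve_function_field iE.
Variable infty : E -> int.
Local Notation A := (function_ring infty).

Let val_inj' : injective (@fun_val E infty) := val_inj.

Let fun_val_zmod : zmod_morphism (@fun_val E infty).
Proof. by move=> x y; exact: (rmorphB (\val : A -> E)). Qed.

Let fun_val_monoid : monoid_morphism (@fun_val E infty).
Proof.
by split=> [|x y]; [exact: (rmorph1 (\val : A -> E)) | exact: (rmorphM (\val : A -> E))].
Qed.

HB.instance Definition _ :=
  GRing.isZmodMorphism.Build A E (@fun_val E infty) fun_val_zmod.
HB.instance Definition _ :=
  GRing.isMonoidMorphism.Build A E (@fun_val E infty) fun_val_monoid.

Lemma function_ring_domain : nonzero_prod A.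
Proof.
move=> a b a0 b0; apply: contraNneq a0 => e; apply/eqP/val_inj'.
have /eqP := congr1 (@fun_val E infty) e.
rewrite [fun_val _]rmorphM mulf_eq0 => /orP [/eqP -> //|/eqP eb].
by case/eqP: b0; exact: val_inj'.
Qed.

Lemma regular_const (c : Fq) : regular_away infty (iE c).
Proof.
apply/asboolP => v hv _; have [->|c0] := eqVneq c 0; first by left; rewrite rmorph0.
by right; rewrite val_finite_field.
Qed.

Definition function_const (c : Fq) : A := FunctionRing (regular_const c).

Let function_const_zmod : zmod_morphism function_const.
Proof. by move=> a b; apply: val_inj'; rewrite [RHS]rmorphB; exact: rmorphB. Qed.

Let function_const_monoid : monoid_morphism function_const.
Proof.
split=> [|a b]; apply: val_inj'.
  by rewrite [RHS]rmorph1; exact: rmorph1.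
by rewrite [RHS]rmorphM; exact: rmorphM.
Qed.

HB.instance Definition _ :=
  GRing.isZmodMorphism.Build Fq A function_const function_const_zmod.
HB.instance Definition _ :=
  GRing.isMonoidMorphism.Build Fq A function_const function_const_monoid.

Variable t : A.

Definition poly_function (P : {poly Fq}) : A := (map_poly function_const P).[t].

Let poly_function_zmod : zmod_morphism poly_function.
Proof. by move=> P P'; rewrite /poly_function rmorphB hornerD hornerN. Qed.

Let poly_function_monoid : monoid_morphism poly_function.
Proof.
by split=> [|P P']; rewrite /poly_function ?rmorph1 ?hornerC // rmorphM hornerM.
Qed.

HB.instance Definition _ :=
  GRing.isZmodMorphism.Build {poly Fq} A poly_function poly_function_zmod.
HB.instance Definition _ :=
  GRing.isMonoidMorphism.Build {poly Fq} A poly_function poly_function_monoid.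

Local Notation iota := poly_function.

Lemma poly_functionC c : iota c%:P = function_const c.
Proof. by rewrite /poly_function map_polyC hornerC. Qed.

Lemma poly_functionX : iota 'X = t.
Proof. by rewrite /poly_function map_polyX hornerX. Qed.

Lemma poly_function_val P : fun_val (iota P) = (map_poly iE P).[fun_val t].
Proof.
rewrite /poly_function.
have -> : fun_val (map_poly function_const P).[t] =
  (map_poly (@fun_val E infty) (map_poly function_const P)).[fun_val t].
  by rewrite horner_map.
by rewrite -map_poly_comp; congr (_.[_]); apply: eq_map_poly.
Qed.

Lemma function_dependence : exists N, forall y : nat -> A,
  exists P : nat -> {poly Fq},
    (exists2 i, (i < N)%N & P i != 0) /\ \sum_(i < N) iota (P i) * y i = 0.
Proof.
have [N hN] := polynomial_dependence curve_E (fun_val t).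
exists N => y; have [P [P0 e]] := hN (fun i => fun_val (y i)).
exists P; split=> //; apply: val_inj'; rewrite rmorph_sum [RHS]rmorph0 -[RHS]e.
by apply: eq_bigr => i _; rewrite rmorphM /= -poly_function_val.
Qed.

Hypothesis t_transcendental : forall P : {poly Fq}, P != 0 -> iota P != 0.

(** Take a relation among powers of a. While its constant coefficient vanishes, a factor a cancels;
    a nonzero constant coefficient is a multiple of a. *)
Lemma function_divides_poly (a : A) : a != 0 ->
  exists2 P : {poly Fq}, P != 0 & exists a', iota P = a * a'.
Proof.
move=> a0; have [N hN] := function_dependence.
have [P [P0 e]] := hN (fun i => a ^+ i); elim: N {hN} P P0 e => [|N IH] P [i iN Pi].
  by [].
rewrite big_ord_recl expr0 mulr1 /= => e.
have {}e : iota (P 0%N) + a * (\sum_(i < N) iota (P i.+1) * a ^+ i) = 0.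
  rewrite -[RHS]e mulr_sumr; congr (_ + _); apply: eq_bigr => k _.
  by rewrite /bump /= exprS mulrCA.
have [P0|P0] := eqVneq (P 0%N) 0; last first.
  exists (P 0%N) => //; exists (- \sum_(i < N) iota (P i.+1) * a ^+ i).
  by rewrite mulrN; apply/eqP; rewrite -addr_eq0; apply/eqP.
apply: (IH (fun i => P i.+1)).
  by case: i iN Pi => [|i] iN Pi; [rewrite P0 eqxx in Pi | exists i].
by move: e; rewrite P0 rmorph0 add0r; exact: (dom_eq0 function_ring_domain a0).
Qed.

(** Lists longer than N are dependent, so some independent list has greatest length; prepending a to
    it creates a relation in which a occurs. *)
Lemma function_finite_rank : exists l : seq A^o,
  forall a : A^o, pure_closure (range iota) l a.
Proof.
have hB := range_subring iota; have [N hN] := function_dependence.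
pose dep (l : seq A) := exists c : nat -> {poly Fq},
  (exists2 i, (i < size l)%N & c i != 0) /\ \sum_(i < size l) iota (c i) * l`_i = 0.
pose P k := `[< exists l : seq A, size l = k /\ ~ dep l >].
have P0 : exists k, P k.
  by exists 0%N; apply/asboolP; exists [::]; split=> // -[c [[i]]].
have Pb k : P k -> (k <= N)%N.
  move=> /asboolP [l [<- nd]]; rewrite leqNgt; apply/negP => lt; apply: nd.
  have [c [[i iN ci] e]] := hN (fun i => l`_i).
  exists (fun i => if (i < N)%N then c i else 0); split.
    by exists i; [exact: ltn_trans lt | rewrite iN].
  rewrite -[RHS]e (big_ord_widen (size l) (fun i => iota (c i) * l`_i) (ltnW lt)).
  rewrite [RHS]big_mkcond /=; apply: eq_bigr => i1 _.
  by case: ifP => // _; rewrite rmorph0 mul0r.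
case: (ex_maxnP P0 Pb) => k /asboolP [l [sl nd]] kmax.
exists l => a; have : dep (a :: l).
  apply: contrapT => nda; have : P k.+1 by apply/asboolP; exists (a :: l); rewrite /= sl.
  by move=> /kmax; rewrite ltnn.
move=> [c [[i ci c0]]]; rewrite /= big_ord_recl /= => e.
have c00 : c 0%N != 0.
  apply/eqP => c00; apply: nd; exists (fun i => c i.+1); split.
    by case: i ci c0 => [|i] ci c0; [rewrite c00 eqxx in c0 | exists i].
  by move: e; rewrite c00 rmorph0 mul0r add0r.
exists (iota (c 0%N)); first by exists (c 0%N).
split; first exact: t_transcendental.
apply/(span_over_sum hB); exists (fun i => - iota (c i.+1)).
  by move=> j; exists (- c j.+1); rewrite ?rmorphN.
move/eqP: e; rewrite addr_eq0 => /eqP e; rewrite [LHS]e -sumrN.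
by apply: eq_bigr => j _; rewrite -mulNr.
Qed.

(* With a primitive relation sum_i c_i al^i = 0 for al = b / a, both
   be_k = sum_(i >= k) c_i al^(i - k) and al * be_k are regular, and
   c_k = be_k - al * be_(k + 1). *)
Lemma function_ring_prufer (a b : A) :
  exists s u v : A, s * b = u * a /\ (1 - s) * a = v * b.
Proof.
have [->|a0] := eqVneq a 0.
  by exists 0, 0, 0; rewrite !mul0r mulr0.
have [->|b0] := eqVneq b 0.
  by exists 1, 0, 0; rewrite !mulr0 subrr !mul0r.
have va0 : fun_val a != 0 by apply: contraNneq a0 => e; apply/eqP/val_inj'.
have vb0 : fun_val b != 0 by apply: contraNneq b0 => e; apply/eqP/val_inj'.
pose al := fun_val b / fun_val a.
have al0 : al != 0 by rewrite mulf_neq0 ?invr_neq0.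
have [N hN] := polynomial_dependence curve_E (fun_val t).
have [P [/primitive_family [g [c [u [g0 PE cu]]]] e]] := hN (fun i => al ^+ i).
pose x i := fun_val (iota (c i)).
have {}e : \sum_(i < N) x i * al ^+ i = 0.
  have g1 : fun_val (iota g) != 0.
    by apply: contraNneq (t_transcendental g0) => e1; apply/eqP/val_inj'.
  apply: (mulfI g1); rewrite mulr0 -[RHS]e mulr_sumr; apply: eq_bigr => i _.
  by rewrite -poly_function_val (PE i) // rmorphM [in RHS]rmorphM mulrA.
pose be k := \sum_(i < N | (k <= i)%N) x i * al ^+ (i - k).
have beE k : be k = - \sum_(i < N | (i < k)%N) x i * al^-1 ^+ (k - i).
  apply: (mulIf (expf_neq0 k al0)); rewrite mulNr; apply/eqP; rewrite -addr_eq0.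
  rewrite !mulr_suml; apply/eqP; rewrite -[RHS]e [RHS](bigID (fun i : 'I_N => (k <= i)%N)) /=.
  congr (_ + _).
    by apply: eq_bigr => i ki; rewrite -mulrA -exprD subnK.
  apply: eq_big => [i|i ik]; first by rewrite ltnNge.
  rewrite -mulrA; congr (_ * _); rewrite -{2}(subnK (ltnW ik)) exprD mulrA.
  by rewrite exprVn mulVf ?mul1r // expf_neq0.
have xreg v : dvaluation v -> v <> infty -> forall i, vring v (x i).
  by move=> hv vi i; have /asboolP := fun_valP (iota (c i)); apply.
have be_reg k : regular_away infty (be k) /\ regular_away infty (al * be k).
  suff H v : dvaluation v -> v <> infty -> vring v (be k) /\ vring v (al * be k).
    by split; apply/asboolP => v hv vi; have [] := H v hv vi.
  (* Where al is integral the defining sum shows regularity. Elsewhere al^-1 is, and [beE] has only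
     positive powers of al^-1, so one factor al can be absorbed. *)
  move=> hv vi; have hx := xreg v hv vi; case: (vringV hv al) => hal.
    have hb : vring v (be k).
      by apply: (vring_sum hv) => i _; apply: (vringM hv) => //; exact: (vringX hv).
    by split=> //; exact: (vringM hv).
  rewrite beE mulrN mulr_sumr; split; apply: (vringN hv); apply: (vring_sum hv) => i ik.
    by apply: (vringM hv) => //; exact: (vringX hv).
  have -> : al * (x i * al^-1 ^+ (k - i)) = x i * al^-1 ^+ (k - i).-1.
    have -> : (k - i = (k - i).-1.+1)%N by rewrite prednK // subn_gt0.
    by rewrite exprS /=; field.
  by apply: (vringM hv) => //; exact: (vringX hv).
have beS k : (k < N)%N -> x k = be k - al * be k.+1.
  move=> kN; rewrite /be (bigD1 (Ordinal kN)) //= subnn expr0 mulr1.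
  set S := \sum_(_ < _ | _) _; set T := \sum_(_ < _ | _) _.
  suff -> : al * T = S by rewrite addrK.
  rewrite mulr_sumr; apply: eq_big => [i|i ki].
    by rewrite -val_eqE /= ltn_neqAle eq_sym andbC.
  by rewrite mulrCA -exprS -subSn // subSS.
pose bA k : A := FunctionRing (be_reg k).1.
pose baA k : A := FunctionRing (be_reg k).2.
(* Inserting c_k = be_k - al be_(k + 1) in the Bezout relation gives 1 - s = - al sum_k u_k be_(k +
   1). Hence s al and (1 - s) / al are both regular. *)
pose s := \sum_(k < N) iota (u k) * bA k.
have sum_val (w : nat -> A) : fun_val (\sum_(k < N) iota (u k) * w k) =
    \sum_(k < N) fun_val (iota (u k)) * fun_val (w k).
  by rewrite rmorph_sum; apply: eq_bigr => k _; rewrite rmorphM.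
have bE : fun_val b = al * fun_val a by rewrite /al divfK.
have s1 : fun_val (1 - s) = - (al * \sum_(k < N) fun_val (iota (u k)) * be k.+1).
  rewrite rmorphB rmorph1 /= /s (sum_val bA).
  have : \sum_(k < N) fun_val (iota (u k)) * x k = 1.
    have := congr1 (fun p => fun_val (iota p)) cu.
    rewrite rmorph1 rmorph1 !rmorph_sum => <-.
    by apply: eq_bigr => k _; rewrite !rmorphM.
  move=> <-; rewrite -sumrB mulr_sumr -sumrN; apply: eq_bigr => k _.
  by rewrite beS //=; ring.
exists s, (\sum_(k < N) iota (u k) * baA k), (- \sum_(k < N) iota (u k) * bA k.+1).
split; apply: val_inj'.
  rewrite [LHS]rmorphM [RHS]rmorphM /= (sum_val bA) (sum_val baA) bE /= mulrA; congr (_ * _).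
  by rewrite mulr_suml; apply: eq_bigr => k _; rewrite -mulrA [be k * al]mulrC.
rewrite [LHS]rmorphM [RHS]rmorphM; set S := (X in _ = X * _).
have -> : S = - fun_val (\sum_(k < N) iota (u k) * bA k.+1) by rewrite /S rmorphN.
rewrite [X in X * _]s1 (sum_val (fun k => bA k.+1)) /= bE.
ring.
Qed.

End FunctionRing.

(** * Modular transcendence degree *)

Local Notation tsize := Defs.tsize.

Section TwistedCoefficients.
Variables (k : fieldType) (sigma : {rmorphism k -> k}).
Implicit Types P Q : tpoly sigma.

Lemma coef_iter_tau i (Q : {poly k}) n :
  (iter i (tau_mul sigma) Q)`_n = if (i <= n)%N then iter i sigma Q`_(n - i) else 0.
Proof.
elim: i n => [|i IH] n /=; first by rewrite subn0.
rewrite /tau_mul coefMX; case: n => [|n] //=.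
by rewrite coef_map /= IH subSS ltnS; case: ifP => //; rewrite rmorph0.
Qed.

Lemma tcoefM P Q n :
  tcoef (P * Q) n = \sum_(i < n.+1) tcoef P i * iter i sigma (tcoef Q (n - i)).
Proof.
rewrite /tcoef -[P * Q]/(tmul sigma P Q) /tmul coef_sum.
transitivity (\sum_(i < maxn (size (P : {poly k})) n.+1)
    if (i < n.+1)%N then (P : {poly k})`_i * iter i sigma (Q : {poly k})`_(n - i) else 0).
  rewrite (big_ord_widen _
    (fun i => (((P : {poly k})`_i *: iter i (tau_mul sigma) Q)%R : {poly k})`_n)
    (leq_maxl _ n.+1)).
  rewrite big_mkcond; apply: eq_bigr => i _.
  rewrite coefZ coef_iter_tau ltnS; case: ltnP => sP; last first.
    by rewrite nth_default // mul0r if_same.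
  by case: ifP => //; rewrite mulr0.
rewrite -big_mkcond (big_ord_widen _ (fun i => (P : {poly k})`_i *
  iter i sigma (Q : {poly k})`_(n - i)) (leq_maxr (size (P : {poly k})) n.+1)).
by [].
Qed.

Lemma iter_rmorph0 i : iter i sigma 0 = 0.
Proof. by elim: i => //= i ->; rewrite rmorph0. Qed.

Lemma iter_rmorph_eq0 i x : (iter i sigma x == 0) = (x == 0).
Proof. by elim: i => //= i <-; rewrite fmorph_eq0. Qed.

Lemma tcoef_lead P n : tsize P = n.+1 -> tcoef P n != 0.
Proof.
rewrite /tsize /tcoef => sP; have := lead_coef_eq0 (P : {poly k}).
by rewrite lead_coefE sP /= => ->; rewrite -size_poly_eq0 sP.
Qed.

Lemma tsizeM P Q a b : tsize P = a.+1 -> tsize Q = b.+1 ->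
  tsize (P * Q) = (a + b).+1.
Proof.
move=> sP sQ; have P0 n : (a < n)%N -> tcoef P n = 0.
  by move=> h; rewrite /tcoef nth_default // -/(tsize P) sP.
have Q0 n : (b < n)%N -> tcoef Q n = 0.
  by move=> h; rewrite /tcoef nth_default // -/(tsize Q) sQ.
apply/eqP; rewrite eqn_leq; apply/andP; split.
  apply/leq_sizeP => n h; rewrite -/(tcoef (P * Q) n) tcoefM big1 // => i _.
  have [ai|ia] := ltnP a i; first by rewrite P0 // mul0r.
  by rewrite Q0 ?iter_rmorph0 ?mulr0 //; lia.
rewrite ltnNge; apply/negP => /leq_sizeP /(_ _ (leqnn _)).
rewrite -/(tcoef (P * Q) (a + b)) tcoefM.
have lt : (a < (a + b).+1)%N by rewrite ltnS leq_addr.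
rewrite (bigD1 (Ordinal lt)) //= big1 ?addr0 => [|i ne].
  move/eqP; rewrite mulf_eq0 iter_rmorph_eq0 addKn (negPf (tcoef_lead sP)).
  by rewrite (negPf (tcoef_lead sQ)).
rewrite -val_eqE /= in ne; have [ai|ia] := ltnP a i; first by rewrite P0 // mul0r.
by rewrite Q0 ?iter_rmorph0 ?mulr0 //; lia.
Qed.

(** Degrees in tau add up. Nonzero elements of F_q are units of A, so this makes them act on K by
    scalars. *)
Lemma tsize_unit P Q : P * Q = 1 -> tsize P = 1.
Proof.
have s1 : tsize (1 : tpoly sigma) = 1%N by exact: size_poly1.
have s0 : tsize (0 : tpoly sigma) = 0%N by exact: size_poly0.
move=> e; case sP : (tsize P) => [|a].
  have P0 : P = 0 by apply/eqP; rewrite -size_poly_eq0 -/(tsize P) sP.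
  by move: e s1; rewrite P0 mul0r => <-; rewrite s0.
case sQ : (tsize Q) => [|b].
  have Q0 : Q = 0 by apply/eqP; rewrite -size_poly_eq0 -/(tsize Q) sQ.
  by move: e s1; rewrite Q0 mulr0 => <-; rewrite s0.
by move: (tsizeM sP sQ); rewrite e s1 => -[/esym/eqP]; rewrite addn_eq0 => /andP [/eqP ->].
Qed.

Lemma tcoef_constM c P n : tcoef (tconst sigma c * P) n = c * tcoef P n.
Proof.
rewrite tcoefM big_ord_recl subn0 /= big1 => [|i _].
  by rewrite addr0 /tconst {1}/tcoef coefC.
by rewrite /tcoef /tconst coefC mul0r.
Qed.

Lemma tcoefM_const c P n : tcoef (P * tconst sigma c) n = tcoef P n * iter n sigma c.
Proof.
rewrite tcoefM big_ord_recr /= subnn big1 => [|i _].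
  by rewrite add0r /tconst /tcoef coefC.
rewrite /tcoef /tconst coefC subn_eq0 leqNgt ltn_ord /=.
by rewrite iter_rmorph0 mulr0.
Qed.

End TwistedCoefficients.

Lemma iter_qfrob (k : fieldType) p m (chk : p \in [pchar k]) i (x : k) :
  iter i (qfrob m chk) x = x ^+ ((p ^ m) ^ i).
Proof.
elim: i => [|i IH]; first by rewrite expn0 expr1.
by rewrite iterS IH /qfrob -exprM expnSr.
Qed.

Section FieldOfConstants.
Variables (R : realType) (K : fieldType) (U : set (K -> int)) (d : (K -> int) -> R).

Lemma fsum_eq0 (I : choiceType) (P : set I) (g : I -> R) :
  finite_support_on P g -> (forall i, P i -> 0 <= g i) ->
  \sum_(i \in P) g i = 0 -> forall i, P i -> g i = 0.
Proof.
move=> fg g0 e i Pi; apply/le_anti; rewrite g0 // andbT -e.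
exact: ler_term_fsum.
Qed.

(* By the product formula, an element without poles has no zeros. *)
Lemma constant_of_ge0 (hU : good_set U d) x : x != 0 ->
  (forall v, U v -> 0 <= v x) -> field_of_constants U x.
Proof.
move=> x0 hx; right => v Uv.
have := @fsum_eq0 _ U (fun v => d v * (v x)%:~R) _ _ (good_sum hU x0) v Uv.
have dpos w : U w -> 0 < d w by exact: (good_deg_gt0 hU).
move=> H; have /eqP : d v * (v x)%:~R = 0 :> R.
  apply: H => [|w Uw]; last by rewrite mulr_ge0 ?ler0z ?hx // ltW // dpos.
  apply: sub_finite_set (good_finite hU x0) => w [Uw h]; split=> //.
  by apply: contraNneq h => ->; rewrite mulr0.
by rewrite mulf_eq0 gt_eqF ?dpos //= intr_eq0 => /eqP.
Qed.

(** The proof of [good_set U d] is an argument so that closure under subtraction and division, which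
    depends on it, can be declared as an instance. *)
Definition is_constant of good_set U d := fun x : K => `[< field_of_constants U x >].

Variable hU : good_set U d.

Lemma is_constant_divring : divring_closed (is_constant hU).
Proof.
split=> [|x y|x y].
- by apply/asboolP; right => v /(good_val hU) /(@dval1 _ _).
- move=> /asboolP hx /asboolP hy; apply/asboolP.
  have [->|xy0] := eqVneq (x - y) 0; first by left.
  have ge0 z v : U v -> field_of_constants U z -> vring v z.
    by move=> Uv [->|h]; [left | right; rewrite h].
  apply: (constant_of_ge0 hU) => // v Uv; have hv := good_val hU Uv.
  have [/eqP|//] : vring v (x - y).
    by apply: (vringD hv); [exact: ge0 | apply: (vringN hv); exact: ge0].
  by rewrite (negPf xy0).
- move=> /asboolP hx /asboolP hy; apply/asboolP.
  have [->|x0] := eqVneq x 0; first by left; rewrite mul0r.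
  have [->|y0] := eqVneq y 0; first by left; rewrite invr0 mulr0.
  case: hx => [/eqP|hx]; first by rewrite (negPf x0).
  case: hy => [/eqP|hy]; first by rewrite (negPf y0).
  right => v Uv; have hv := good_val hU Uv.
  by rewrite (dvalM hv) ?invr_neq0 // (valV hv) // hx // hy.
Qed.

HB.instance Definition _ :=
  GRing.isDivringClosed.Build K (is_constant hU) is_constant_divring.

Record constant_field := ConstantField {
  constant_val : K;
  constant_valP : is_constant hU constant_val }.

HB.instance Definition _ := [isSub for constant_val].
HB.instance Definition _ := [Choice of constant_field by <:].
HB.instance Definition _ := [SubChoice_isSubIntegralDomain of constant_field by <:].
HB.instance Definition _ := [SubIntegralDomain_isSubField of constant_field by <:].

Let constant_val_zmod : zmod_morphism constant_val.
Proof. by move=> x y; exact: (rmorphB (\val : constant_field -> K)). Qed.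

Let constant_val_monoid : monoid_morphism constant_val.
Proof.
by split=> [|x y]; [exact: (rmorph1 (\val : constant_field -> K))
  | exact: (rmorphM (\val : constant_field -> K))].
Qed.

HB.instance Definition _ :=
  GRing.isZmodMorphism.Build constant_field K constant_val constant_val_zmod.
HB.instance Definition _ :=
  GRing.isMonoidMorphism.Build constant_field K constant_val constant_val_monoid.

End FieldOfConstants.

Lemma alg_indep_set0 (L : fieldType) (S : set L) : alg_indep S set0.
Proof.
move=> [|n] b _ hb P _; last by case: (hb ord0).
move=> e; apply/mpolyP => mo; rewrite mcoeff0.
have [sm|nm] := boolP (mo \in msupp P); last exact: memN_msupp_eq0.
rewrite -[RHS]e mevalE (bigD1_seq mo sm (msupp_uniq P)) /=.
rewrite big_ord0 mulr1 big1 ?addr0 // => mo' /negP; case.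
by apply/eqP/mnmP; case.
Qed.

Section ModularDegree.
Variables (R : realType) (A : comNzRingType) (K : fieldType) (p m : nat).
Hypotheses (p_prime : prime p) (m_gt0 : (0 < m)%N).
Variables (chK : p \in [pchar K]) (U : set (K -> int)) (d : (K -> int) -> R).
Hypothesis hU : good_set U d.
Variable phi : {rmorphism A -> tpoly (qfrob m chK)}.
Variables (L : closedFieldType) (j : {rmorphism K -> L}).

Local Notation q := (p ^ m)%N.
Local Notation F := (field_of_constants U).
Local Notation sigmaL := (qfrob m (rmorph_pchar j chK)).

Let jF : {rmorphism constant_field hU -> L} := (j \o @constant_val R K U d hU).
Let alg := algebraicOver jF.

Let q_gt1 : (1 < q)%N.
Proof. by rewrite -{1}(exp1n m) ltn_exp2r ?prime_gt1. Qed.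

Let alg_jF x : F x -> alg (j x).
Proof.
move=> Fx; have cx : is_constant hU x by apply/asboolP.
exact: (algebraic_id jF (ConstantField cx)).
Qed.

Let alg_monic_root (P : {poly L}) x : P \is monic -> (forall i, alg P`_i) ->
  root P x -> alg x.
Proof.
move=> mP hP rP; apply/integral_algebraic.
apply: (integral_root_monic mP rP) => c /(nthP 0) [i _ <-].
by move/integral_algebraic: (hP i).
Qed.

Let alg_sum (I : finType) (Q : pred I) (G : I -> L) :
  (forall i, Q i -> alg (G i)) -> alg (\sum_(i | Q i) G i).
Proof.
by move=> h; elim/big_ind: _ => //; [exact: algebraic0 | exact: algebraic_add].
Qed.

Let alg_exp x n : alg x -> alg (x ^+ n).
Proof.
move=> h; elim: n => [|n IH]; first by rewrite expr0; exact: algebraic1.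
by rewrite exprS; exact: algebraic_mul.
Qed.

Let alg_root x n : (0 < n)%N -> alg (x ^+ n) -> alg x.
Proof.
move=> n0 h; apply: (@alg_monic_root ('X^n - (x ^+ n)%:P)).
- exact: monicXnsubC.
- move=> i; rewrite coefB coefXn coefC; apply: algebraic_sub.
    by case: eqP => _; [exact: algebraic1 | exact: algebraic0].
  by case: ifP => // _; exact: algebraic0.
by rewrite /root !hornerE subrr.
Qed.

Section Twist.
Variable gamma : L.
Hypothesis gamma0 : gamma != 0.

Let e a n := tcoef (isom_twist (qfrob m (rmorph_pchar j chK)) j phi gamma a) n.

Let eE a n : e a n = gamma^-1 * j (tcoef (phi a) n) * gamma ^+ (q ^ n).
Proof.
rewrite /e /isom_twist tcoefM_const tcoef_constM iter_qfrob.
by rewrite {1}/tcoef coef_map.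
Qed.

Let eM a b n : \sum_(i < n.+1) e a i * e b (n - i) ^+ (q ^ i) = e (a * b) n.
Proof.
rewrite eE rmorphM tcoefM rmorph_sum mulr_sumr mulr_suml; apply: eq_bigr => i _.
rewrite !eE rmorphM /= iter_qfrob rmorphXn !exprMn exprVn -exprM -expnD.
rewrite subnK -1?ltnS //; set g := gamma ^+ _; set h := gamma ^+ _.
have g0 : g != 0 by rewrite expf_neq0.
by field; rewrite g0 gamma0.
Qed.

Variables (t : A) (r : nat).
Hypothesis size_t : tsize (phi t) = r.+1.
Hypothesis r_gt0 : (0 < r)%N.
Hypothesis monic_t : e t r = 1.
Hypothesis alg_t : forall n, alg (e t n).

(* Comparing coefficients in phi_a phi_t = phi_t phi_a expresses
   x - x^(q^r), for x the n-th coefficient, in terms of later coefficients. *)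
Let alg_all a n : alg (e a n).
Proof.
have et0 i : (r < i)%N -> e t i = 0.
  move=> ri; rewrite eE; have -> : tcoef (phi t) i = 0.
    by rewrite /tcoef nth_default // -/(tsize (phi t)) size_t.
  by rewrite rmorph0 mulr0 mul0r.
suff H k : forall n, (tsize (phi a) <= n + k)%N -> alg (e a n).
  by apply: (H (tsize (phi a))); exact: leq_addl.
elim: k => {n} [|k IH] n.
  rewrite addn0 => h; rewrite eE; have -> : tcoef (phi a) n = 0.
    by rewrite /tcoef nth_default.
  by rewrite rmorph0 mulr0 mul0r; exact: algebraic0.
move=> h; have {}IH i : (n < i)%N -> alg (e a i) by move=> ni; apply: IH; lia.
have := eM a t (n + r); rewrite mulrC -eM.
have n_lt : (n < (n + r).+1)%N by rewrite ltnS leq_addr.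
have r_lt : (r < (n + r).+1)%N by rewrite ltnS leq_addl.
rewrite (bigD1 (Ordinal n_lt)) //= [RHS](bigD1 (Ordinal r_lt)) //=.
rewrite addKn monic_t expr1n mulr1 addnK mul1r.
set x := e a n; set S1 := \sum_(_ < _ | _) _; set S2 := \sum_(_ < _ | _) _ => E.
have a1 : alg S1.
  apply: alg_sum => i; rewrite -val_eqE /= => ne.
  have [lt|le] := ltnP n i.
    by apply: algebraic_mul; [exact: IH | apply: alg_exp; exact: alg_t].
  rewrite et0; last by lia.
  rewrite expr0n; have -> : (q ^ i == 0)%N = false by rewrite expn_eq0; lia.
  by rewrite mulr0; exact: algebraic0.
have a2 : alg S2.
  apply: alg_sum => i; rewrite -val_eqE /= => ne.
  have [lt|le] := ltnP r i; first by rewrite et0 // mul0r; exact: algebraic0.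
  by apply: algebraic_mul; [exact: alg_t | apply: alg_exp; apply: IH; lia].
have Qr : (1 < q ^ r)%N by rewrite -(exp1n r) ltn_exp2r.
apply: (@alg_monic_root ('X^(q ^ r) + (- 'X + (S2 - S1)%:P))).
- rewrite monicE lead_coefDl ?lead_coefXn //.
  rewrite size_polyXn; apply: leq_ltn_trans (size_polyD _ _) _.
  rewrite size_polyN size_polyX size_polyC gtn_max; apply/andP; split; first by [].
  by case: (_ != 0) => //=; lia.
- move=> i; rewrite !coefD coefN coefXn coefX coefC.
  have b n1 (b : bool) : b = n1 -> alg b%:R.
    by move=> _; case: b; [exact: algebraic1 | exact: algebraic0].
  apply: algebraic_add; first exact: b.
  apply: algebraic_add; first by apply: algebraic_opp; exact: b.
  by case: ifP => _; [exact: algebraic_sub | exact: algebraic0].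
rewrite /root !hornerE; apply/eqP.
have -> : x ^+ (q ^ r) = x + S1 - S2 by rewrite E addrK.
by rewrite /=; ring.
Qed.

(** One monic twisted phi_t with coefficients algebraic over the constants forces the whole twist to
    be algebraic, which makes the empty set a transcendence basis. *)
Lemma twist_field_algebraic x :
  twist_field (qfrob m (rmorph_pchar j chK)) j phi F gamma x ->
  algebraic_over (gen_subfield (j @` F `|` set0)) x.
Proof.
have algS : subfield [set x | alg x].
  split; [exact: algebraic1 | exact: algebraic_sub | exact: algebraic_div].
move=> h; have {h} [P P0 rP] : alg x.
  apply: (h _ (conj algS _)) => y [[z Fz <-]|]; first exact: alg_jF.
  move=> h'; apply: (h' _ (conj algS _)) => _ [a [n ->]].
  exact: alg_all.
exists (map_poly jF P); split=> //; first by rewrite map_poly_eq0.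
move=> i M [_ sM]; apply: sM; left; rewrite coef_map /=.
exists (constant_val P`_i) => //; exact/asboolP/constant_valP.
Qed.

End Twist.

Hypothesis phi_pos : pos_rel_mod_trdeg (qfrob m (rmorph_pchar j chK)) j phi F.

(** Choose gamma with gamma^(q^r - 1) = 1 / c_r. The (q^r - 1)-th powers of the twisted coefficients
    are c_n^(q^r - 1) / c_r^(q^n - 1), in K. Without poles they would be constants, and the relative
    modular transcendence degree would be 0. *)
Lemma pos_trdeg_pole (t : A) (r : nat) : tsize (phi t) = r.+1 -> (0 < r)%N ->
  exists n v, [/\ (n < r)%N, tcoef (phi t) n != 0, U v
    & normalized_coef_val q r (tcoef (phi t)) v n < 0].
Proof.
move=> st r0; apply: contrapT => nex.
pose c := tcoef (phi t); pose N := (q ^ r).-1.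
have cr0 : c r != 0 by exact: tcoef_lead.
have Qr : (1 < q ^ r)%N by rewrite -(exp1n r) ltn_exp2r.
have [gamma] : exists g : L, root ('X^N - ((j (c r))^-1)%:P) g.
  by apply/closed_rootP; rewrite size_XnsubC /N; lia.
rewrite /root !hornerE subr_eq0 => /eqP gN.
have jcr : j (c r) != 0 by rewrite fmorph_eq0.
have gamma0 : gamma != 0.
  apply: contraTneq jcr => g0; move: gN; rewrite g0 expr0n.
  have -> : (N == 0)%N = false by rewrite /N; lia.
  by move/esym/eqP; rewrite invr_eq0 => ->.
have gq n : gamma ^+ (q ^ n) = gamma * gamma ^+ (q ^ n).-1.
  by rewrite -exprS prednK // expn_gt0; lia.
have coefE n : tcoef (isom_twist (qfrob m (rmorph_pchar j chK)) j phi gamma t) n =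
    j (c n) * gamma ^+ (q ^ n).-1.
  rewrite /isom_twist tcoefM_const tcoef_constM iter_qfrob {1}/tcoef coef_map gq.
  by rewrite /= -/(c n); field.
have tb : transcendence_basis (j @` F)
    (twist_field (qfrob m (rmorph_pchar j chK)) j phi F gamma) set0.
  split; [by [] | exact: alg_indep_set0 |].
  move=> x; apply: (@twist_field_algebraic gamma gamma0 t r st r0).
    by rewrite coefE gN mulfV.
  move=> n; rewrite coefE; apply: (@alg_root _ N); first by rewrite /N; lia.
  have [cn0|cn0] := eqVneq (c n) 0.
    rewrite cn0 rmorph0 mul0r expr0n.
    have -> : (N == 0)%N = false by rewrite /N; lia.
    exact: algebraic0.
  rewrite exprMn exprAC gN exprVn -!rmorphXn -fmorphV -rmorphM; apply: alg_jF.
  apply: (constant_of_ge0 hU); first by rewrite mulf_neq0 ?invr_neq0 ?expf_neq0.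
  move=> v Uv; have hv := good_val hU Uv.
  have nr : (n <= r)%N.
    rewrite -ltnS -st ltnNge; apply: contra cn0 => h.
    by rewrite /c /tcoef nth_default.
  rewrite (dvalM hv) ?invr_neq0 ?expf_neq0 // (valV hv) ?expf_neq0 // !(valX hv) //.
  rewrite leNgt; apply/negP => lt; apply: nex; exists n, v; split=> //.
  rewrite ltn_neqAle nr andbT; apply: contraTneq lt => ->.
  by rewrite subrr ltxx.
have [B [_ minB] [x Bx]] := phi_pos.
have := minB _ _ gamma0 tb; rewrite card_le0 => /eqP B0.
by move: Bx; rewrite B0.
Qed.

End ModularDegree.

(** * From F_q[t] to A, and the conclusion *)

Lemma span_overS (A : comNzRingType) (M : lmodType A) (C C' : set A) (l : seq M) :
  C `<=` C' -> span_over C l `<=` span_over C' l.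
Proof.
move=> sC; elim: l => // z l IH x /= [c Cc h]; exists c; first exact: sC.
exact: IH.
Qed.

(** The closure of [l] over A is the closure over B of the products of [l] with [lA], because
    denominators in A divide denominators in B. The span stays over B because the infinite rank is
    proved by reduction modulo t. *)
Lemma closure_fg_extension (B A : comNzRingType) (iota : {rmorphism B -> A})
    (M : lmodType A) : nonzero_prod A ->
  (forall a, a != 0 -> exists2 b, iota b != 0 & exists a', iota b = a * a') ->
  (exists lA : seq A^o, forall a : A^o, pure_closure (range iota) lA a) ->
  (forall l : seq M, exists2 l' : seq M,
     {in l', forall x, pure_closure (range iota) l x} &
     pure_closure (range iota) l `<=` span_over (range iota) l') ->
  forall l : seq M, exists2 l' : seq M,
    {in l', forall x, pure_closure [set: A] l x} &
    pure_closure [set: A] l `<=` span_over (range iota) l'.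
Proof.
move=> domA mult [lA hlA] fg l; have hB := range_subring iota.
have hT := subring_setT A.
have spanT (l1 : seq M) : span_over (range iota) l1 `<=` span_over [set: A] l1.
  exact: span_overS.
pose l1 := [seq (a : A) *: x | a <- lA, x <- l].
have in_l1 a x : a \in lA -> x \in l -> (a : A) *: x \in l1.
  by move=> al xl; apply/allpairsP; exists (a, x).
have scale_cl (a : A) x : x \in l -> pure_closure (range iota) l1 (a *: x).
  move=> xl; have [_ [b _ <-] [b0 h]] := hlA a.
  exists (iota b) => //; split=> //; rewrite scalerA.
  have key (s : seq A^o) (y : A^o) : {subset s <= lA} ->
      span_over (range iota) s y -> span_over (range iota) l1 ((y : A) *: x).
    elim: s y => [|z s IH] y sl /=.
      by move=> ->; rewrite scale0r; exact: span_over0.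
    move=> [c Cc hy]; have -> : (y : A) *: x =
        ((y - c *: z : A^o) : A) *: x + c *: ((z : A) *: x).
      by rewrite scalerA -scalerDl; congr (_ *: _); rewrite subrK.
    apply: (span_overD hB).
      by apply: IH => // w ws; apply: sl; rewrite inE ws orbT.
    apply: (span_overZ hB) => //; apply: (mem_span_over hB); apply: in_l1 => //.
    by apply: sl; exact: mem_head.
  exact: key h.
have sub_cl : pure_closure [set: A] l `<=` pure_closure (range iota) l1.
  move=> y [a _ [a0 h]]; have [b b0 [a' e]] := mult a a0.
  have cb : range iota (iota b) by exists b.
  apply: (pure_closureP hB domA cb b0).
  have {}h : span_over [set: A] l (iota b *: y).
    by rewrite e mulrC -scalerA; apply: (span_overZ hT).
  move: h; move: (iota b *: y) => {y a a0 b b0 cb a' e} y.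
  have : {subset l <= l} by [].
  elim: {1 3}l y => [|z s IH] y sl /=.
    by move=> ->; exact: pure_closure0.
  move=> [c _ h]; rewrite -(subrK (c *: z) y); apply: (pure_closureD hB domA).
    by apply: IH => // w ws; apply: sl; rewrite inE ws orbT.
  by apply: scale_cl; apply: sl; exact: mem_head.
have cl_sub : pure_closure (range iota) l1 `<=` pure_closure [set: A] l.
  move=> y [c Cc [c0 h]]; exists c => //; split=> //.
  apply: (span_over_sub hT) (spanT _ _ h) => _ /allpairsP [[a x] /= [_ xl ->]].
  by apply: (span_overZ hT) => //; exact: (mem_span_over hT).
have [l' hl' sl'] := fg l1; exists l'; first by move=> x /hl' /cl_sub.
by move=> y /sub_cl /sl'.
Qed.

Theorem mainTheorem5
  (R : realType)
  (p m : nat) (p_prime : prime p) (m_gt0 : (0 < m)%N)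
  (Fq : finFieldType) (card_Fq : #|Fq| = (p ^ m)%N)
  (E : fieldType) (iE : {rmorphism Fq -> E})
  (curve_E : curve_function_field iE)
  (infty : E -> int) (infty_point : dvaluation infty)
  (K : countFieldType) (chK : p \in [pchar K])
  (U : set (K -> int)) (d : (K -> int) -> R)
  (U_coherent : coherent_good_set U d)
  (i : {rmorphism function_ring infty -> K})
  (phi : {rmorphism function_ring infty -> tpoly (qfrob m chK)})
  (phi_drinfeld : is_drinfeld_module i phi)
  (Kalg : closedFieldType) (j : {rmorphism K -> Kalg})
  (Kalg_algebraic : forall x, algebraicOver j x)
  (phi_pos : pos_rel_mod_trdeg (qfrob m (rmorph_pchar j chK)) j phi
               (field_of_constants U)) :
  exists T G : set (drinfeld_points phi),
    [/\ submodule T, finite_set T & torsion_set T] /\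
    [/\ submodule G, free_of_rank_aleph0 G & internal_direct_sum T G].
Proof.
have [hU _ _] := U_coherent; have [phi0 [a0 ha0]] := phi_drinfeld.
have q_gt1 : (1 < p ^ m)%N by rewrite -(exp1n m) ltn_exp2r ?prime_gt1.
have [r1 sa0] : exists r1, Defs.tsize (phi a0) = r1.+2.
  by move: ha0; case: Defs.tsize => [|[|r1]] // _; exists r1.
pose t := a0 * a0; pose r := (r1.+1 + r1.+1)%N.
have st : Defs.tsize (phi t) = r.+1 by rewrite /t rmorphM; exact: tsizeM.
have r_gt1 : (1 < r)%N by rewrite /r addSn addnS.
have r_gt0 : (0 < r)%N by exact: ltnW.
pose c := tcoef (phi t).
have cr0 : c r != 0 by exact: tcoef_lead.
pose M := drinfeld_points phi.
pose f (x : K) : K := (t *: (x : M)).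
have fE x : f x = \sum_(k < r.+1) c k * x ^+ ((p ^ m) ^ k).
  rewrite /f -[t *: _]/(tpoly_eval (qfrob m chK) (phi t) x) /tpoly_eval.
  rewrite -/(Defs.tsize (phi t)) st; apply: eq_bigr => k _.
  by rewrite iter_qfrob.
have fB x y : f (x - y) = f x - f y by exact: (scalerBr t (x : M) y).
have [n [v0 [nr cn0 Uv0 kn]]] := pos_trdeg_pole p_prime m_gt0 hU phi_pos st r_gt0.
have bad : exists2 v, U v & pole_radius R (p ^ m) r c v != 0.
  exists v0 => //; apply/eqP => b0.
  have := pole_radius_le R q_gt1 r_gt1 v0 (ltnW nr) cn0.
  by rewrite b0 mul0r oppr0 ler0z leNgt kn.
pose h : M -> R := canonical_height U d (p ^ m) r c f.
have h_ge0 x : 0 <= h x by exact: (canonical_height_ge0 hU).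
have hD x y : h (x + y) <= h x + h y.
  exact: (canonical_heightD hU q_gt1 r_gt1 cr0 fE fB).
pose Q := ((p ^ m) ^ r)%:R : R.
have Q3 : 3 <= Q by rewrite ler_nat; apply: ltnW; exact: Q_ge4.
have htx (x : M) : h (t *: x) = Q * h x.
  exact: (canonical_height_image hU q_gt1 r_gt1 cr0 fE).
have [eps eps0 [Z hZ]] := small_canonical_height hU q_gt1 r_gt1 cr0 fE fB bad.
have [u hu] := image_classes_infinite R q_gt1 r_gt1 cr0 fE (good_val hU Uv0).
pose iota : {rmorphism {poly Fq} -> function_ring infty} := poly_function iE t.
have hX (x : M) : h (iota 'X *: x) = Q * h x.
  by rewrite [iota 'X]poly_functionX htx.
have const_act b (x : M) : b != 0 ->
    function_const iE infty b *: x = (i (function_const iE infty b) * x : K).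
  move=> b0; set a := function_const iE infty b.
  have sa : Defs.tsize (phi a) = 1.
    apply: (@tsize_unit _ _ _ (phi (function_const iE infty b^-1))).
    by rewrite -!rmorphM mulfV // !rmorph1.
  rewrite -[a *: x]/(tpoly_eval (qfrob m chK) (phi a) x) /tpoly_eval.
  rewrite -/(Defs.tsize (phi a)) sa big_ord1 /=; congr (_ * _); exact: phi0.
have hC b (x : M) : b != 0 -> h (iota b%:P *: x) = h x.
  move=> b0; rewrite [iota _]poly_functionC const_act //.
  apply: (canonical_height_unit hU).
  - by rewrite -[i _]/((i \o function_const iE infty) b) fmorph_eq0.
  - move=> v Uv; rewrite -[i _]/((i \o function_const iE infty) b).
    exact: (val_finite_field (good_val hU Uv) (i \o function_const iE infty) b0).
  move=> y; rewrite -(const_act b y b0) -(const_act b (f y) b0) /f.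
  by rewrite !scalerA mulrC.
have h_small x : h x = 0 -> x \in Z by move=> e; apply: hZ; rewrite -/(h x) e.
have hpoly (P : {poly Fq}) (x : M) : P != 0 -> iota P *: x = 0 -> h x = 0.
  exact: (height_poly_eq0 Q3 h_ge0 hD hX hC).
(* If all heights vanished, K would lie in the finite list Z; but u is injective, as equal values
   would differ by f 0. *)
have [x0 hx0] : exists x0 : M, h x0 != 0.
  apply: contrapT => nex; have allZ x : x \in Z.
    by apply: h_small; apply/eqP/negPn/negP => hx; apply: nex; exists x.
  have inju : injective u.
    have f0 : f 0 = 0 by have := fB 0 0; rewrite !subrr.
    have H k l : (k < l)%N -> u k <> u l.
      by move=> kl e; apply: (hu k l kl); exists 0; rewrite e subrr f0.
    by move=> k l e; case: (ltngtP k l) => // [/H|/H/nesym].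
  have := @uniq_leq_size _ [seq u k | k <- seq.iota 0 (size Z).+1] Z.
  rewrite size_map size_iota ltnn map_inj_uniq // iota_uniq => H.
  by have : false by apply: H => // x _; exact: allZ.
have t_trans P : P != 0 -> poly_function iE t P != 0.
  move=> P0; apply: contraNneq hx0 => e; apply/eqP; apply: (hpoly P _ P0).
  by rewrite [iota P]e scale0r.
have domA := @function_ring_domain E infty.
have mult (a : function_ring infty) : a != 0 ->
    exists2 P : {poly Fq}, iota P != 0 & exists a', iota P = a * a'.
  by move=> /(function_divides_poly curve_E t) [P P0 aP]; exists P => //; exact: t_trans.
have tors (a : function_ring infty) (x : M) : a != 0 -> a *: x = 0 -> h x = 0.
  move=> /(function_divides_poly curve_E t) [P P0 [a' e]] ax; apply: (hpoly P _ P0).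
  by rewrite [iota P]e mulrC -scalerA ax scaler0.
have inj0 (a b : function_ring infty) : a *: x0 = b *: x0 -> a = b.
  move=> e; apply/eqP; rewrite -subr_eq0; apply: contraNT hx0 => ab0.
  by apply/eqP; apply: (tors _ _ ab0); rewrite scalerBl e subrr.
have fgM := closure_fg_height Q3 h_ge0 hD hX hC eps0
  (ex_intro _ (Z : seq M) hZ) domA.
have finA (P : {poly Fq}) : P != 0 -> finite_classes [set: function_ring infty]
    (fun a b => exists z, a - b = iota P * z).
  (* The height of A is pulled back along a -> a x0, which is injective because torsion has height
     0. *)
  pose hA (a : (function_ring infty)^o) : R := h ((a : function_ring infty) *: x0).
  have ZA : exists ZA : seq (function_ring infty)^o, forall a, hA a < eps -> a \in ZA.
    exists [seq xget (0 : (function_ring infty)^o)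
      [set a | (a : function_ring infty) *: x0 = z] | z <- (Z : seq M)].
    move=> a /hZ az; apply/mapP; exists (a *: x0 : M) => //.
    by case: xgetP => [b _ /= /inj0 ->|/(_ a) []].
  have hAD a b : hA (a + b) <= hA a + hA b.
    by rewrite /hA scalerDl; exact: hD.
  have hAX a : hA (iota 'X *: a) = Q * hA a.
    by rewrite /hA -[iota 'X *: a]/(iota 'X * a) -scalerA hX.
  have hAC b a : b != 0 -> hA (iota b%:P *: a) = hA a.
    by move=> b0; rewrite /hA -[iota b%:P *: a]/(iota b%:P * a) -scalerA hC.
  have [lA hlA] := function_finite_rank curve_E t_trans.
  have [l' _ sl'] := closure_fg_height (h := hA) Q3 (fun a => h_ge0 _)
    hAD hAX hAC eps0 ZA domA lA.
  move=> P0; have [T [cl hcl]] := span_over_classes iota l' P0.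
  exists T, cl => a b _ _; apply: hcl; apply: sl'; exact: hlA.
have idem (s b : function_ring infty) : b != 0 ->
    exists k c, s ^+ k.+1 * (1 - s ^+ k.+1) = b * c.
  move=> /(function_divides_poly curve_E t) [P P0 [b' e]]; apply: idempotent_power.
  apply: (finite_classesS (fun x hx => hx) _ (finA P P0)) => x y [z hz].
  by exists (b' * z); rewrite hz [iota P]e mulrA.
have fgA := @closure_fg_extension _ _ iota M domA mult
  (function_finite_rank curve_E t_trans) fgM.
have fgT (l : seq M) : exists2 l' : seq M,
    {in l', forall x, pure_closure [set: function_ring infty] l x} &
    pure_closure [set: function_ring infty] l `<=` span_over [set: function_ring infty] l'.
  by have [l' hl' sl'] := fgA l; exists l' => // x /sl'; exact: span_overS.
have inf_rank (l : seq M) : exists x, ~ pure_closure [set: function_ring infty] l x.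
  apply: contrapT => nex; have [l' _ sl'] := fgA l.
  have all_span x : span_over (range iota) l' x.
    by apply: sl'; apply: contrapT => nx; apply: nex; exists x.
  have X0 : 'X != 0 :> {poly Fq} by rewrite polyX_eq0.
  (* A finitely generated F_q[t]-module has finitely many classes modulo t, that is, modulo the
     image of f; the sequence u has infinitely many. *)
  have [k [k' [kk [z]]]] :=
    finite_classes_seq (u := (u : nat -> M)) (span_over_classes iota l' X0)
      (fun k => all_span _).
  rewrite [iota 'X]poly_functionX => hz; apply: (hu k k' kk); exists z; exact: hz.
pose en (k : nat) : M := odflt (0 : K) (unpickle k).
have enP (x : M) : exists k, en k = x.
  by exists (pickle (x : K)); rewrite /en pickleK.
have [G [subG freeG sumG]] := torsion_free_complement domA
  (function_ring_prufer curve_E t_trans) idem fgT inf_rank enP.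
(* The closure of the empty list is the torsion submodule; its elements have height 0 and so lie in
   Z. *)
exists (pure_closure [set: function_ring infty] [::]), G; split; split=> //.
- exact: cl_submodule.
- apply: (@sub_finite_set _ _ [set` Z]); last exact: finite_seq.
  by move=> x [a _ [an0 /= ax]]; exact/h_small/(tors _ _ an0 ax).
- by move=> x [a _ [an0 /= ax]]; exists a.
Qed.
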